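(* Let $p$ be a prime and $c$ a positive integer with $p>c$. There is a polynomial-time algorithm $A$ which, given the Cayley tables of two groups $G$ and $H$ from $\mathfrak{B}(p,c,N)$, outputs the Cayley tables of groups $A(G)$ and $A(H)$ in $\mathfrak{B}(p,2,\mathrm{poly}(N))$ (i.e. of order bounded by a polynomial in $N$), such that $G\cong H$ if and only if $A(G)\cong A(H)$.
   Context: For a prime $p$ and integers $c,N\ge 1$, $\mathfrak{B}(p,c,N)$ denotes the set of finite $p$-groups of nilpotency class $c$ (length of the lower central series), exponent $p$, and order $N$. Groups are given by their Cayley tables (full multiplication tables); polynomial time means polynomial in $N$.
   Formalization: The case p = 2, c = 1 is excluded: there the claim fails, since every group of exponent 2 is abelian, so no group of exponent 2 and nilpotency class 2 exists to serve as A(G), although B(2,1,N) is nonempty (e.g. the group of order 2). *)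

(* Defs.v *)
From HB Require Import structures.
From mathcomp Require Import all_boot all_order all_algebra.
From mathcomp Require Import all_fingroup all_solvable.

Set Implicit Arguments.
Unset Strict Implicit.
Unset Printing Implicit Defensive.

(** Random access machines, presented as structured programs.  A machine has
    registers (indexed by [nat], finitely many occurring in a given program)
    and a separate memory with indirect addressing; every cell holds a natural
    number.  The time is the uniform (unit) cost.  There is no multiplication
    instruction, so the bit length of the cells and addresses grows by at most
    one per step (beyond the largest constant of the program and of the input),
    and polynomial time here is polynomial time on Turing machines
    (Cook and Reckhow). *)

Inductive prog : Type :=
  | Const (x k : nat)           (* x := k *)
  | Copy (x y : nat)            (* x := y *)
  | Add (x y z : nat)           (* x := y + z *)
  | Sub (x y z : nat)           (* x := y - z, truncated at 0 *)
  | Fetch (x y : nat)            (* x := mem[y] *)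
  | Store (x y : nat)           (* mem[x] := y *)
  | Seq (P Q : prog)
  | If (x : nat) (P Q : prog)   (* P if x <> 0, else Q *)
  | While (x : nat) (P : prog). (* repeat P as long as x <> 0 *)

Record state := State { reg : nat -> nat; mem : nat -> nat }.

Definition upd (f : nat -> nat) (i v : nat) : nat -> nat :=
  fun j => if j == i then v else f j.

Definition set_reg (s : state) (x v : nat) := State (upd (reg s) x v) (mem s).
Definition set_mem (s : state) (a v : nat) := State (reg s) (upd (mem s) a v).

(** [exec P s t s']: started in [s], [P] halts after exactly [t] steps in
    [s']. *)
Inductive exec : prog -> state -> nat -> state -> Prop :=
  | ExecConst s x k : exec (Const x k) s 1 (set_reg s x k)
  | ExecCopy s x y : exec (Copy x y) s 1 (set_reg s x (reg s y))
  | ExecAdd s x y z : exec (Add x y z) s 1 (set_reg s x (reg s y + reg s z))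
  | ExecSub s x y z : exec (Sub x y z) s 1 (set_reg s x (reg s y - reg s z))
  | ExecFetch s x y : exec (Fetch x y) s 1 (set_reg s x (mem s (reg s y)))
  | ExecStore s x y : exec (Store x y) s 1 (set_mem s (reg s x) (reg s y))
  | ExecSeq P Q s1 s2 s3 t1 t2 of exec P s1 t1 s2 & exec Q s2 t2 s3 :
      exec (Seq P Q) s1 (t1 + t2) s3
  | ExecIfT x P Q s t s' of reg s x != 0 & exec P s t s' :
      exec (If x P Q) s t.+1 s'
  | ExecIfF x P Q s t s' of reg s x = 0 & exec Q s t s' :
      exec (If x P Q) s t.+1 s'
  | ExecWhileF x P s of reg s x = 0 : exec (While x P) s 1 s
  | ExecWhileT x P s1 s2 s3 t1 t2 of reg s1 x != 0 & exec P s1 t1 s2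
      & exec (While x P) s2 t2 s3 :
      exec (While x P) s1 (t1 + t2).+1 s3.

(** Words are passed through memory: cell 0 holds the length and the letters
    follow from cell 1 on.  Initially every other cell is 0. *)
Definition input_state (w : seq nat) : state :=
  State (fun=> 0) (fun i => nth 0 (size w :: w) i).

Definition output_word (s : state) : seq nat :=
  mkseq (fun i => mem s i.+1) (mem s 0).

Definition outputs_within (A : prog) (w : seq nat) (t : nat) (w' : seq nat) :
    Prop :=
  exists t' s', [/\ t' <= t, exec A (input_state w) t' s' & output_word s' = w'].

(** [w] is the multiplication table of [G], row by row, for some listing [s]
    of the elements of [G]; an element is named by its position in [s]. *)
Definition cayley_table (gT : finGroupType) (G : {group gT}) (w : seq nat) :
    Prop :=
  exists s : seq gT,
    [/\ uniq s, s =i G & w = [seq index (x * y)%g s | x <- s, y <- s]].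

(** Note that the nilpotency class is exactly [c]. *)
Definition in_B (p c N : nat) (gT : finGroupType) (G : {group gT}) : Prop :=
  [/\ (p.-group G)%g, nil_class G = c, exponent G = p & #|G| = N].

(** Programs are deterministic, so a program induces a partial function on
    words. *)
Lemma exec_det P s t1 s1 t2 s2 :
  exec P s t1 s1 -> exec P s t2 s2 -> t1 = t2 /\ s1 = s2.
Proof.
move=> e1; elim: e1 t2 s2 => {P s t1 s1}
  [s x k|s x y|s x y z|s x y z|s x y|s x y|P Q s1 s2 s3 t1 t2 _ IH1 _ IH2
  |x P Q s t s' x0 _ IH|x P Q s t s' x0 _ IH|x P s x0
  |x P s1 s2 s3 t1 t2 x0 _ IH1 _ IH2] t' r e; inversion e; subst=> //;
  try by match goal with
    | h : is_true (reg _ _ != 0), h' : reg _ _ = 0 |- _ => rewrite h' in h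
    end.
- by case: (IH1 _ _ ltac:(eassumption)) => -> ?; subst;
    case: (IH2 _ _ ltac:(eassumption)) => -> ->.
- by case: (IH _ _ ltac:(eassumption)) => -> ->.
- by case: (IH _ _ ltac:(eassumption)) => -> ->.
- by case: (IH1 _ _ ltac:(eassumption)) => -> ?; subst;
    case: (IH2 _ _ ltac:(eassumption)) => -> ->.
Qed.

(* Main.v *)
Require Import Defs.
From HB Require Import structures.
From mathcomp Require Import all_boot all_order all_algebra.
From mathcomp Require Import all_fingroup all_solvable all_character.
From mathcomp Require Import zify ring.

(** The Lazard correspondence is realised by group words.  In the free
    associative algebra over [F_p] truncated above degree [c < p], a unipotent
    [u] lies in the group generated by the [exp X_a] if and only if conjugation
    by [u] preserves Lie elements and [u^-1 E(u)] is Lie, with [E] the Euler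
    derivation.  Hence [exp (X + Y)] and [exp [X, Y]] are words in [exp X] and
    [exp Y].  By the Dynkin map this group is relatively free of class [c] and
    exponent [p], so the two words turn every such group [G] into a nilpotent
    Lie algebra [L] over [F_p], from which the group law is recovered.

    The group [A(G)] is the central extension of [V = L + F_p^2] by [L + L] with
    cocycle [([x, y] + s y, t y)].  The subspace [F_p^2] of [V] is recognised by
    centralizers, so an isomorphism induces a linear map [A] on [L] with
    [2 alpha A[x, y] = 2 [Ax, Ay] + a(x) Ay - a(y) Ax].  Nilpotency forces
    [a = 0], and [alpha^-1 A] is then an isomorphism of Lie algebras.  In class
    one the isomorphism type is determined by the order instead.

    Every entry of the table of [A(G)] is a fixed expression in the table of
    [G], so the algorithm is a nest of loops over that table. *)

Set Implicit Arguments.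
Unset Strict Implicit.
Unset Printing Implicit Defensive.

Import GRing.Theory.
Local Open Scope ring_scope.

(** * Truncated free associative algebras *)

(** The obstacle is to express the Lie operations by group words without the
    Baker-Campbell-Hausdorff series and its inversion; the bare existence of two words replaces
    them. These depend on [p] and [c] alone, so they enter the program as constants, and neither
    their shape nor their length affects polynomial time. They need no inverses, because the free
    object is built inside a finite algebra, of functions on words of length at most [c]. The bound
    [c < p] provides the inverses of [n!] in the exponential, those of the degree in the Euler and
    Dynkin arguments, and [u ^ p = 1] for unipotents. One scalar added to [L] would not do: with [s]
    alone, a nonzero vector of [F_p] and a generic vector both commute only with their multiples.
    With [t] as well, a nonzero vector of [F_p^2] commutes with a plane and a generic vector with a
    line. The case [p = 2], [c = 1] has to be excluded, since groups of exponent 2 are abelian and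
    the target has class 2. *)

Section Convolution.
Variables (A : eqType) (R : comNzRingType).
Implicit Types (f g h : seq A -> R) (w : seq A).

Definition shift f (a : A) : seq A -> R := fun u => f (a :: u).

(** Product of noncommutative series. The cut of the word moves letter by letter through [shift],
    which keeps sums over cut positions out of the proofs. *)
Fixpoint conv f g w : R :=
  if w is a :: w' then f [::] * g w + conv (shift f a) g w'
  else f [::] * g [::].

Lemma eq_conv f f' g g' w :
  (forall u, (size u <= size w)%N -> f u = f' u) ->
  (forall u, (size u <= size w)%N -> g u = g' u) ->
  conv f g w = conv f' g' w.
Proof.
elim: w f f' => [|a w IHw] f f' eqf eqg /=; first by rewrite eqf ?eqg.
rewrite eqf // eqg //; congr (_ + _).
by apply: IHw => u leuw; [apply: eqf | apply: eqg; apply: leqW].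
Qed.

Lemma convDl f f' g w : conv (fun u => f u + f' u) g w = conv f g w + conv f' g w.
Proof.
elim: w f f' => [|a w IHw] f f' /=; first by rewrite mulrDl.
by rewrite mulrDl IHw addrACA.
Qed.

Lemma convDr f g g' w : conv f (fun u => g u + g' u) w = conv f g w + conv f g' w.
Proof.
elim: w f => [|a w IHw] f /=; first by rewrite mulrDr.
by rewrite mulrDr IHw addrACA.
Qed.

Lemma convZl k f g w : conv (fun u => k * f u) g w = k * conv f g w.
Proof.
elim: w f => [|a w IHw] f /=; first by rewrite mulrA.
by rewrite IHw mulrDr mulrA.
Qed.

Lemma convZr k f g w : conv f (fun u => k * g u) w = k * conv f g w.
Proof.
elim: w f => [|a w IHw] f /=; first by rewrite mulrCA.
by rewrite IHw mulrDr mulrCA.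
Qed.

Lemma convA f g h w : conv f (conv g h) w = conv (conv f g) h w.
Proof.
elim: w f g => [|a w IHw] f g /=; first by rewrite mulrA.
rewrite IHw mulrDr mulrA -addrA; congr (_ + _).
by rewrite -convZl -convDl.
Qed.

Definition conv1 w : R := (w == [::])%:R.

Lemma conv0l g w : conv (fun=> 0) g w = 0.
Proof. by elim: w => [|a w IHw] /=; rewrite mul0r // [conv _ _ _]IHw addr0. Qed.

Lemma conv1l g w : conv conv1 g w = g w.
Proof. by case: w => [|a w] /=; rewrite mul1r // conv0l addr0. Qed.

Lemma conv1r f w : conv f conv1 w = f w.
Proof.
elim: w f => [|a w IHw] f /=; first by rewrite mulr1.
by rewrite mulr0 add0r IHw.
Qed.

Lemma conv_order k l f g w :
  (forall u, (size u < k)%N -> f u = 0) -> (forall u, (size u < l)%N -> g u = 0) ->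
  (size w < k + l)%N -> conv f g w = 0.
Proof.
elim: w k f => [|a w IHw] [|k] f ordf ordg ltw /=.
- by rewrite ordg ?mulr0.
- by rewrite ordf ?mul0r.
- rewrite (ordg (a :: w)) // mulr0 add0r.
  by apply: (IHw 0%N) => //; apply: ltn_trans ltw.
rewrite ordf // mul0r add0r; apply: (IHw k) => // u ltu; exact: ordf.
Qed.

(** In degree [k + l] every other cut leaves one factor below its order. *)
Lemma conv_leading k l f g w :
  (forall u, (size u < k)%N -> f u = 0) -> (forall u, (size u < l)%N -> g u = 0) ->
  size w = (k + l)%N -> conv f g w = f (take k w) * g (drop k w).
Proof.
elim: w k f => [|a w IHw] [|k] f ordf ordg //= szw.
  rewrite (@conv_order 0 l) ?addr0 //.
  by move: szw; rewrite add0n => <-.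
case: szw => szw; rewrite ordf // mul0r add0r (IHw k) // => u ltu; exact: ordf.
Qed.

Lemma conv_euler f g w :
  (size w)%:R * conv f g w =
  conv (fun u => (size u)%:R * f u) g w + conv f (fun u => (size u)%:R * g u) w.
Proof.
elim: w f => [|a w IHw] f; first by rewrite /= !mul0r mulr0 addr0.
rewrite /= mul0r mul0r add0r mulrDr.
have -> : conv (shift (fun u : seq A => (size u)%:R * f u) a) g w
   = conv (shift f a) g w + conv (fun u => (size u)%:R * shift f a u) g w.
  rewrite -convDl; apply: eq_conv => // u _.
  by rewrite /shift /= -addn1 natrD mulrDl mul1r addrC.
have := IHw (shift f a); rewrite [_.+1]/= -addn1 natrD; move: (conv (shift f a) g w) => x IHx.
by rewrite mulrDl mul1r [X in _ + X]mulrDl IHx; ring.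
Qed.

End Convolution.

Section TruncatedFreeAlgebra.
Variables (A : finType) (p c : nat).

(** Finite by construction, so that the unipotents form a [finGroupType] with its generated
    subgroups and lower central series. *)
Definition tfa := {ffun c.-bseq A -> 'F_p}.
HB.instance Definition _ := Finite.on tfa.
HB.instance Definition _ := GRing.Zmodule.on tfa.

Implicit Types (f g : tfa) (w : seq A).

(* Coefficient of [w]; zero beyond the truncation degree [c]. *)
Definition co f w : 'F_p := if insub w is Some b then f b else 0.
Definition mk (h : seq A -> 'F_p) : tfa := [ffun b : c.-bseq A => h b].

Lemma co_mk h w : (size w <= c)%N -> co (mk h) w = h w.
Proof. by move=> lew; rewrite /co (insubT (fun w => size w <= c)%N lew) ffunE. Qed.

Lemma co_big f w : (c < size w)%N -> co f w = 0.
Proof. by move=> ltw; rewrite /co insubF // leqNgt ltw. Qed.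

Lemma co_inj f g : (forall w, (size w <= c)%N -> co f w = co g w) -> f = g.
Proof.
move=> eqfg; apply/ffunP=> b; have := eqfg b (size_bseq b).
by rewrite /co valK.
Qed.

Lemma co0 w : co 0 w = 0.
Proof. by rewrite /co; case: insub => // b; rewrite ffunE. Qed.

Lemma coD f g w : co (f + g) w = co f w + co g w.
Proof. by rewrite /co; case: insub => [b|]; rewrite ?ffunE ?addr0. Qed.

Lemma coN f w : co (- f) w = - co f w.
Proof. by rewrite /co; case: insub => [b|]; rewrite ?ffunE ?oppr0. Qed.

Lemma coB f g w : co (f - g) w = co f w - co g w.
Proof. by rewrite coD coN. Qed.

Definition tfa_scale (k : 'F_p) f : tfa := mk (fun w => k * co f w).

Lemma co_scale k f w : co (tfa_scale k f) w = k * co f w.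
Proof.
case: (leqP (size w) c) => lew; first by rewrite co_mk.
by rewrite !co_big // mulr0.
Qed.

Fact tfa_scaleA a b f : tfa_scale a (tfa_scale b f) = tfa_scale (a * b) f.
Proof. by apply: co_inj => w _; rewrite !co_scale mulrA. Qed.
Fact tfa_scale1 : left_id 1 tfa_scale.
Proof. by move=> f; apply: co_inj => w _; rewrite co_scale mul1r. Qed.
Fact tfa_scaleDr : right_distributive tfa_scale +%R.
Proof. by move=> a f g; apply: co_inj => w _; rewrite coD !co_scale coD mulrDr. Qed.
Fact tfa_scaleDl f : {morph tfa_scale^~ f : a b / a + b}.
Proof. by move=> a b; apply: co_inj => w _; rewrite coD !co_scale mulrDl. Qed.

HB.instance Definition _ := GRing.Zmodule_isLmodule.Build 'F_p tfa
  tfa_scaleA tfa_scale1 tfa_scaleDr tfa_scaleDl.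

Lemma coZ k f w : co (k *: f) w = k * co f w.
Proof. exact: co_scale. Qed.

Definition tfa_one : tfa := mk (@conv1 A 'F_p).
Definition tfa_mul f g : tfa := mk (conv (co f) (co g)).

Lemma co_tfa_mul f g w : (size w <= c)%N -> co (tfa_mul f g) w = conv (co f) (co g) w.
Proof. exact: co_mk. Qed.

Fact tfa_mulA : associative tfa_mul.
Proof.
move=> f g h; apply: co_inj => w lew; rewrite !co_tfa_mul //.
transitivity (conv (co f) (conv (co g) (co h)) w).
  by apply: eq_conv => // u leu; rewrite co_tfa_mul // (leq_trans leu).
rewrite convA; apply: eq_conv => // u leu.
by rewrite co_tfa_mul // (leq_trans leu).
Qed.

Fact tfa_mul1l : left_id tfa_one tfa_mul.
Proof.
move=> f; apply: co_inj => w lew; rewrite co_tfa_mul // -[RHS]conv1l.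
by apply: eq_conv => // u leu; rewrite co_mk // (leq_trans leu).
Qed.

Fact tfa_mul1r : right_id tfa_one tfa_mul.
Proof.
move=> f; apply: co_inj => w lew; rewrite co_tfa_mul // -[RHS]conv1r.
by apply: eq_conv => // u leu; rewrite co_mk // (leq_trans leu).
Qed.

Fact tfa_mulDl : left_distributive tfa_mul +%R.
Proof.
move=> f g h; apply: co_inj => w lew; rewrite coD !co_tfa_mul // -convDl.
by apply: eq_conv => // u _; rewrite coD.
Qed.

Fact tfa_mulDr : right_distributive tfa_mul +%R.
Proof.
move=> f g h; apply: co_inj => w lew; rewrite coD !co_tfa_mul // -convDr.
by apply: eq_conv => // u _; rewrite coD.
Qed.

Fact tfa_one_neq0 : tfa_one != 0.
Proof.
apply/eqP=> /(congr1 (co^~ [::])) /eqP; by rewrite co0 co_mk ?oner_eq0.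
Qed.

HB.instance Definition _ := GRing.Zmodule_isNzRing.Build tfa
  tfa_mulA tfa_mul1l tfa_mul1r tfa_mulDl tfa_mulDr tfa_one_neq0.

Lemma coM f g w : (size w <= c)%N -> co (f * g) w = conv (co f) (co g) w.
Proof. exact: co_tfa_mul. Qed.

Fact tfa_scaleAl (k : 'F_p) f g : k *: (f * g) = (k *: f) * g.
Proof.
apply: co_inj => w lew; rewrite coZ !coM // -convZl.
by apply: eq_conv => // u _; rewrite coZ.
Qed.

HB.instance Definition _ := GRing.Lmodule_isLalgebra.Build 'F_p tfa tfa_scaleAl.

Fact tfa_scaleAr (k : 'F_p) f g : k *: (f * g) = f * (k *: g).
Proof.
apply: co_inj => w lew; rewrite coZ !coM // -convZr.
by apply: eq_conv => // u _; rewrite coZ.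
Qed.

HB.instance Definition _ := GRing.Lalgebra_isAlgebra.Build 'F_p tfa tfa_scaleAr.

Lemma co1 w : co 1 w = (w == [::])%:R.
Proof.
case: (leqP (size w) c) => lew; first by rewrite co_mk.
by rewrite co_big //; case: w lew.
Qed.

Definition gen (a : A) : tfa := mk (fun w => (w == [:: a])%:R).

(** Membership in the [k]-th power of the augmentation ideal, which is zero from [k = c.+1] on. *)
Definition ord_ge k f := forall w, (size w < k)%N -> co f w = 0.

Lemma ordge0 k : ord_ge k 0. Proof. by move=> w _; rewrite co0. Qed.
Lemma ordgeD k f g : ord_ge k f -> ord_ge k g -> ord_ge k (f + g).
Proof. by move=> kf kg w ltw; rewrite coD kf ?kg ?addr0. Qed.
Lemma ordgeN k f : ord_ge k f -> ord_ge k (- f).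
Proof. by move=> kf w ltw; rewrite coN kf ?oppr0. Qed.
Lemma ordgeB k f g : ord_ge k f -> ord_ge k g -> ord_ge k (f - g).
Proof. by move=> kf kg; apply: ordgeD => //; apply: ordgeN. Qed.
Lemma ordgeZ k x f : ord_ge k f -> ord_ge k (x *: f).
Proof. by move=> kf w ltw; rewrite coZ kf ?mulr0. Qed.
Lemma ordge_le k l f : (k <= l)%N -> ord_ge l f -> ord_ge k f.
Proof. by move=> lekl lf w ltw; apply: lf; apply: leq_trans lekl. Qed.
Lemma ordge_sum I (r : seq I) (P : pred I) (F : I -> tfa) k :
  (forall i, P i -> ord_ge k (F i)) -> ord_ge k (\sum_(i <- r | P i) F i).
Proof. by move=> kF; elim/big_ind: _ => //; [apply: ordge0 | apply: ordgeD]. Qed.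
Lemma ordgeM k l f g : ord_ge k f -> ord_ge l g -> ord_ge (k + l) (f * g).
Proof.
move=> kf lg w ltw; case: (leqP (size w) c) => lew; last by rewrite co_big.
by rewrite coM // (conv_order kf lg).
Qed.
Lemma ordge_full f : ord_ge c.+1 f -> f = 0.
Proof. by move=> cf; apply: co_inj => w lew; rewrite co0 cf. Qed.
Lemma ordgeX k f n : ord_ge k f -> ord_ge (n * k) (f ^+ n).
Proof. by move=> kf; elim: n => [//|n IHn]; rewrite exprS mulSn; apply: ordgeM. Qed.
Lemma ordgeMl k f g : ord_ge k g -> ord_ge k (f * g).
Proof. by move=> kg; apply: (@ordgeM 0). Qed.
Lemma ordgeMr k f g : ord_ge k f -> ord_ge k (f * g).
Proof. by move=> kf; rewrite -[k]addn0; apply: ordgeM. Qed.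

Lemma ordge_gen a : ord_ge 1 (gen a).
Proof. by case=> // _; rewrite co_mk. Qed.

Lemma coM_leading k l f g w : ord_ge k f -> ord_ge l g -> size w = (k + l)%N ->
  (size w <= c)%N -> co (f * g) w = co f (take k w) * co g (drop k w).
Proof. by move=> kf lg szw lew; rewrite coM // (conv_leading kf lg). Qed.

Definition hc i f : tfa := mk (fun w => (size w == i)%:R * co f w).
Definition euler f : tfa := mk (fun w => (size w)%:R * co f w).

Lemma co_hc i f w : co (hc i f) w = (size w == i)%:R * co f w.
Proof.
case: (leqP (size w) c) => lew; first by rewrite co_mk.
by rewrite !co_big // mulr0.
Qed.

Lemma co_euler f w : co (euler f) w = (size w)%:R * co f w.
Proof.
case: (leqP (size w) c) => lew; first by rewrite co_mk.
by rewrite !co_big // mulr0.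
Qed.

Lemma eulerD f g : euler (f + g) = euler f + euler g.
Proof. by apply: co_inj => w _; rewrite coD !co_euler coD mulrDr. Qed.

Lemma eulerZ k f : euler (k *: f) = k *: euler f.
Proof. by apply: co_inj => w _; rewrite coZ !co_euler coZ mulrCA. Qed.

Lemma eulerM f g : euler (f * g) = euler f * g + f * euler g.
Proof.
apply: co_inj => w lew; rewrite coD co_euler !coM // conv_euler.
by congr (_ + _); apply: eq_conv => // u _; rewrite co_euler.
Qed.

Lemma euler1 : euler 1 = 0.
Proof.
by apply: co_inj => w _; rewrite co_euler co1 co0; case: w => [|a w]; rewrite ?mul0r ?mulr0.
Qed.

Lemma ordge_euler k f : ord_ge k f -> ord_ge k (euler f).
Proof. by move=> kf w ltw; rewrite co_euler kf ?mulr0. Qed.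

Lemma hcD i f g : hc i (f + g) = hc i f + hc i g.
Proof. by apply: co_inj => w _; rewrite coD !co_hc coD mulrDr. Qed.

Lemma ordge_hcB i f : ord_ge i f -> ord_ge i.+1 (f - hc i f).
Proof.
move=> oif w; rewrite ltnS coB co_hc leq_eqVlt => /predU1P[->|ltw].
  by rewrite eqxx mul1r subrr.
by rewrite oif // mulr0 subrr.
Qed.

End TruncatedFreeAlgebra.

(** * Substitution endomorphisms *)

Section Substitution.
Variables (A : finType) (p c : nat) (a : A -> tfa A p c).
Hypothesis ordge_a : forall x, ord_ge 1 (a x).
Implicit Types (h : seq A -> 'F_p).
Local Notation T := (tfa A p c).

(** Horner evaluation, at the elements [a x], of the part of [h] on words of length at most [k]. *)
Fixpoint evk k h : T :=
  h [::] *: 1 + (if k is k'.+1 then \sum_x a x * evk k' (shift h x) else 0).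

Lemma eq_evk k h h' :
  (forall u, (size u <= k)%N -> h u = h' u) -> evk k h = evk k h'.
Proof.
elim: k h h' => [|k IHk] h h' eqh /=; rewrite eqh //.
by congr (_ + _); apply: eq_bigr => x _; congr (_ * _); apply: IHk => u leu; apply: eqh.
Qed.

Lemma evkD k h h' : evk k (fun u => h u + h' u) = evk k h + evk k h'.
Proof.
elim: k h h' => [|k IHk] h h' /=; first by rewrite !addr0 scalerDl.
rewrite scalerDl addrACA -big_split; congr (_ + _).
by apply: eq_bigr => x _ /=; rewrite -mulrDr -IHk.
Qed.

Lemma evkZ k z h : evk k (fun u => z * h u) = z *: evk k h.
Proof.
elim: k h => [|k IHk] h /=; first by rewrite !addr0 scalerA.
rewrite scalerDr scalerA scaler_sumr; congr (_ + _).
by apply: eq_bigr => x _; rewrite scalerAr -IHk.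
Qed.

Lemma evk_stable k l h : ord_ge k.+1 (evk (k + l) h - evk k h).
Proof.
elim: k h => [|k IHk] h /=.
  rewrite addr0 add0n; case: l => [|l] /=; first by rewrite addr0 subrr; apply: ordge0.
  by rewrite addrC addKr; apply: ordge_sum => x _; apply: ordgeMr.
rewrite opprD addrACA subrr add0r -sumrB; apply: ordge_sum => x _.
by rewrite -mulrBr -add1n; apply: ordgeM.
Qed.

(** Only the left factor is cut at [k], so that the induction follows the recursion of [conv]; at
    [k = c] the error has order above [c] and vanishes. *)
Lemma evk_conv k h h' : (k <= c)%N ->
  ord_ge k.+1 (evk k (conv h h') - evk k h * evk c h').
Proof.
have stable j : (j <= c)%N -> ord_ge j.+1 (evk j h' - evk c h').
  move=> lejc; rewrite -opprB; apply: ordgeN.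
  by have := @evk_stable j (c - j)%N h'; rewrite (subnKC lejc).
elim: k h => [|k IHk] h lek.
  rewrite /= !addr0 -scalerA -scalerAl -scalerBr mul1r; apply: ordgeZ.
  by rewrite -[h' [::] *: 1]addr0; apply: (stable 0%N).
have -> : evk k.+1 (conv h h') = h [::] *: evk k.+1 h' +
    \sum_x a x * evk k (conv (shift h x) h').
  rewrite /= scalerDr scalerA -addrA; congr (_ + _).
  rewrite scaler_sumr -big_split; apply: eq_bigr => x _ /=.
  by rewrite scalerAr -evkZ -mulrDr -evkD.
rewrite [evk k.+1 h]/= mulrDl opprD addrACA -scalerAl mul1r -scalerBr.
apply: ordgeD; first by apply/ordgeZ/stable.
rewrite mulr_suml -sumrB; apply: ordge_sum => x _.
by rewrite -mulrA -mulrBr -add1n; apply: ordgeM (IHk _ (ltnW lek)).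
Qed.

Definition subst (f : T) : T := evk c (co f).

Lemma substM f g : subst (f * g) = subst f * subst g.
Proof.
rewrite /subst -(subrK (evk c (co f) * evk c (co g)) (evk c (co (f * g)))).
rewrite [X in X + _]ordge_full ?add0r //.
rewrite (@eq_evk _ (co (f * g)) (conv (co f) (co g))) => [|u leu]; last by rewrite coM.
exact: evk_conv.
Qed.

Lemma substD f g : subst (f + g) = subst f + subst g.
Proof. by rewrite /subst -evkD; apply: eq_evk => u _; rewrite coD. Qed.

Lemma substZ z f : subst (z *: f) = z *: subst f.
Proof. by rewrite /subst -evkZ; apply: eq_evk => u _; rewrite coZ. Qed.

Lemma subst0 : subst 0 = 0.
Proof. by apply: (addrI (subst 0)); rewrite -substD !addr0. Qed.

Lemma evk0 k h : (forall u, h u = 0) -> evk k h = 0.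
Proof.
elim: k h => [|k IHk] h h0 /=; rewrite h0 scale0r ?addr0 // add0r.
by rewrite big1 // => x _; rewrite IHk ?mulr0 // => u; apply: h0.
Qed.

Lemma evk1 k h : (forall u, h u = (u == [::])%:R) -> evk k h = 1.
Proof.
case: k => [|k] h1 /=; rewrite h1 eqxx scale1r ?addr0 //.
rewrite big1 ?addr0 // => x _; rewrite evk0 ?mulr0 // => u.
by rewrite /shift h1.
Qed.

Lemma subst1 : subst 1 = 1.
Proof. by apply: evk1 => u; rewrite co1. Qed.

Lemma subst_gen x : (0 < c)%N -> subst (gen p c x) = a x.
Proof.
have evk_gen k : (0 < k)%N -> evk k (fun w => (w == [:: x])%:R) = a x.
  case: k => // k _ /=; rewrite scale0r add0r (bigD1 x) //= evk1 ?mulr1 => [|u].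
    rewrite big1 ?addr0 // => y neqyx; rewrite evk0 ?mulr0 // => u.
    by rewrite /shift eqseq_cons (negPf neqyx).
  by rewrite /shift eqseq_cons eqxx.
move=> c_gt0; rewrite -(evk_gen _ c_gt0) /subst.
by apply: eq_evk => u leu; rewrite co_mk.
Qed.

End Substitution.

(** * Exponentials and the group of unipotents *)

Lemma truncated_cauchy_product (R : pzRingType) (c : nat) (U V : nat -> R) :
  (forall m k, (c < m + k)%N -> U m * V k = 0) ->
  (\sum_(0 <= m < c.+1) U m) * (\sum_(0 <= k < c.+1) V k) =
  \sum_(0 <= n < c.+1) \sum_(0 <= k < n.+1) U (n - k)%N * V k.
Proof.
move=> UV0; rewrite mulr_sumr.
transitivity (\sum_(0 <= k < c.+1) \sum_(0 <= n < c.+1 | (k < n.+1)%N) U (n - k)%N * V k).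
  apply: eq_big_nat => k /andP[_ ltk]; rewrite mulr_suml.
  rewrite -(@big_nat_widenl _ _ _ k 0 c.+1 predT) // -{2}[k]add0n big_addn.
  rewrite [LHS](@big_cat_nat _ _ _ (c.+1 - k)%N) ?leq_subr //= [X in _ + X = _]big_nat [X in _ + X = _]big1.
    by rewrite addr0; apply: eq_bigr => m _; rewrite addnK.
  by move=> m /andP[lem _]; rewrite UV0 //; lia.
rewrite (exchange_big_dep_nat predT) //=.
apply: eq_big_nat => n /andP[_ ltn].
by rewrite [RHS](@big_nat_widen _ _ _ 0 n.+1 c.+1).
Qed.

Section Exponential.
Variables (A : finType) (p c : nat).
Local Notation T := (tfa A p c).
Implicit Types (f g x y : T).

(** For [c < p] every factorial that occurs is invertible, so the convention for the inverse of 0 is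
    never met. *)
Definition texp f : T := \sum_(0 <= n < c.+1) (n`!%:R)^-1 *: f ^+ n.

Lemma texp0 : texp 0 = 1.
Proof.
rewrite /texp big_nat_recl // fact0 invr1 scale1r expr0 big1 ?addr0 // => n _.
by rewrite expr0n scaler0.
Qed.

Lemma ordge_texp k f : (0 < k)%N -> ord_ge k f -> ord_ge k (texp f - 1).
Proof.
move=> k_gt0 kf; rewrite /texp big_nat_recl // fact0 invr1 scale1r expr0 addrC addKr.
apply: ordge_sum => n _; apply: ordgeZ; rewrite exprS; exact: ordgeMr.
Qed.

Hypothesis c_gt0 : (0 < c)%N.

Lemma texp_leading k f : (0 < k)%N -> ord_ge k f -> ord_ge k.+1 (texp f - (1 + f)).
Proof.
move=> k_gt0 kf; rewrite /texp big_ltn // big_ltn // fact0 (factS 0) invr1 !scale1r expr0 expr1.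
rewrite addrA (addrC (1 + f)) addrK big_nat; apply: ordge_sum => -[|[|n]] // _; apply: ordgeZ.
rewrite -addn2 exprD; apply: ordgeMl; rewrite expr2; apply: (ordge_le _ (ordgeM kf kf)); lia.
Qed.

Lemma ordge_exprB i x y n : (0 < i)%N -> ord_ge 1 x -> ord_ge i y -> (0 < n)%N ->
  ord_ge (i + n.-1) ((x + y) ^+ n - x ^+ n).
Proof.
move=> i_gt0 ox oy; case: n => // n _; elim: n => [|n IHn].
  by rewrite !expr1 addrC addKr addn0.
rewrite exprS [x ^+ n.+2]exprS.
have -> : (x + y) * (x + y) ^+ n.+1 - x * x ^+ n.+1 =
  x * ((x + y) ^+ n.+1 - x ^+ n.+1) + y * (x + y) ^+ n.+1.
  by rewrite mulrDl mulrBr addrAC.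
apply: ordgeD; first by rewrite /= addnS -add1n; apply: ordgeM.
apply: (ordgeM oy _); rewrite -[(n.+2).-1]muln1; apply: ordgeX.
by apply: ordgeD => //; apply: (ordge_le _ oy).
Qed.

(** In [(x + y) ^+ n - x ^+ n] each term has a factor [y] and [n - 1] further factors of order at
    least 1, so only [n = 1] counts in degree [i]. *)
Lemma texp_addr i x y : (0 < i)%N -> ord_ge 1 x -> ord_ge i y ->
  ord_ge i.+1 (texp (x + y) - texp x * (1 + y)).
Proof.
move=> i_gt0 ox oy.
have -> : texp (x + y) - texp x * (1 + y) =
    (texp (x + y) - texp x - y) - (texp x - 1) * y.
  by rewrite mulrDr mulr1 mulrBl mul1r opprB opprD !addrA subrK.
apply: ordgeB; last by rewrite -add1n; apply: ordgeM => //; apply: ordge_texp.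
have ordge_tail n : ord_ge i.+1 ((x + y) ^+ n.+2 - x ^+ n.+2).
  by apply: (ordge_le _ (ordge_exprB i_gt0 ox oy _)); rewrite //= addnS ltnS leq_addr.
rewrite -[texp (x + y) - _]sumrB big_ltn // big_ltn //.
rewrite !expr0 subrr add0r !expr1 (factS 0) fact0 invr1 !scale1r.
have -> : x + y - x = y by rewrite addrC addKr.
rewrite (addrC y) addrK big_nat; apply: ordge_sum => -[|[|n]] // _.
by rewrite -scalerBr; apply: ordgeZ.
Qed.

Hypotheses (p_prime : prime p) (c_lt_p : (c < p)%N).

Lemma natr_Fp_neq0 n : (0 < n <= c)%N -> n%:R != 0 :> 'F_p.
Proof.
case/andP=> n_gt0 len; rewrite -(dvdn_pcharf (pchar_Fp p_prime)).
by rewrite gtnNdvd // (leq_ltn_trans len).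
Qed.

Lemma fact_Fp_neq0 n : (n <= c)%N -> n`!%:R != 0 :> 'F_p.
Proof.
elim: n => [|n IHn] len; first by rewrite oner_neq0.
by rewrite factS natrM mulf_neq0 ?IHn ?natr_Fp_neq0 // ltnW.
Qed.

Lemma texpD_comm x y : ord_ge 1 x -> ord_ge 1 y -> GRing.comm x y ->
  texp (x + y) = texp x * texp y.
Proof.
move=> ox oy cxy; rewrite truncated_cauchy_product; last first.
  move=> m k lt_c; rewrite -scalerAl -scalerAr [_ * _]ordge_full ?scaler0 //.
  by have := ordgeM (ordgeX (n := m) ox) (ordgeX (n := k) oy); rewrite !muln1; apply: ordge_le.
apply: eq_big_nat => n /andP[_ ltn]; rewrite (exprDn_comm _ cxy) scaler_sumr big_mkord.
apply: eq_bigr => k _; rewrite -scalerAl -scalerAr scalerA -scaler_nat scalerA.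
congr (_ *: _); have lekn : (k <= n)%N by rewrite -ltnS.
have := bin_fact lekn; move/(congr1 (fun m => m%:R : 'F_p)); rewrite !natrM => <-.
have kn0 : ((n - k)`!%:R : 'F_p) != 0 by apply: fact_Fp_neq0; lia.
have k0 : (k`!%:R : 'F_p) != 0 by apply: fact_Fp_neq0; lia.
have b0 : ('C(n, k)%:R : 'F_p) != 0.
  apply: contraTneq (fact_Fp_neq0 (ltnSE ltn)) => b0; rewrite negbK.
  by rewrite -(bin_fact lekn) natrM b0 mul0r.
by field; rewrite kn0 k0 b0.
Qed.

Lemma texpN x : ord_ge 1 x -> texp x * texp (- x) = 1.
Proof.
move=> ox; rewrite -texpD_comm ?subrr ?texp0 //; first exact: ordgeN.
exact: commrN.
Qed.

Lemma texpMn x n : ord_ge 1 x -> texp (x *+ n) = texp x ^+ n.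
Proof.
move=> ox; elim: n => [|n IHn]; first by rewrite mulr0n texp0.
rewrite mulrS texpD_comm ?IHn ?exprS //; last exact: commrMn.
by elim: n {IHn} => [|n IHn]; [apply: ordge0 | rewrite mulrS; apply: ordgeD].
Qed.

(** This is [[f, y]], the right adjoint action, matching conjugation [u^-1 f u] and left-normed
    commutators. *)
Definition ad y f := f * y - y * f.

Lemma iter_ad_ordge y f k : ord_ge 1 y -> ord_ge k (iter k (ad y) f).
Proof.
move=> oy; elim: k => [//|k IHk] /=; rewrite /ad.
by apply: ordgeB; [rewrite -addn1 | rewrite -add1n]; apply: ordgeM.
Qed.

(** Divided powers turn the rule for moving [f] past [y ^+ n] into a convolution without binomial
    coefficients. *)
Definition dpow y n := (n`!%:R : 'F_p)^-1 *: y ^+ n.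
Definition dad y f k := (k`!%:R : 'F_p)^-1 *: iter k (ad y) f.

Lemma dpowS y n : (n < c)%N -> dpow y n * y = n.+1%:R *: dpow y n.+1.
Proof.
move=> ltn; rewrite /dpow -scalerAl -exprSr scalerA factS natrM invfM mulrA.
by rewrite mulfV ?mul1r ?natr_Fp_neq0.
Qed.

Lemma dadS y f k : (k < c)%N -> dad y f k * y = y * dad y f k + k.+1%:R *: dad y f k.+1.
Proof.
move=> ltk; rewrite /dad scalerA factS natrM invfM mulrA mulfV ?natr_Fp_neq0 //.
rewrite mul1r -scalerAl -scalerAr -scalerDr /= {2}/ad; congr (_ *: _).
by rewrite addrC subrK.
Qed.

Lemma mul_dpow y f n : (n <= c)%N ->
  f * dpow y n = \sum_(0 <= k < n.+1) dpow y (n - k) * dad y f k.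
Proof.
elim: n => [|n IHn] len; first by rewrite big_nat1 /dpow /dad /= fact0 invr1 !scale1r mulr1 mul1r.
(* Both sides are multiplied by [n + 1], which splits as [(n + 1 - k) + k] on the [k]-th term: one
   part comes from a higher power of [y], the other from one more [ad y]. *)
apply: (scalerI (natr_Fp_neq0 (n := n.+1) _)) => //.
rewrite scalerAr -dpowS // mulrA IHn 1?ltnW // mulr_suml scaler_sumr.
transitivity (\sum_(0 <= k < n.+1) (n.+1 - k)%:R *: (dpow y (n.+1 - k) * dad y f k)
  + \sum_(0 <= k < n.+1) k.+1%:R *: (dpow y (n.+1 - k.+1) * dad y f k.+1)).
  rewrite -big_split; apply: eq_big_nat => k /andP[_ ltk] /=.
  rewrite -mulrA dadS; last by apply: leq_trans len.
  rewrite mulrDr mulrA dpowS; last by apply: leq_trans len; lia.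
  by rewrite -subSn // subSS scalerAl scalerAr.
rewrite -[X in _ = X]/(\sum_(0 <= k < n.+2) _).
have -> : \sum_(0 <= k < n.+1) k.+1%:R *: (dpow y (n.+1 - k.+1) * dad y f k.+1) =
   \sum_(0 <= k < n.+2) k%:R *: (dpow y (n.+1 - k) * dad y f k).
  by rewrite [RHS]big_nat_recl // scale0r add0r.
have -> : \sum_(0 <= k < n.+1) (n.+1 - k)%:R *: (dpow y (n.+1 - k) * dad y f k) =
   \sum_(0 <= k < n.+2) (n.+1 - k)%:R *: (dpow y (n.+1 - k) * dad y f k).
  by rewrite [RHS]big_nat_recr //= subnn scale0r addr0.
rewrite -big_split; apply: eq_big_nat => k /andP[_ ltk] /=.
by rewrite -scalerDl -natrD subnK.
Qed.

(** Conjugation by [exp y] is [exp (ad y)]: the diagonals of the product are the sums in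
    [mul_dpow]. *)
Lemma texp_adjoint y f : ord_ge 1 y ->
  f * texp y = texp y * \sum_(0 <= k < c.+1) dad y f k.
Proof.
move=> oy; rewrite -[texp y]/(\sum_(0 <= n < c.+1) dpow y n) truncated_cauchy_product.
  by rewrite mulr_sumr; apply: eq_big_nat => n /andP[_ ltn]; apply: mul_dpow.
move=> m k lt_c; rewrite -scalerAl -scalerAr [_ * _]ordge_full ?scaler0 //.
by have := ordgeM (ordgeX (n := m) oy) (@iter_ad_ordge y f k oy); rewrite !muln1; apply: ordge_le.
Qed.

(** The hypothesis makes [euler y] a multiple of [y], so the two commute and the chain rule holds
    for [exp]. *)
Lemma euler_texp y (i : 'F_p) : ord_ge 1 y -> euler y = i *: y ->
  euler (texp y) = texp y * euler y.
Proof.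
move=> oy Ey; rewrite Ey.
have EX n : euler (y ^+ n) = (n%:R * i) *: y ^+ n.
  elim: n => [|n IHn]; first by rewrite expr0 euler1 mul0r scale0r.
  by rewrite exprS eulerM IHn Ey -scalerAl -scalerAr -exprS -scalerDl -natr1 mulrDl mul1r addrC.
have Esum n : euler (\sum_(0 <= k < n) dpow y k) = \sum_(0 <= k < n) i *: (k%:R *: dpow y k).
  elim: n => [|n IHn]; first by rewrite !big_geq //; apply: (addrI (euler 0)); rewrite -eulerD !addr0.
  rewrite !big_nat_recr //= eulerD IHn eulerZ EX /dpow !scalerA; congr (_ + _ *: _); ring.
rewrite -[texp y]/(\sum_(0 <= k < c.+1) dpow y k) Esum big_nat_recl // scale0r scaler0 add0r.
(* The index shift leaves a multiple of [y ^+ c.+1], which lies beyond the truncation. *)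
rewrite big_nat_recr //= mulrDl [X in _ + X]ordge_full ?addr0; last first.
  rewrite /dpow -scalerAl -scalerAr -exprSr; apply/ordgeZ/ordgeZ.
  by have := ordgeX (n := c.+1) oy; rewrite muln1.
rewrite mulr_suml; apply: eq_big_nat => k /andP[_ ltk].
by rewrite -scalerAr dpowS.
Qed.

End Exponential.

Lemma subst_texp (A : finType) (p c : nat) (a : A -> tfa A p c) f :
  (forall x, ord_ge 1 (a x)) -> subst a (texp f) = texp (subst a f).
Proof.
move=> oa; rewrite /texp.
have substX n : subst a (f ^+ n) = subst a f ^+ n.
  by elim: n => [|n IHn]; rewrite ?subst1 // !exprS substM // IHn.
elim: c.+1 => [|n IHn]; first by rewrite !big_geq // subst0.
by rewrite !big_nat_recr //= substD IHn substZ substX.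
Qed.

Section MagnusGroup.
Variables (A : finType) (p c : nat).
Local Notation T := (tfa A p c).

Definition magnus := {f : T | co f [::] == 1}.
HB.instance Definition _ := Finite.on magnus.
Implicit Types u v : magnus.

Lemma magnus_ordge u : ord_ge 1 (val u - 1).
Proof. by case=> // _; rewrite coB (eqP (valP u)) co1 subrr. Qed.

Lemma ordge_magnus (f : T) : ord_ge 1 (f - 1) -> co f [::] == 1.
Proof. by move=> /(_ [::] isT); rewrite coB co1 => /subr0_eq->. Qed.

Fact magnus_mul_subproof u v : co (val u * val v) [::] == 1.
Proof. by rewrite coM //= (eqP (valP u)) (eqP (valP v)) mulr1. Qed.

Definition magnus_mul u v : magnus := exist (fun f : T => co f [::] == 1) _ (magnus_mul_subproof u v).

Fact magnus_one_subproof : co (1 : T) [::] == 1. Proof. by rewrite co1. Qed.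
Definition magnus_one : magnus := exist (fun f : T => co f [::] == 1) _ magnus_one_subproof.

Fact magnus_inv_subproof u : co (\sum_(i < c.+1) (1 - val u) ^+ i) [::] == 1.
Proof.
apply: ordge_magnus; rewrite big_ord_recl expr0 addrC addKr.
apply: ordge_sum => i _; rewrite lift0 exprS; apply: ordgeMr.
by rewrite -opprB; apply/ordgeN/magnus_ordge.
Qed.
Definition magnus_inv u : magnus := exist (fun f : T => co f [::] == 1) _ (magnus_inv_subproof u).

Fact magnus_mulA : associative magnus_mul.
Proof. by move=> u v w; apply: val_inj; rewrite /= mulrA. Qed.
Fact magnus_mul1 : left_id magnus_one magnus_mul.
Proof. by move=> u; apply: val_inj; rewrite /= mul1r. Qed.
Fact magnus_mulV : left_inverse magnus_one magnus_inv magnus_mul.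
Proof.
move=> u; apply: val_inj => /=; set x := 1 - val u.
have -> : val u = 1 - x by rewrite opprB addrC subrK.
have cx : GRing.comm (1 - x) (\sum_(i < c.+1) x ^+ i).
  apply: commr_sum => i _; apply: commrX; apply: commr_sym.
  by apply: commrB => //; exact: commr1.
rewrite -cx -opprB mulNr -subrX1 [x ^+ _]ordge_full ?sub0r ?opprK //.
have xo : ord_ge 1 x by rewrite /x -opprB; apply/ordgeN/magnus_ordge.
by have := ordgeX (n := c.+1) xo; rewrite muln1.
Qed.

HB.instance Definition _ := Finite_isGroup.Build magnus
  magnus_mulA magnus_mul1 magnus_mulV.

Lemma val_magnusM u v : val (u * v)%g = val u * val v. Proof. by []. Qed.
Lemma val_magnus1 : val (1%g : magnus) = 1. Proof. by []. Qed.

Lemma val_magnusX u n : val (u ^+ n)%g = val u ^+ n.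
Proof. by elim: n => [|n IHn]; rewrite ?expg0 // expgS exprS val_magnusM IHn. Qed.

Lemma magnusV u : val (u^-1)%g * val u = 1.
Proof. by rewrite -val_magnusM mulVg. Qed.

(** By Frobenius, [(1 + x) ^ p = 1 + x ^ p], and [x ^ p] has order at least [p > c]. *)
Lemma magnus_exponent u : prime p -> (c < p)%N -> (u ^+ p)%g = 1%g.
Proof.
move=> p_pr ltcp; apply: val_inj; rewrite val_magnusX val_magnus1.
have pT : p \in [pchar T].
  rewrite inE /= p_pr /=; apply/eqP; apply: co_inj => w _.
  by rewrite -scaler_nat (pchar_Fp_0 p_pr) scale0r.
have /(pFrobenius_autD_comm pT) : GRing.comm 1 (val u - 1) by exact/commr_sym/commr1.
rewrite addrC subrK pFrobenius_autE => ->.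
rewrite !pFrobenius_autE expr1n [X in _ + X]ordge_full ?addr0 //.
by have := ordgeX (n := p) (magnus_ordge u); rewrite muln1; apply: ordge_le.
Qed.

(** The default of [insubd] is never reached when [f] has no constant term. *)
Definition mexp (f : T) : magnus := insubd magnus_one (texp f).

Lemma val_mexp f : ord_ge 1 f -> val (mexp f) = texp f.
Proof.
by move=> of1; rewrite insubdK //; apply: ordge_magnus; apply: ordge_texp.
Qed.

End MagnusGroup.

(** * Lie elements and words *)

Definition wprod (A : Type) (gT : finGroupType) (g : A -> gT) (w : seq A) : gT :=
  (\prod_(a <- w) g a)%g.

(** In a finite group inverses are positive powers, so positive words suffice. *)
Lemma gen_wordP (A : finType) (gT : finGroupType) (g : A -> gT) (x : gT) :
  reflect (exists w, x = wprod g w) (x \in <<[set g a | a : A]>>%g).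
Proof.
apply: (iffP idP) => [|[w ->]]; last first.
  by apply: group_prod => a _; apply: mem_gen; apply/imsetP; exists a.
case/gen_prodgP=> n [F inF ->]; rewrite /wprod.
elim: n F inF => [|n IHn] F inF; first by exists [::]; rewrite big_ord0 big_nil.
have [w eqw] := IHn (fun i => F (lift ord0 i)) (fun i => inF _).
have /imsetP[a _ eqa] := inF ord0.
by exists (a :: w); rewrite big_ord_recl big_cons eqw eqa.
Qed.

(** [ring] needs a commutative ring; on coefficients the noncommutative products become atoms with
    values in ['F_p]. *)
Ltac tfa_zmod := apply: co_inj => ? _; rewrite !(coB, coD, coN); ring.

Section LieElements.
Variables (A : finType) (p c : nat).
Local Notation T := (tfa A p c).
Local Notation X := (gen p c).
Implicit Types (f g x y : T) (u v : magnus A p c).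

Lemma ad0l f : ad 0 f = 0. Proof. by rewrite /ad mulr0 mul0r subrr. Qed.
Lemma ad0r y : ad y 0 = 0. Proof. by rewrite /ad mulr0 mul0r subrr. Qed.
Lemma adDl y y' f : ad (y + y') f = ad y f + ad y' f.
Proof. by rewrite /ad mulrDr mulrDl opprD addrACA. Qed.
Lemma adDr y f f' : ad y (f + f') = ad y f + ad y f'.
Proof. by rewrite /ad mulrDr mulrDl opprD addrACA. Qed.

Lemma ad_ad y x f : ad (ad x y) f = ad x (ad y f) - ad y (ad x f).
Proof.
by rewrite /ad !mulrBr !mulrBl !mulrA; tfa_zmod.
Qed.

(** Homogeneous Lie elements of degree [i], as sums of left-normed brackets of generators; over the
    prime field scalars are repeated sums. *)
Inductive lie : nat -> T -> Prop :=
  | lie_gen a : lie 1 (X a)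
  | lie_zero i : lie i.+1 0
  | lie_add i f g of lie i f & lie i g : lie i (f + g)
  | lie_ad i f a of lie i f : lie i.+1 (ad (X a) f).

Lemma scale_Fp (k : 'F_p) f : k *: f = f *+ (k : nat).
Proof. by rewrite -scaler_nat natr_Zp. Qed.

Lemma lie_gt0 i f : lie i f -> (0 < i)%N.
Proof. by elim. Qed.

Lemma lieZ i k f : lie i f -> lie i (k *: f).
Proof.
move=> lf; rewrite scale_Fp; elim: (nat_of_ord k) => [|n IHn].
  by rewrite mulr0n -(prednK (lie_gt0 lf)); apply: lie_zero.
by rewrite mulrS; apply: lie_add.
Qed.

Lemma lie_ordge i f : lie i f -> ord_ge i f.
Proof.
elim=> {i f} [a|i|i f g _ IHf _ IHg|i f a _ IHf].
- exact: ordge_gen.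
- exact: ordge0.
- exact: ordgeD.
by apply: ordgeB; [rewrite -addn1 | rewrite -add1n]; apply: ordgeM => //; exact: ordge_gen.
Qed.

Lemma lie_euler i f : lie i f -> euler f = i%:R *: f.
Proof.
have euler_gen a : euler (X a) = X a.
  apply: co_inj => w lew; rewrite co_euler co_mk //.
  by case: eqP => [->|]; rewrite ?mulr1 ?mulr0.
have eulerB g h : euler (g - h) = euler g - euler h.
  by apply: co_inj => w _; rewrite coB !co_euler coB mulrBr.
elim=> {i f} [a|i|i f g _ IHf _ IHg|i f a _ IHf].
- by rewrite euler_gen scale1r.
- by rewrite scaler0; apply: (addrI (euler 0)); rewrite -eulerD !addr0.
- by rewrite eulerD IHf IHg scalerDr.
rewrite /ad eulerB !eulerM IHf euler_gen -scalerAl -scalerAr -natr1 scalerDl scale1r scalerBr.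
by rewrite [X a * f + _]addrC opprD addrACA.
Qed.

(** By the Jacobi identity [ad_ad], a bracket with a left-normed bracket unfolds into brackets with
    generators. *)
Lemma lie_bracket i j f g : lie i f -> lie j g -> lie (i + j) (ad g f).
Proof.
move=> lf lg; elim: lg i f lf => {j g} [a|j|j g h _ IHg _ IHh|j g a _ IHg] i f lf.
- by rewrite addn1; apply: lie_ad.
- by rewrite ad0l addnS; apply: lie_zero.
- by rewrite adDl; apply: lie_add; [apply: IHg | apply: IHh].
rewrite ad_ad; apply: lie_add; first by rewrite addnS; apply/lie_ad/IHg.
by rewrite -scaleN1r addnS -addSn; apply/lieZ/IHg/lie_ad.
Qed.

Inductive isLie : T -> Prop :=
  | isLie_hom i f of lie i f : isLie f
  | isLie_add f g of isLie f & isLie g : isLie (f + g).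

Lemma isLie0 : isLie 0. Proof. exact: isLie_hom (lie_zero 0). Qed.

Lemma isLieZ k f : isLie f -> isLie (k *: f).
Proof.
elim=> {f} [i f lf|f g _ IHf _ IHg]; first exact: isLie_hom (lieZ k lf).
by rewrite scalerDr; apply: isLie_add.
Qed.

Lemma isLie_sum I (r : seq I) (P : pred I) (F : I -> T) :
  (forall i, P i -> isLie (F i)) -> isLie (\sum_(i <- r | P i) F i).
Proof. by move=> LF; elim/big_ind: _ => //; [apply: isLie0 | apply: isLie_add]. Qed.

Lemma isLie_ad f g : isLie f -> isLie g -> isLie (ad g f).
Proof.
move=> Lf; elim=> {g} [j g lg|g h _ IHg _ IHh]; last by rewrite adDl; apply: isLie_add.
elim: Lf => {f} [i f lf|f h _ IHf _ IHh]; first exact: isLie_hom (lie_bracket lf lg).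
by rewrite adDr; apply: isLie_add.
Qed.

Lemma isLie_ordge f : isLie f -> ord_ge 1 f.
Proof.
elim=> {f} [i f lf|f g _ IHf _ IHg]; last exact: ordgeD.
by apply: ordge_le (lie_ordge lf); apply: lie_gt0 lf.
Qed.

Hypotheses (p_prime : prime p) (c_lt_p : (c < p)%N) (c_gt0 : (0 < c)%N).

(** [f] has Euler eigenvalue [i], while the coefficient of [w] is scaled by [size w]; distinct
    degrees up to [c] stay distinct modulo [p]. *)
Lemma lie_hc i j f : (j <= c)%N -> lie i f -> hc j f = if j == i then f else 0.
Proof.
move=> lejc lf; apply: co_inj => w lew; rewrite co_hc.
have [szw|szw] := eqVneq (size w) j; last first.
  rewrite mul0r; case: eqP => [eqji|_]; last by rewrite co0.
  case: (leqP (size w) j) => [lewj|ltjw].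
    by rewrite (lie_ordge lf) // -eqji ltn_neqAle szw.
  have /(congr1 (fun g => co g w)) := lie_euler lf; rewrite co_euler coZ -eqji => /eqP.
  rewrite -subr_eq0 -mulrBl -natrB 1?ltnW // mulf_eq0.
  have /negPf-> : (size w - j)%:R != 0 :> 'F_p by apply: (natr_Fp_neq0 p_prime c_lt_p); lia.
  by move/eqP.
rewrite mul1r; case: eqP => // neqji; rewrite co0.
case: (leqP i j) => leij; last by rewrite (lie_ordge lf) // szw.
have /(congr1 (fun g => co g w)) := lie_euler lf; rewrite co_euler coZ szw => /eqP.
rewrite -subr_eq0 -mulrBl -natrB // mulf_eq0.
have /negPf-> : (j - i)%:R != 0 :> 'F_p by apply: (natr_Fp_neq0 p_prime c_lt_p); lia.
by move/eqP.
Qed.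

Lemma isLie_hc i f : (0 < i <= c)%N -> isLie f -> lie i (hc i f).
Proof.
case/andP=> i_gt0 lei; elim=> {f} [j f lf|f g _ IHf _ IHg]; last by rewrite hcD; apply: lie_add.
by rewrite (lie_hc lei lf); case: eqP => [->//|_]; rewrite -(prednK i_gt0); apply: lie_zero.
Qed.

(* Both conditions are stable under products and hold for exponentials of
   homogeneous Lie elements; the second makes the leading term of [u] Lie, as
   [i] is invertible for [0 < i <= c]. *)
Definition grouplike u :=
  (forall f, isLie f -> isLie (val (u^-1)%g * f * val u)) /\
  isLie (val (u^-1)%g * euler (val u)).

Lemma grouplike1 : grouplike 1%g.
Proof.
split=> [f Lf|]; first by rewrite invg1 val_magnus1 mul1r mulr1.
by rewrite val_magnus1 euler1 mulr0; apply: isLie0.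
Qed.

(** [(u v)^-1 E(u v)] is the conjugate of [u^-1 E(u)] by [v], plus [v^-1 E(v)]. *)
Lemma grouplikeM u v : grouplike u -> grouplike v -> grouplike (u * v)%g.
Proof.
move=> [nu eu] [nv ev]; split=> [f Lf|]; rewrite invMg !val_magnusM.
  by rewrite !mulrA -[_ * _ * f]mulrA -[_ * (_ * f) * _]mulrA; apply/nv/nu.
rewrite eulerM mulrDr; apply: isLie_add.
  by rewrite !mulrA -[_ * _ * euler _]mulrA; apply: nv.
by rewrite !mulrA -[_ * _ * val u]mulrA magnusV mulr1.
Qed.

(** The exponent [p] turns the inverse into a power, so stability under products is enough. *)
Lemma grouplikeV u : grouplike u -> grouplike u^-1%g.
Proof.
move=> gu; have -> : u^-1%g = (u ^+ p.-1)%g.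
  apply: (mulIg u); rewrite mulVg -expgSr prednK ?prime_gt0 //.
  by rewrite magnus_exponent.
by elim: p.-1 => [|n IHn]; [apply: grouplike1 | rewrite expgS; apply: grouplikeM].
Qed.

(** Conjugation by [exp y] is [exp (ad y)], and [u^-1 E(u)] is [i y]. *)
Lemma grouplike_mexp i y : lie i y -> grouplike (mexp y).
Proof.
move=> ly; have oy := ordge_le (lie_gt0 ly) (lie_ordge ly).
split=> [f Lf|].
  rewrite -mulrA val_mexp // texp_adjoint // mulrA -{1}(val_mexp oy) magnusV mul1r.
  apply: isLie_sum => k _; apply: isLieZ.
  by elim: k => //= k IHk; apply: isLie_ad => //; apply: isLie_hom ly.
rewrite val_mexp // (euler_texp p_prime c_lt_p oy (lie_euler ly)).
by rewrite mulrA -{1}(val_mexp oy) magnusV mul1r (lie_euler ly); apply/isLieZ/isLie_hom/ly.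
Qed.

Lemma hc_ordge i f : ord_ge i.+1 f -> hc i f = 0.
Proof.
move=> oif; apply: co_inj => w _; rewrite co_hc co0.
by case: eqP => [szw|_]; rewrite ?mul0r // oif ?mulr0 // szw.
Qed.

Lemma grouplike_leading i u : (0 < i <= c)%N -> grouplike u -> ord_ge i (val u - 1) ->
  lie i (hc i (val u)).
Proof.
move=> lei [_ eu] ou; have oe : ord_ge i (euler (val u)).
  have -> : euler (val u) = euler (val u - 1).
    by apply: co_inj => w _; rewrite !co_euler coB co1; case: w => [|a w]; rewrite ?mul0r // subr0.
  exact: ordge_euler.
have := isLie_hc lei eu.
have -> : val (u^-1)%g * euler (val u) =
    euler (val u) + (val (u^-1)%g - 1) * euler (val u) by rewrite mulrBl mul1r addrC subrK.
rewrite hcD [X in _ + X]hc_ordge ?addr0; last first.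
  by rewrite -add1n; apply: ordgeM => //; apply: magnus_ordge.
have -> : hc i (euler (val u)) = i%:R *: hc i (val u).
  apply: co_inj => w _; rewrite coZ !co_hc co_euler.
  by case: eqP => [->|_]; rewrite ?mul0r ?mulr0 // !mul1r.
move/(lieZ (i%:R^-1)); rewrite scalerA mulVf ?scale1r //.
exact: (natr_Fp_neq0 p_prime c_lt_p lei).
Qed.

Definition magnus_gen := <<[set mexp (X a) | a : A]>>%G.

Lemma mem_magnus_gen a : mexp (X a) \in magnus_gen.
Proof. by apply: mem_gen; apply/imsetP; exists a. Qed.

Lemma grouplike_magnus_gen u : u \in magnus_gen -> grouplike u.
Proof.
case/gen_wordP=> w ->; rewrite /wprod; elim: w => [|a w IHw].
  by rewrite big_nil; apply: grouplike1.
by rewrite big_cons; apply: grouplikeM => //; apply: grouplike_mexp (lie_gen a).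
Qed.

(** Up to a unipotent factor this is a ring commutator, so group commutators have Lie brackets as
    leading terms. *)
Lemma magnus_comm_sub1 u v : val [~ u, v]%g - 1 =
  val (u^-1 * v^-1)%g * ((val u - 1) * (val v - 1) - (val v - 1) * (val u - 1)).
Proof.
have -> : (val u - 1) * (val v - 1) - (val v - 1) * (val u - 1) = val u * val v - val v * val u.
  by rewrite !mulrBl !mulrBr !mul1r !mulr1; tfa_zmod.
rewrite mulrBr -!val_magnusM commgEl /conjg !mulgA; congr (_ - _).
by rewrite !mulgKV mulVg.
Qed.

(** Products of group elements add leading terms, and commutators bracket them. *)
Lemma lie_leading_gen i f : lie i f -> exists u, [/\ u \in magnus_gen,
  ord_ge i (val u - 1) & ord_ge i.+1 (val u - 1 - f)].
Proof.
elim=> {i f} [a|i|i f g lf [u [Gu ou lu]] _ [v [Gv ov lv]]|i f a lf [u [Gu ou lu]]].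
- exists (mexp (X a)); rewrite mem_magnus_gen val_mexp; last exact: ordge_gen.
  split=> //; first by apply: ordge_texp => //; apply: ordge_gen.
  by rewrite -addrA -opprD; apply: texp_leading => //; apply: ordge_gen.
- by exists 1%g; rewrite group1 val_magnus1 subrr subr0; split=> //; apply: ordge0.
- have i_gt0 := lie_gt0 lf.
  have eqM : val (u * v)%g - 1 = (val u - 1) + (val v - 1) + (val u - 1) * (val v - 1).
    by rewrite val_magnusM mulrBl mul1r mulrBr mulr1; tfa_zmod.
  have o2 : ord_ge i.+1 ((val u - 1) * (val v - 1)).
    by apply: ordge_le (ordgeM ou ov); lia.
  exists (u * v)%g; rewrite groupM // eqM; split=> //.
    by apply: ordgeD; [apply: ordgeD | apply: ordge_le o2].
  rewrite addrAC opprD addrACA; apply: ordgeD => //; exact: ordgeD.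
have i_gt0 := lie_gt0 lf; pose v : magnus A p c := mexp (X a).
have ov : ord_ge 1 (val v - 1) by apply: magnus_ordge.
have lv : ord_ge 2 (val v - 1 - X a).
  rewrite /v val_mexp; last exact: ordge_gen.
  by rewrite -addrA -opprD; apply: texp_leading => //; apply: ordge_gen.
set x := val u - 1 in ou lu; set y := val v - 1 in ov lv.
have eqC := magnus_comm_sub1 u v; rewrite -/x -/y in eqC.
have oxy : ord_ge i.+1 (x * y - y * x).
  by apply: ordgeB; [rewrite -addn1 | rewrite -add1n]; apply: ordgeM.
exists [~ u, v]%g; rewrite eqC groupR ?mem_magnus_gen //.
split=> //; first exact: ordgeMl.
have -> : val (u^-1 * v^-1)%g * (x * y - y * x) - ad (X a) f =
    (val (u^-1 * v^-1)%g - 1) * (x * y - y * x)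
    + ((x - f) * y + f * (y - X a) - (y - X a) * x - X a * (x - f)).
  rewrite [in RHS]mulrBl mul1r -[RHS]addrA; congr (_ + _).
  by rewrite /ad !mulrBl !mulrBr; tfa_zmod.
have of1 := lie_ordge lf.
apply: ordgeD; first by rewrite -add1n; apply: ordgeM => //; apply: magnus_ordge.
apply: ordgeB; [apply: ordgeB; [apply: ordgeD|]|].
- by rewrite -addn1; apply: ordgeM.
- by rewrite -addn2; apply: ordgeM.
- by rewrite -add2n; apply: ordgeM.
by rewrite -add1n; apply: ordgeM => //; apply: ordge_gen.
Qed.

(** The leading term of [u] is Lie, hence shared by some [v] of the group; [v^-1 u] is again
    grouplike and starts one degree later. In [sub], [n] bounds the number of degrees left. *)
Lemma grouplike_mem_magnus_gen u : grouplike u -> u \in magnus_gen.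
Proof.
suff sub n i : (c < n + i)%N -> (0 < i)%N -> forall u, grouplike u -> ord_ge i (val u - 1) -> u \in magnus_gen.
  by move=> gu; apply: (sub c 1%N) => //; rewrite ?addn1 //; apply: magnus_ordge.
have triv k v : (c < k)%N -> ord_ge k (val v - 1) -> v \in magnus_gen.
  move=> ltci ov; have -> : v = 1%g; last exact: group1.
  by apply: val_inj; apply/eqP; rewrite -subr_eq0 (ordge_full (ordge_le ltci ov)).
elim: n i => [|n IHn] i lt_c i_gt0 {}u gu ou; first exact: (triv i).
have [ltci|leic] := ltnP c i; first exact: (triv i).
have lP := grouplike_leading (introT andP (conj i_gt0 leic)) gu ou.
have [v [Gv ov lv]] := lie_leading_gen lP.
rewrite -(groupMl _ (groupVr Gv)); apply: (IHn i.+1) => //; first by rewrite addnS.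
  by apply: grouplikeM => //; apply/grouplikeV/grouplike_magnus_gen.
have -> : val (v^-1 * u)%g - 1 = val (v^-1)%g * (val u - val v).
  by rewrite mulrBr magnusV.
apply: ordgeMl; set P := hc i (val u) in lv.
have -> : val u - val v = (val u - 1 - P) - (val v - 1 - P).
  by rewrite opprB addrA subrK opprB addrA subrK.
apply: ordgeB => //; rewrite /P.
have -> : hc i (val u) = hc i (val u - 1).
  apply: co_inj => w _; rewrite !co_hc coB co1; case: eqP => [szw|_]; last by rewrite !mul0r.
  by case: w szw => [szw|a w _]; [rewrite -szw in i_gt0 | rewrite subr0].
exact: ordge_hcB.
Qed.

(** Substitution is an algebra endomorphism commuting with [exp], so word identities between
    exponentials of generators hold for all series without constant term. *)
Lemma wprod_subst (h : A -> T) w : (forall i, ord_ge 1 (h i)) ->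
  val (wprod (fun a => mexp (h a)) w) = subst h (val (wprod (fun a => mexp (X a)) w)).
Proof.
move=> oh; rewrite /wprod; elim: w => [|a w IHw]; first by rewrite !big_nil subst1.
rewrite !big_cons !val_magnusM substM // IHw; congr (_ * _).
by rewrite !val_mexp ?subst_texp ?subst_gen //; apply: ordge_gen.
Qed.

Variables (a b : A).
Hypothesis neq_ab : a != b.

Definition sub2 (U : Type) (z x y : U) := fun i : A => if i == a then x else if i == b then y else z.

Lemma mexp_sub2 x y i : sub2 1%g (mexp x) (mexp y) i = mexp (sub2 0 x y i).
Proof.
rewrite /sub2; do 2?case: eqP => // _.
by apply: val_inj; rewrite val_mexp ?texp0 //; apply: ordge0.
Qed.

Lemma wprod_sub2 F w x y : ord_ge 1 x -> ord_ge 1 y -> ord_ge 1 F ->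
  ord_ge 1 (subst (sub2 0 x y) F) ->
  wprod (fun i => mexp (X i)) w = mexp F ->
  wprod (sub2 1%g (mexp x) (mexp y)) w = mexp (subst (sub2 0 x y) F).
Proof.
move=> ox oy oF oS eqw; apply: val_inj.
have os i : ord_ge 1 (sub2 0 x y i) by rewrite /sub2; do 2?case: eqP => // _; apply: ordge0.
have -> : wprod (sub2 1%g (mexp x) (mexp y)) w = wprod (fun i => mexp (sub2 0 x y i)) w.
  by apply: eq_bigr => i _; apply: mexp_sub2.
by rewrite wprod_subst // eqw !val_mexp // subst_texp.
Qed.

Lemma sub2_gen x y : ord_ge 1 x -> ord_ge 1 y ->
  subst (sub2 0 x y) (X a) = x /\ subst (sub2 0 x y) (X b) = y.
Proof.
move=> ox oy.
have os i : ord_ge 1 (sub2 0 x y i) by rewrite /sub2; do 2?case: eqP => // _; apply: ordge0.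
by rewrite !subst_gen // /sub2 eqxx eq_sym (negPf neq_ab) eqxx.
Qed.

Lemma ordge_ad i x y : ord_ge i x -> ord_ge i y -> ord_ge i (ad y x).
Proof. by move=> ox oy; apply: ordgeB; apply: ordgeMr. Qed.

(** The exponential of the Lie element [X a + X b] is grouplike, hence a word in the generators;
    substitution carries the word to all [x] and [y]. *)
Lemma exists_sum_word : exists w, forall x y, ord_ge 1 x -> ord_ge 1 y ->
  wprod (sub2 1%g (mexp x) (mexp y)) w = mexp (x + y).
Proof.
have lab : lie 1 (X a + X b) by apply: lie_add; apply: lie_gen.
have /gen_wordP[w eqw] := grouplike_mem_magnus_gen (grouplike_mexp lab).
exists w => x y ox oy; have [subxa subxb] := sub2_gen ox oy.
have os i : ord_ge 1 (sub2 0 x y i) by rewrite /sub2; do 2?case: eqP => // _; apply: ordge0.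
have eqS : subst (sub2 0 x y) (X a + X b) = x + y by rewrite substD // subxa subxb.
rewrite -eqS; apply: wprod_sub2 => //; first exact: lie_ordge lab.
by rewrite eqS; apply: ordgeD.
Qed.

Lemma exists_bracket_word : exists w, forall x y, ord_ge 1 x -> ord_ge 1 y ->
  wprod (sub2 1%g (mexp x) (mexp y)) w = mexp (ad y x).
Proof.
have lab : lie 2 (ad (X b) (X a)) by apply: lie_ad; apply: lie_gen.
have /gen_wordP[w eqw] := grouplike_mem_magnus_gen (grouplike_mexp lab).
exists w => x y ox oy; have [subxa subxb] := sub2_gen ox oy.
have os i : ord_ge 1 (sub2 0 x y i) by rewrite /sub2; do 2?case: eqP => // _; apply: ordge0.
have eqS : subst (sub2 0 x y) (ad (X b) (X a)) = ad y x.
  by rewrite /ad -scaleN1r substD // substZ // !substM // subxa subxb scaleN1r.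
rewrite -eqS; apply: wprod_sub2 => //; first exact: ordge_le (lie_ordge lab).
by rewrite eqS; apply: ordge_ad.
Qed.

(** The logarithm is found by successive approximation: the leading term [P] of [(exp f)^-1 u] is
    Lie, and [f + P] is correct one degree further. *)
Lemma magnus_gen_exp u : u \in magnus_gen -> exists2 f, isLie f & u = mexp f.
Proof.
move/grouplike_magnus_gen=> gu; have [w sumw] := exists_sum_word.
suff approx i : (i <= c.+1)%N -> (0 < i)%N ->
    exists f, [/\ isLie f, grouplike (mexp f) & ord_ge i (val u - texp f)].
  have [f [Lf _ of1]] := approx c.+1 (leqnn _) isT.
  exists f => //; apply: val_inj; apply/eqP.
  by rewrite (val_mexp (isLie_ordge Lf)) -subr_eq0 (ordge_full of1).
elim: i => // i IHi lei _; case: (posnP i) => [->|i_gt0].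
  exists 0; rewrite texp0; split; [exact: isLie0 | exact: grouplike_mexp (lie_zero 0) | exact: magnus_ordge].
have [f [Lf gf ou]] := IHi (ltnW lei) i_gt0; have of1 := isLie_ordge Lf.
pose v := ((mexp f)^-1 * u)%g; have gv : grouplike v by apply: grouplikeM => //; apply: grouplikeV.
have ov : ord_ge i (val v - 1).
  have -> : val v - 1 = val ((mexp f)^-1)%g * (val u - texp f).
    by rewrite mulrBr -val_mexp // magnusV.
  exact: ordgeMl.
have lP := grouplike_leading (introT andP (conj i_gt0 (lei : i <= c)%N)) gv ov.
set P := hc i (val v) in lP; have oP := lie_ordge lP.
have oP1 := ordge_le i_gt0 oP.
exists (f + P); split; first exact: isLie_add (isLie_hom lP).
  (* [exp (f + P)] is the sum word in [exp f] and [exp P], both grouplike; this stands in for the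
     Baker-Campbell-Hausdorff formula. *)
  rewrite -sumw // /wprod; elim: w {sumw} => [|z w IHw]; first by rewrite big_nil; apply: grouplike1.
  rewrite big_cons; apply: grouplikeM => //; rewrite /sub2.
  by case: eqP => _ //; case: eqP => _; [apply: grouplike_mexp lP | apply: grouplike1].
have -> : val u - texp (f + P) =
    texp f * (val v - 1 - P) - (texp (f + P) - texp f * (1 + P)).
  rewrite -addrA -opprD mulrBr -[texp f * val v](_ : val u = _); last first.
    by rewrite -val_mexp // -val_magnusM mulgA mulgV mul1g.
  by rewrite opprB addrA subrK.
apply: ordgeB; last exact: texp_addr.
apply: ordgeMl.
have -> : P = hc i (val v - 1).
  apply: co_inj => z _; rewrite !co_hc coB co1; case: eqP => [szw|_]; last by rewrite !mul0r.
  by case: z szw => [szw|d z _]; [rewrite -szw in i_gt0 | rewrite subr0].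
exact: ordge_hcB.
Qed.

End LieElements.

(** * The Dynkin map and relative freeness *)

(** A form of the Hall-Witt identity. If [a], [b], [x] have weights [j], [k], 1 in the lower central
    series, then [[n, x]], [[a, d]] and [[m, b]] have weight [j + k + 1] and the remaining factors
    lie deeper. *)
Lemma commg_jacobi (gT : finGroupType) (a b x : gT) :
  let m := [~ a, x]%g in let n := [~ a, b]%g in let d := [~ b, x]%g in
  ([~ n, x] = [~ a, d] ^ (m * n) * [~ n, m] * [~ m, b] * [~ n * m * [~ m, b], d])%g.
Proof.
move=> m n d; rewrite /m /n /d /commg /conjg !(invMg, invgK, mulgA).
by rewrite !(mulgK, mulgKV, mulVg, mulgV, mul1g).
Qed.

(** Induction on [j], with the three subgroups lemma in the quotient by the target term. *)
Lemma lcn_comm (gT : finGroupType) (G : {group gT}) (i j : nat) :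
  ([~: 'L_i.+1(G), 'L_j.+1(G)] \subset 'L_(i + j).+2(G))%g.
Proof.
elim: j i => [|j IHj] i; first by rewrite addn0 lcn1 lcnSn.
set N := ('L_(i + j.+1).+2(G))%G.
have nN (K : {group gT}) : (K \subset G -> K \subset 'N(N))%g.
  by move=> sKG; apply: subset_trans sKG (lcn_norm _ _).
have Ls k : ('L_k(G) \subset G)%g by apply: lcn_sub.
have nNL k := nN ('L_k(G))%G (Ls k); have nNG := nN G (subxx _).
have q3 (K1 K2 K3 : {group gT}) : (K1 \subset G -> K2 \subset G -> K3 \subset G ->
    [~: K1, K2, K3] \subset N -> [~: K1 / N, K2 / N, K3 / N] = 1)%g.
  move=> s1 s2 s3 sN; rewrite -!quotientR ?comm_subG ?nN //; apply/trivgP.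
  by rewrite quotient_sub1 // (subset_trans sN) // normG.
have tri : ([~: 'L_j.+1(G) / N, G / N, 'L_i.+1(G) / N] = 1)%g.
  apply: (@three_subgroup _ (G / N) ('L_i.+1(G) / N) ('L_j.+1(G) / N))%G.
    apply: (q3 G ('L_i.+1(G))%G ('L_j.+1(G))%G) => //=.
    by rewrite (commGC G) -lcnSn /N addnS -addSn IHj.
  apply: (q3 ('L_i.+1(G))%G ('L_j.+1(G))%G G) => //=.
  by rewrite /N addnS; exact: (commSg G (IHj i)).
have nC1 : [~: 'L_j.+1(G), G]%g \subset 'N(N)%g by exact: comm_subG (nNL j.+1) nNG.
have nC2 : [~: [~: 'L_j.+1(G), G], 'L_i.+1(G)]%g \subset 'N(N)%g.
  by exact: comm_subG nC1 (nNL i.+1).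
have : [~: 'L_j.+1(G), G, 'L_i.+1(G)]%g \subset N.
  by rewrite -(quotient_sub1 nC2) (quotientR nC1 (nNL _)) (quotientR (nNL _) nNG) tri.
by rewrite (commGC ('L_i.+1(G))%g).
Qed.

Lemma mem_lcn_comm (gT : finGroupType) (G : {group gT}) (i j : nat) (x y : gT) :
  (0 < i)%N -> (0 < j)%N -> x \in 'L_i(G)%g -> y \in 'L_j(G)%g -> [~ x, y]%g \in 'L_(i + j)(G)%g.
Proof.
case: i => // i _; case: j => // j _ Lx Ly; rewrite addnS addSn.
exact: subsetP (lcn_comm _ _ _) _ (mem_commg Lx Ly).
Qed.

Section WordSums.
Variables (A : finType) (V : zmodType).
Implicit Types F : seq A -> V.

(** The sum over words of length [k], recursive so that the first letter, or by [wsumSr] the last,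
    splits off. *)
Fixpoint wsum k F : V := if k is k'.+1 then \sum_x wsum k' (fun u => F (x :: u)) else F [::].

Lemma eq_wsum k F F' : (forall u, size u = k -> F u = F' u) -> wsum k F = wsum k F'.
Proof.
elim: k F F' => [|k IHk] F F' eqF /=; first exact: eqF.
by apply: eq_bigr => x _; apply: IHk => u szu; apply: eqF; rewrite /= szu.
Qed.

Lemma wsumD k F F' : wsum k (fun u => F u + F' u) = wsum k F + wsum k F'.
Proof.
elim: k F F' => [//|k IHk] F F' /=; rewrite -big_split.
by apply: eq_bigr => x _; rewrite IHk.
Qed.

Lemma wsumN k F : wsum k (fun u => - F u) = - wsum k F.
Proof.
elim: k F => [//|k IHk] F /=; rewrite -sumrN.
by apply: eq_bigr => x _; rewrite IHk.
Qed.

Lemma wsum0 k F : (forall u, size u = k -> F u = 0) -> wsum k F = 0.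
Proof.
move=> F0; rewrite (eq_wsum (F' := fun=> 0)) //.
by elim: k {F0} => //= k IHk; rewrite big1 // => x _; rewrite IHk.
Qed.

Lemma wsumSr k F : wsum k.+1 F = \sum_x wsum k (fun u => F (rcons u x)).
Proof.
elim: k F => [//|k IHk] F.
transitivity (\sum_y \sum_x wsum k (fun u => F (y :: rcons u x))).
  by apply: eq_bigr => y _; exact: IHk (fun u => F (y :: u)).
by rewrite exchange_big.
Qed.

End WordSums.

Section Dynkin.
Variables (A : finType) (p c : nat).
Hypotheses (p_prime : prime p) (c_lt_p : (c < p)%N) (c_gt0 : (0 < c)%N).
Local Notation X := (gen p c).
Variables (gT : finGroupType) (g : A -> gT) (theta : gT -> magnus A p c).
Hypothesis thetaM : {morph theta : x y / (x * y)%g}.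
Hypothesis theta_g : forall a, theta (g a) = mexp (X a).
Let P := <<[set g a | a : A]>>%G.
Local Notation L k := ('L_k(P)%g).
Implicit Types (a b : gT) (s u : seq A) (i j k : nat).

Let Pg x : g x \in P. Proof. by apply: mem_gen; apply/imsetP; exists x. Qed.
Let L1g x : g x \in L 1. Proof. by rewrite lcn1 Pg. Qed.
Let Lle i j x : (i <= j)%N -> x \in L j -> x \in L i.
Proof. by move=> leij; apply: subsetP (lcn_sub_leq _ leij) _. Qed.
Let LP k x : x \in L k -> x \in P. Proof. exact: subsetP (lcn_sub _ _) x. Qed.
Let Lcomm i j x y : (0 < i)%N -> (0 < j)%N -> x \in L i -> y \in L j -> [~ x, y]%g \in L (i + j)%N.
Proof. exact: mem_lcn_comm. Qed.
Let LcommP i x y : (0 < i)%N -> x \in L i -> y \in P -> [~ x, y]%g \in L i.+1.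
Proof. by move=> i_gt0 Lx Py; rewrite -addn1; apply: Lcomm. Qed.

(** Modulo ['L_k.+2] the commutator [[b, y]] is multiplicative in [y], and [y] is a word in the
    generators. *)
Lemma lcn_word_ind (Q : gT -> Prop) k : (0 < k)%N ->
  (forall x y, x \in L k.+1 -> y \in L k.+1 -> Q x -> Q y -> Q (x * y)%g) ->
  (forall x, x \in L k.+2 -> Q x) ->
  (forall b x, b \in L k -> Q [~ b, g x]%g) ->
  forall b, b \in L k.+1 -> Q b.
Proof.
move=> k_gt0 QM QL Qc b; case: k k_gt0 QM QL Qc => // k _ QM QL Qc.
rewrite lcnSn => /gen_prodgP[n [F inF ->]].
have inL (i : 'I_n) : F i \in L k.+2 by rewrite lcnSn mem_gen.
have {inF} QF (i : 'I_n) : Q (F i).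
  have /imset2P[b' y Lb Py ->] := inF i.
  have /gen_wordP[w ->] := Py.
  rewrite /wprod; elim: w => [|x w IHw]; first by rewrite big_nil commg1; apply: QL.
  rewrite big_cons commgMJ conjg_mulR; set y' := (\prod_(_ <- _) _)%g in IHw *.
  have Py' : y' \in P by apply: group_prod => z _.
  have L1 := LcommP (ltn0Sn _) Lb Py'; have L2 := LcommP (ltn0Sn _) Lb (Pg x).
  have L3 := LcommP (ltn0Sn _) L2 Py'.
  have Qx := Qc b' x Lb; have L3' := Lle (leqnSn _) L3.
  by apply: (QM) => //; [apply: groupM | apply: (QM) => //; apply: QL].
elim: n F inL QF => [|n IHn] F inL QF; first by rewrite big_ord0; apply: QL.
by rewrite big_ord_recl; apply: (QM) => //; [apply: group_prod | apply: IHn].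
Qed.

Lemma theta_one : theta 1%g = 1%g.
Proof. by apply: (mulgI (theta 1%g)); rewrite -thetaM !mulg1. Qed.

Lemma thetaV x : theta x^-1%g = (theta x)^-1%g.
Proof. by apply: (mulgI (theta x)); rewrite -thetaM !mulgV theta_one. Qed.

Lemma thetaR x y : theta [~ x, y]%g = [~ theta x, theta y]%g.
Proof. by rewrite /commg /conjg !thetaM !thetaV. Qed.

Lemma theta_lcn k x : (0 < k)%N -> x \in L k -> ord_ge k (val (theta x) - 1).
Proof.
case: k => // k _; elim: k x => [|k IHk] x Lx; first exact: magnus_ordge.
have ordM i (u v : magnus A p c) : ord_ge i (val u - 1) -> ord_ge i (val v - 1) ->
    ord_ge i (val (u * v)%g - 1).
  move=> ou ov; have -> : val (u * v)%g - 1 = val u * (val v - 1) + (val u - 1).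
    by rewrite mulrBr mulr1 addrA subrK.
  by apply: ordgeD => //; apply: ordgeMl.
move: Lx; rewrite lcnSn => /gen_prodgP[n [F inF ->]].
elim: n F inF => [|n IHn] F inF.
  by rewrite big_ord0 theta_one val_magnus1 subrr; apply: ordge0.
rewrite big_ord_recl thetaM; apply: ordM; last by apply: IHn => i; apply: inF.
have /imset2P[b y Lb Py ->] := inF ord0.
rewrite thetaR magnus_comm_sub1; apply: ordgeMl.
by apply: ordgeB; [rewrite -addn1; apply: (ordgeM (IHk b Lb) (@magnus_ordge _ _ _ _)) | rewrite -add1n; apply: (ordgeM (@magnus_ordge _ _ _ _) (IHk b Lb))].
Qed.

Lemma co_theta k x u : (0 < k)%N -> x \in L k -> size u = k ->
  co (val (theta x)) u = co (val (theta x) - 1) u.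
Proof. by move=> k_gt0 _ szu; rewrite coB co1 -size_eq0 szu (gtn_eqF k_gt0) subr0. Qed.

Lemma co_thetaM k x y u : (0 < k <= c)%N -> x \in L k -> y \in L k -> size u = k ->
  co (val (theta (x * y))) u = co (val (theta x)) u + co (val (theta y)) u.
Proof.
case/andP=> k_gt0 lek Lx Ly szu; rewrite (@co_theta k) ?groupM // !(@co_theta k) //.
have -> : val (theta (x * y)%g) - 1 = (val (theta x) - 1) + (val (theta y) - 1)
    + (val (theta x) - 1) * (val (theta y) - 1).
  by rewrite thetaM val_magnusM !mulrBl !mulrBr !mul1r !mulr1; tfa_zmod.
rewrite !coD [X in _ + X](ordgeM (theta_lcn k_gt0 Lx) (theta_lcn k_gt0 Ly)) ?addr0 //.
by rewrite szu -{1}[k]addn0 ltn_add2l.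
Qed.

Lemma co_theta_deep k x u : (0 < k)%N -> x \in L k.+1 -> size u = k -> co (val (theta x)) u = 0.
Proof.
move=> k_gt0 Lx szu; rewrite (@co_theta k) //; last exact: Lle Lx.
by apply: (theta_lcn (k := k.+1)) => //; rewrite szu.
Qed.

Lemma co_theta_gen x y : co (val (theta (g x))) [:: y] = (y == x)%:R.
Proof.
rewrite (@co_theta 1) // theta_g val_mexp; last exact: ordge_gen.
have := texp_leading c_gt0 (ltn0Sn 0) (@ordge_gen A p c x).
move/(_ [:: y] isT); rewrite opprD addrA coB => /subr0_eq->.
by rewrite co_mk // eqseq_cons andbT.
Qed.

(** The leading term is the bracket of that of [b], in degree [k], with that of [g x], in degree 1;
    hence the cuts after [k] letters and after one. *)
Lemma co_theta_comm k b x u : (0 < k < c)%N -> b \in L k -> size u = k.+1 ->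
  co (val (theta [~ b, g x])) u =
    co (val (theta b)) (take k u) * co (val (theta (g x))) (drop k u)
    - co (val (theta (g x))) (take 1 u) * co (val (theta b)) (drop 1 u).
Proof.
case/andP=> k_gt0 ltk Lb szu.
have oD (f h : tfa A p c) : ord_ge k.+2 (f - h) -> co f u = co h u.
  by move=> ofh; apply/eqP; rewrite -subr_eq0 -coB ofh ?szu.
rewrite (@co_theta k.+1) ?LcommP // thetaR magnus_comm_sub1.
set w := (_^-1 * _^-1)%g; set f := _ - 1; set h := _ - 1.
have of1 : ord_ge k f by apply: theta_lcn.
have oh : ord_ge 1 h by apply: magnus_ordge.
have ofh : ord_ge k.+1 (f * h - h * f).
  by apply: ordgeB; [rewrite -addn1 | rewrite -add1n]; apply: ordgeM.
rewrite (oD _ (f * h - h * f)); last first.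
  rewrite -[X in _ - X]mul1r -mulrBl -add1n; apply: ordgeM => //; exact: magnus_ordge.
rewrite coB (coM_leading of1 oh) ?szu ?addn1 // (coM_leading oh of1) ?szu ?add1n //.
have ef v : size v = k -> co f v = co (val (theta b)) v by move=> szv; rewrite (@co_theta k).
have eh v : size v = 1%N -> co h v = co (val (theta (g x))) v by move=> szv; rewrite (@co_theta 1).
by rewrite ef ?eh ?ef ?size_takel ?size_drop ?szu ?subSnn ?subSS ?subn0.
Qed.

Definition icomm a s := foldl (fun b x => [~ b, g x]%g) a s.

Lemma icomm_lcn j a s : (0 < j)%N -> a \in L j -> icomm a s \in L (j + size s)%N.
Proof.
elim: s j a => [|x s IHs] j a j_gt0 La /=; first by rewrite addn0.
by rewrite -addSnnS; apply: IHs => //; apply: LcommP.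
Qed.

Variables (V : lmodType 'F_p) (n : nat) (eta : gT -> V).
Hypotheses (n_gt0 : (0 < n <= c)%N).
Hypothesis etaM : forall x y, x \in L n -> y \in L n -> eta (x * y)%g = eta x + eta y.
Hypothesis eta0 : forall x, x \in L n.+1 -> eta x = 0.

Lemma eta_icomm0 j a s : (0 < j)%N -> (j + size s)%N = n -> a \in L j.+1 -> eta (icomm a s) = 0.
Proof. by move=> j_gt0 eqn La; apply: eta0; rewrite -eqn -addSn; apply: icomm_lcn. Qed.

(** The correction [[a, x, b]] in the expansion of [[a b, x]] lies one step deeper, and what remains
    of it after all commutators is killed by [eta]. *)
Lemma eta_icommM j a b s : (0 < j)%N -> (j + size s)%N = n -> a \in L j -> b \in L j ->
  eta (icomm (a * b)%g s) = eta (icomm a s) + eta (icomm b s).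
Proof.
elim: s j a b => [|x s IHs] j a b j_gt0 eqn La Lb /=.
  by rewrite addn0 in eqn; apply: etaM; rewrite -eqn.
have eqn' : (j.+1 + size s)%N = n by rewrite addSnnS.
have La1 := LcommP j_gt0 La (Pg x); have Lb1 := LcommP j_gt0 Lb (Pg x).
have Lab := LcommP (ltn0Sn j) La1 (LP Lb).
have Lab' := Lle (leqnSn _) Lab; rewrite commMgJ conjg_mulR.
set a1 := [~ a, g x]%g in La1 Lab Lab' *; set b1 := [~ b, g x]%g in Lb1 *.
set e := [~ a1, b]%g in Lab Lab' *; have Le : (a1 * e)%g \in L j.+1 by apply: groupM.
rewrite (IHs j.+1 (a1 * e)%g b1) // (IHs j.+1 a1 e) //.
by rewrite (eta_icomm0 (j := j.+1) (a := e)) // addr0.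
Qed.

Lemma eta_icommJ j a b s : (0 < j)%N -> (j + size s)%N = n -> a \in L j -> b \in P ->
  eta (icomm (a ^ b)%g s) = eta (icomm a s).
Proof.
move=> j_gt0 eqn La Pb; have Lab := LcommP j_gt0 La Pb.
rewrite conjg_mulR (eta_icommM j_gt0 eqn) //; last exact: Lle Lab.
by rewrite [X in _ + X](eta_icomm0 j_gt0) ?addr0.
Qed.

Lemma eta_icommV j a s : (0 < j)%N -> (j + size s)%N = n -> a \in L j ->
  eta (icomm a^-1%g s) = - eta (icomm a s).
Proof.
move=> j_gt0 eqn La; apply/eqP; rewrite -addr_eq0 -(eta_icommM j_gt0 eqn) ?groupV //.
by rewrite mulVg (eta_icomm0 j_gt0).
Qed.

Lemma eta_jacobi j k a b x s : (0 < j)%N -> (0 < k)%N -> (j + k + (size s).+1)%N = n ->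
  a \in L j -> b \in L k ->
  eta (icomm [~ a, [~ b, g x]] s)%g =
  eta (icomm [~ [~ a, b], g x] s)%g - eta (icomm [~ [~ a, g x], b] s)%g.
Proof.
move=> j_gt0 k_gt0 eqn La Lb; have eqn' : ((j + k).+1 + size s)%N = n by rewrite addSnnS.
move: (commg_jacobi a b (g x)) => /=.
set m := [~ a, g x]%g; set d := [~ b, g x]%g; set q := [~ a, b]%g.
have Lm : m \in L j.+1 by apply: LcommP.
have Ld : d \in L k.+1 by apply: LcommP.
have Lq : q \in L (j + k)%N by apply: Lcomm.
have jk_gt0 : (0 < j + k)%N by rewrite addn_gt0 j_gt0.
have Lad : [~ a, d]%g \in L (j + k).+1 by rewrite -addnS; apply: Lcomm.
have Lqm : [~ q, m]%g \in L (j + k).+2.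
  by apply: Lle (Lcomm jk_gt0 (ltn0Sn j) Lq Lm); lia.
have Lmb : [~ m, b]%g \in L (j + k).+1 by rewrite -addSn; apply: Lcomm.
have Pmq : (m * q)%g \in P by apply: groupM; [apply: LP Lm | apply: LP Lq].
have [Lq' Lmb'] : q \in L j.+1 /\ [~ m, b]%g \in L j.+1.
  by split; [apply: Lle Lq | apply: Lle Lmb]; lia.
set e1 := [~ a, d]%g in Lad *; set e2 := [~ q, m]%g in Lqm *.
set e3 := [~ m, b]%g in Lmb Lmb' *.
have : [~ q * m * e3, d]%g \in L (j + k).+2.
  rewrite -addSn -addnS; apply: Lcomm => //.
  by apply: (@groupM _ ('L_j.+1(P))%G) => //; apply: (@groupM _ ('L_j.+1(P))%G).
set e4 := [~ _ * e3, d]%g => Le4; move=> ->.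
have Lc : (e1 ^ (m * q))%g \in L (j + k).+1.
  by rewrite memJ_norm // (subsetP (lcn_norm _ P)).
have Lqm' := Lle (leqnSn _) Lqm; have Le4' := Lle (leqnSn _) Le4.
clearbody e1 e2 e3 e4.
have L12 : (e1 ^ (m * q) * e2)%g \in L (j + k).+1 by apply: groupM.
have L123 : (e1 ^ (m * q) * e2 * e3)%g \in L (j + k).+1 by apply: groupM.
rewrite (eta_icommM (j := (j + k).+1) (a := (e1 ^ (m * q) * e2 * e3)%g) (b := e4)) //.
rewrite (eta_icommM (j := (j + k).+1) (a := (e1 ^ (m * q) * e2)%g) (b := e3)) //.
rewrite (eta_icommM (j := (j + k).+1) (a := (e1 ^ (m * q))%g) (b := e2)) //.
rewrite (eta_icommJ (j := (j + k).+1)) //.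
rewrite (eta_icomm0 (j := (j + k).+1) (a := e2)) // (eta_icomm0 (j := (j + k).+1) (a := e4)) //.
by rewrite !addr0 addrK.
Qed.

(** The leading term of [[b, g x]] is [b x - x b], so [x] is appended to the words of [b] or put in
    front of them. *)
Lemma wsum_theta_comm (H : seq A -> V) k b x : (0 < k < c)%N -> b \in L k ->
  wsum k.+1 (fun u => co (val (theta [~ b, g x]%g)) u *: H u) =
  wsum k (fun u => co (val (theta b)) u *: H (rcons u x))
  - wsum k (fun u => co (val (theta b)) u *: H (x :: u)).
Proof.
move=> ltk Lb; have [k_gt0 _] := andP ltk.
rewrite (eq_wsum (F' := fun u =>
   (co (val (theta b)) (take k u) * co (val (theta (g x))) (drop k u)) *: H u
  + - ((co (val (theta (g x))) (take 1 u) * co (val (theta b)) (drop 1 u)) *: H u))); last first.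
  by move=> u szu; rewrite (co_theta_comm _ ltk Lb szu) scalerBl.
rewrite wsumD wsumN; congr (_ - _).
  rewrite wsumSr (bigD1 x) //= big1 ?addr0 => [|y neqyx]; last first.
    apply: wsum0 => u szu; rewrite -cats1 -szu drop_size_cat // co_theta_gen (negPf neqyx).
    by rewrite mulr0 scale0r.
  apply: eq_wsum => u szu; rewrite -cats1 -szu drop_size_cat // take_size_cat //.
  by rewrite co_theta_gen eqxx mulr1.
rewrite [LHS]/= (bigD1 x) //= big1 ?addr0 => [|y neqyx]; last first.
  apply: wsum0 => u szu; rewrite take0 co_theta_gen (negPf neqyx).
  by rewrite mul0r scale0r.
by apply: eq_wsum => u szu; rewrite take0 drop0 co_theta_gen eqxx mul1r.
Qed.

(* [eta] is additive on a quotient of the lower central series, where iterated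
   commutators behave like left-normed Lie brackets: [wsum] applies the Dynkin
   substitution to the leading term of [theta b]. *)
Lemma dynkin_bracket k b : (0 < k)%N -> b \in L k -> forall j a s, (0 < j)%N ->
  (j + k + size s)%N = n -> a \in L j ->
  wsum k (fun u => co (val (theta b)) u *: eta (icomm a (u ++ s))) = eta (icomm [~ a, b]%g s).
Proof.
case: k => // k _; elim: k b => [|k IHk] b Lb.
  have /gen_wordP[w ->] : b \in P by [].
  rewrite /wprod; elim: w => [|x w IHw] j a s j_gt0 eqn La.
    rewrite big_nil commg1 (eta_icomm0 (j := (j + 1)%N)) // ?wsum0 ?addn_gt0 ?j_gt0 // => u szu.
    by rewrite theta_one co1; case: u szu => // *; rewrite scale0r.
  rewrite big_cons; set y := (\prod_(_ <- _) _)%g in IHw *.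
  have Py : y \in L 1 by apply: group_prod => z _.
  have gxL := L1g x.
  rewrite (eq_wsum (F' := fun u => co (val (theta (g x))) u *: eta (icomm a (u ++ s))
     + co (val (theta y)) u *: eta (icomm a (u ++ s)))); last first.
    by move=> u szu; rewrite (@co_thetaM 1) ?c_gt0 // scalerDl.
  rewrite wsumD (IHw j) //= commgMJ; have Lax := LcommP j_gt0 La (Pg x).
  have Lay := LcommP j_gt0 La Py; have eqn' : (j.+1 + size s)%N = n by rewrite -addn1.
  have Laxy : ([~ a, g x] ^ y)%g \in L j.+1 by rewrite memJ_norm // (subsetP (lcn_norm _ P)).
  rewrite (eta_icommM (j := j.+1) (a := [~ a, y]%g) (b := ([~ a, g x] ^ y)%g)) //.
  rewrite (eta_icommJ (j := j.+1) (a := [~ a, g x]%g)) //.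
  rewrite addrC; congr (_ + _); rewrite (bigD1 x) //= co_theta_gen eqxx scale1r.
  rewrite big1 ?addr0 // => z neqzx.
  by rewrite co_theta_gen (negPf neqzx) scale0r.
move: b Lb; apply: lcn_word_ind => // [x y Lx Ly Qx Qy|x Lx|b x Lb] j a s j_gt0 eqn La.
- rewrite (eq_wsum (F' := fun u => co (val (theta x)) u *: eta (icomm a (u ++ s))
     + co (val (theta y)) u *: eta (icomm a (u ++ s)))); last first.
    by move=> u szu; rewrite (@co_thetaM k.+2) ?scalerDl //; lia.
  rewrite wsumD (Qx j) // (Qy j) // commgMJ addrC.
  have jk_gt0 : (0 < j + k.+2)%N by lia.
  have Lax : [~ a, x]%g \in L (j + k.+2)%N by apply: Lcomm.
  have Lay : [~ a, y]%g \in L (j + k.+2)%N by apply: Lcomm.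
  have Py := LP Ly.
  have Laxy : ([~ a, x] ^ y)%g \in L (j + k.+2) by rewrite memJ_norm // (subsetP (lcn_norm _ P)).
  rewrite (eta_icommM (a := [~ a, y]%g) (b := ([~ a, x] ^ y)%g) jk_gt0) //.
  by rewrite (eta_icommJ (a := [~ a, x]%g) jk_gt0).
- rewrite wsum0 => [|u szu]; last by rewrite (co_theta_deep _ Lx szu) ?scale0r.
  have jk_gt0 : (0 < j + k.+2)%N by lia.
  by rewrite (eta_icomm0 jk_gt0) // -addnS; apply: Lcomm.
rewrite wsum_theta_comm //; last by lia.
(* The two terms of the Jacobi identity match the summands [b x] and [x b] of the leading
   bracket. *)
rewrite (eta_jacobi (j := j) (k := k.+1)) //; last by rewrite -addSnnS -addnS.
congr (_ - _).
  rewrite -[RHS](IHk b Lb j a (x :: s)) //; last by rewrite /= -addSnnS -addnS.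
  by apply: eq_wsum => u _; rewrite cat_rcons.
rewrite -[RHS](IHk b Lb j.+1 [~ a, g x]%g s) //; first by rewrite addSnnS.
exact: LcommP.
Qed.

Definition icomm1 s := if s is x :: s' then icomm (g x) s' else 1%g.

(** The Dynkin-Specht-Wever identity: left-normed bracketing multiplies a Lie element of degree [k]
    by [k]. The tail [s] absorbs the letter split off in the induction. *)
Lemma dynkin_degree k b s : (0 < k)%N -> b \in L k -> (k + size s)%N = n ->
  wsum k (fun u => co (val (theta b)) u *: eta (icomm1 (u ++ s))) = k%:R *: eta (icomm b s).
Proof.
case: k => // k _; elim: k b s => [|k IHk] b s Lb eqn.
  have /gen_wordP[w ->] : b \in P by [].
  rewrite /wprod scale1r; elim: w => [|x w IHw].
    rewrite big_nil (eta_icomm0 (j := 1%N)) // wsum0 // => u szu.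
    by rewrite theta_one co1; case: u szu => // *; rewrite scale0r.
  rewrite big_cons; set y := (\prod_(_ <- _) _)%g in IHw *.
  have Py : y \in L 1 by apply: group_prod => z _.
  have gxL := L1g x.
  rewrite (eq_wsum (F' := fun u => co (val (theta (g x))) u *: eta (icomm1 (u ++ s))
     + co (val (theta y)) u *: eta (icomm1 (u ++ s)))); last first.
    by move=> u szu; rewrite (@co_thetaM 1) ?c_gt0 // scalerDl.
  rewrite wsumD IHw (eta_icommM (j := 1%N)) //; congr (_ + _).
  rewrite /= (bigD1 x) //= co_theta_gen eqxx scale1r big1 ?addr0 // => z neqzx.
  by rewrite co_theta_gen (negPf neqzx) scale0r.
move: b Lb; apply: lcn_word_ind => // [x y Lx Ly Qx Qy|x Lx|b x Lb].
- rewrite (eq_wsum (F' := fun u => co (val (theta x)) u *: eta (icomm1 (u ++ s))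
     + co (val (theta y)) u *: eta (icomm1 (u ++ s)))); last first.
    by move=> u szu; rewrite (@co_thetaM k.+2) ?scalerDl //; lia.
  by rewrite wsumD Qx Qy (eta_icommM (j := k.+2)) // scalerDr.
- rewrite wsum0 => [|u szu]; last by rewrite (co_theta_deep _ Lx szu) ?scale0r.
  by rewrite (eta_icomm0 (j := k.+2)) // scaler0.
rewrite wsum_theta_comm //; last by lia.
rewrite (eq_wsum (F' := fun u => co (val (theta b)) u *: eta (icomm1 (u ++ x :: s)))); last first.
  by move=> u _; rewrite cat_rcons.
rewrite (IHk b (x :: s)) //; last by rewrite /= addnS.
(* The words beginning with [x] give [[g x, b]], the inverse of [[b, g x]]: one copy beyond the
   [k.+1] of the induction. *)
rewrite [X in _ - X](dynkin_bracket (k := k.+1) (b := b) _ Lb (j := 1%N) (a := g x)) //.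
rewrite -invgR (eta_icommV (j := k.+2)) //; last exact: LcommP.
by rewrite opprK -[k.+2]addn1 natrD scalerDl scale1r.
Qed.

(** All leading coefficients vanish, so [n] times [eta b] is zero, and [n <= c < p] is
    invertible. *)
Lemma dynkin_kernel b : b \in L n -> theta b = 1%g -> eta b = 0.
Proof.
move=> Lb thb; have [n0 len] := andP n_gt0; have := @dynkin_degree n b [::] n0 Lb (addn0 n).
rewrite wsum0 => [/esym/eqP|u szu].
  by rewrite scaler_eq0 (negPf (natr_Fp_neq0 p_prime c_lt_p n_gt0)) => /eqP.
by rewrite thb co1; case: u szu n0 => [<-|*]; rewrite ?scale0r.
Qed.

End Dynkin.

(** The factor is abelian of exponent dividing [p], hence a vector space; its coordinates serve as
    the map [eta] of the Dynkin argument. *)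
Lemma lcn_factor_coordinates (p : nat) (gT : finGroupType) (P : {group gT}) (n : nat) :
  prime p -> (0 < n)%N -> (forall x, x \in P -> x ^+ p = 1)%g ->
  exists (d : nat) (eta : gT -> 'rV['F_p]_d),
    [/\ forall x y, x \in 'L_n(P)%g -> y \in 'L_n(P)%g -> eta (x * y)%g = eta x + eta y,
        forall x, x \in 'L_n.+1(P)%g -> eta x = 0
      & forall x, x \in 'L_n(P)%g -> eta x = 0 -> x \in 'L_n.+1(P)%g].
Proof.
move=> p_pr n_gt0 expP; pose Q := ('L_n(P) / 'L_n.+1(P))%G.
have nL x : x \in 'L_n(P)%g -> x \in 'N('L_n.+1(P))%g.
  by apply: subsetP; apply: normal_norm (lcn_normalS _ _).
have abQ : (p.-abelem Q)%g.
  rewrite abelemE //; apply/andP; split.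
    by apply: abelianS (center_abelian (P / 'L_n.+1(P))%G); apply: lcn_central.
  apply/exponentP=> _ /morphimP[x Nx Lx ->].
  by rewrite -morphX // expP ?morph1 //; apply: subsetP (lcn_sub n P) _ Lx.
(* Coordinates of an elementary abelian group are defined only for a nontrivial one. *)
have [Q1|ntQ] := eqVneq (Q : {set _}) 1%g.
  exists 0%N, (fun=> 0); split=> [*|//|x Lx _]; first by rewrite addr0.
  have /trivgP := Q1; rewrite quotient_sub1; last exact: normal_norm (lcn_normalS _ _).
  by move/subsetP; apply.
exists _, (fun x => abelem_rV abQ ntQ (coset 'L_n.+1(P) x)); split=> [x y Lx Ly|x Lx|x Lx].
- by rewrite morphM ?nL // abelem_rV_M // mem_quotient.
- by rewrite coset_id // morph1.
move=> eta0; apply: coset_idr; first exact: nL.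
have /(_ (coset 'L_n.+1(P) x) 1%g) := abelem_rV_inj (abelE := abQ) (ntE := ntQ).
by apply; rewrite ?group1 ?mem_quotient // eta0 morph1.
Qed.

Section RelativelyFree.
Variables (A : finType) (p c : nat).
Hypotheses (p_prime : prime p) (c_lt_p : (c < p)%N) (c_gt0 : (0 < c)%N).
Variables (gT : finGroupType) (g : A -> gT).
Hypotheses (expG : forall x : gT, (x ^+ p = 1)%g) (classG : 'L_c.+1([set: gT])%g = 1%g).

(** The subgroup generated by the pairs [(exp X_a, g a)] is the graph of a
    homomorphism: an element that is trivial in the first coordinate is killed
    degree by degree, since the Dynkin map sends its leading term to a nonzero
    multiple of its class in the lower central series. *)
Definition graph := <<[set (mexp (gen p c a), g a) | a : A]>>%G.

Lemma graph_lcn k x : (0 < k)%N -> x \in 'L_k(graph)%g ->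
  ord_ge k (val x.1 - 1) /\ x.2 \in 'L_k([set: gT])%g.
Proof.
move=> k_gt0 Lx; split.
  apply: (@theta_lcn A p c _ (fun a => (mexp (gen p c a), g a)) fst) => //.
case: k k_gt0 Lx => // k _; elim: k x => [|k IHk] x; first by rewrite !lcn1 inE.
rewrite lcnSn => /gen_prodgP[n [F inF ->]].
elim: n F inF => [|n IHn] F inF; first by rewrite big_ord0 group1.
rewrite big_ord_recl /=; apply: groupM; last by apply: IHn => i; apply: inF.
have /imset2P[b y Lb _ ->] := inF ord0.
exact: (mem_commg (IHk b Lb) (in_setT y.2)).
Qed.

Lemma graph_functional h h' m : (m, h) \in graph -> (m, h') \in graph -> h = h'.
Proof.
move=> Gh Gh'; apply/eqP; rewrite eq_sym -(inj_eq (mulgI h^-1%g)) mulVg; apply/eqP; set x := (h^-1 * h')%g.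
have Gx : (1%g, x) \in graph.
  have -> : (1%g, x) = ((m, h)^-1 * (m, h'))%g by congr (_, _); rewrite /= mulVg.
  by rewrite groupM ?groupV.
have expQ z : z \in graph -> (z ^+ p = 1)%g.
  move=> _; case: z => u y.
  have pairX n : ((u, y) ^+ n = (u ^+ n, y ^+ n))%g.
    by elim: n => [//|n IHn]; rewrite !expgS IHn.
  by rewrite pairX expG magnus_exponent.
(* Each use of [dynkin_kernel] moves [(1, x)] one step down the lower central series of the graph,
   until its second coordinate lies in the trivial term. *)
suff Lx n : (n <= c)%N -> (1%g, x) \in 'L_n.+1(graph)%g.
  by have [_] := graph_lcn (ltn0Sn c) (Lx c (leqnn c)); rewrite classG => /set1P.
elim: n => [_|n IHn ltn]; first by rewrite lcn1.
have n1_gt0 : (0 < n.+1 <= c)%N by [].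
have [d [eta [etaM eta0 etaI]]] := lcn_factor_coordinates p_prime (ltn0Sn n) expQ.
have Lx := IHn (ltnW ltn); apply: etaI => //.
by apply: (@dynkin_kernel A p c p_prime c_lt_p c_gt0 _ (fun a => (mexp (gen p c a), g a)) fst _ _ _ n.+1 eta).
Qed.

End RelativelyFree.

(** * The Lazard operations *)

(** Words in two letters [Some true], [Some false]; the third letter [None] is
    evaluated at the unit. *)
Definition wop (w : seq (option bool)) (gT : finGroupType) (x y : gT) : gT :=
  wprod (sub2 (Some true) (Some false) 1%g x y) w.

Lemma wop_cons o w (gT : finGroupType) (x y : gT) :
  wop (o :: w) x y = (sub2 (Some true) (Some false) 1 x y o * wop w x y)%g.
Proof. by rewrite /wop /wprod big_cons. Qed.

Lemma wop_nil (gT : finGroupType) (x y : gT) : wop [::] x y = 1%g.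
Proof. by rewrite /wop /wprod big_nil. Qed.

Lemma mem_wop w (gT : finGroupType) (G : {group gT}) x y :
  x \in G -> y \in G -> wop w x y \in G.
Proof. by move=> Gx Gy; apply: group_prod => -[[]|] _ //=; apply: group1. Qed.

Lemma wop_morph w (gT hT : finGroupType) (f : gT -> hT) x y :
  {morph f : x y / (x * y)%g} -> f (wop w x y) = wop w (f x) (f y).
Proof.
move=> fM; have f1 : f 1%g = 1%g by apply: (mulgI (f 1%g)); rewrite -fM !mulg1.
elim: w => [|[[]|] w IHw]; rewrite ?wop_nil // !wop_cons fM IHw //=.
by rewrite f1.
Qed.

(** Sorting the letters. For the bracket word this reduces commuting arguments to brackets with the
    unit, which are trivial. *)
Lemma wop_commute w (gT : finGroupType) (x y : gT) : commute x y ->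
  wop w x y = (wop w x 1 * wop w 1 y)%g.
Proof.
move=> cxy; elim: w => [|[[]|] w IHw]; rewrite ?wop_nil ?mulg1 // !wop_cons IHw /= ?mul1g ?mulgA //.
congr (_ * _)%g; apply: commute_sym; elim: w {IHw} => [|[[]|] w IHw]; rewrite ?wop_nil ?wop_cons /=.
- exact: commute_sym (commute1 _).
- by apply: commute_sym; apply: commuteM; [apply: commute_sym | apply: commute_sym].
- by rewrite mul1g.
by rewrite mul1g.
Qed.

Section Lazard.
Variables (p c : nat).
Hypotheses (p_prime : prime p) (c_lt_p : (c < p)%N) (c_gt0 : (0 < c)%N).
Local Notation T := (tfa (option bool) p c).
Local Notation X := (gen (A := option bool) p c).

Definition lazard_words (wa wb : seq (option bool)) :=
  (forall x y : T, ord_ge 1 x -> ord_ge 1 y -> wop wa (mexp x) (mexp y) = mexp (x + y)) /\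
  (forall x y : T, ord_ge 1 x -> ord_ge 1 y -> wop wb (mexp x) (mexp y) = mexp (ad y x)).

Lemma exists_lazard_words : exists wa wb, lazard_words wa wb.
Proof.
have neq : Some true != Some false by [].
have [wa Pa] := exists_sum_word p_prime c_lt_p c_gt0 neq.
have [wb Pb] := exists_bracket_word p_prime c_lt_p c_gt0 neq.
by exists wa, wb.
Qed.

Variables (wa wb : seq (option bool)).
Hypothesis wab : lazard_words wa wb.

Definition class_exponent (gT : finGroupType) :=
  (forall x : gT, (x ^+ p = 1)%g) /\ 'L_c.+1([set: gT])%g = 1%g.

Section OneGroup.
Variable gT : finGroupType.
Hypothesis G_ce : class_exponent gT.
Implicit Types x y z h k : gT.
Local Notation add := (wop wa).
Local Notation br := (wop wb).

Definition triple x y z (o : option bool) := sub2 (Some true) (Some false) z x y o.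

(* [h] is the value at [x, y, z] of a word that equals [exp f] in the free case. *)
Definition lrel x y z (f : T) h := ord_ge 1 f /\ (mexp f, h) \in graph p c (triple x y z).

Lemma lrel_fun x y z f f' h h' : lrel x y z f h -> lrel x y z f' h' -> f = f' -> h = h'.
Proof.
move=> [_ Gh] [_ Gh'] eqf; rewrite -eqf in Gh'; have [eG cG] := G_ce.
exact: (graph_functional p_prime c_lt_p c_gt0 eG cG Gh Gh').
Qed.

Lemma lrel_gen x y z o : lrel x y z (X o) (triple x y z o).
Proof.
split; first exact: ordge_gen.
by apply: mem_gen; apply/imsetP; exists o.
Qed.

Lemma lrelx x y z : lrel x y z (X (Some true)) x. Proof. exact: lrel_gen (Some true). Qed.
Lemma lrely x y z : lrel x y z (X (Some false)) y. Proof. exact: lrel_gen (Some false). Qed.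
Lemma lrelz x y z : lrel x y z (X None) z. Proof. exact: lrel_gen None. Qed.

Lemma wop_pair w (u v : magnus (option bool) p c) h k :
  wop w (u, h) (v, k) = (wop w u v, wop w h k).
Proof. by elim: w => [|[[]|] w IHw]; rewrite ?wop_nil // !wop_cons IHw. Qed.

Lemma lrelD x y z f g h k : lrel x y z f h -> lrel x y z g k -> lrel x y z (f + g) (add h k).
Proof.
move=> [of1 Gh] [og Gk]; split; first exact: ordgeD.
by rewrite -(proj1 wab) // -wop_pair mem_wop.
Qed.

Lemma lrelB x y z f g h k : lrel x y z f h -> lrel x y z g k -> lrel x y z (ad g f) (br h k).
Proof.
move=> [of1 Gh] [og Gk]; split; first exact: ordge_ad.
by rewrite -(proj2 wab) // -wop_pair mem_wop.
Qed.

Lemma lrel0 x y z : lrel x y z 0 1%g.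
Proof.
split; first exact: ordge0.
have -> : mexp 0 = 1%g :> magnus (option bool) p c.
  by apply: val_inj; rewrite val_mexp ?texp0 //; apply: ordge0.
exact: group1.
Qed.

Lemma lrelN x y z f h : lrel x y z f h -> lrel x y z (- f) h^-1%g.
Proof.
move=> [of1 Gh]; split; first exact: ordgeN.
have -> : (mexp (- f)%R, h^-1)%g = (mexp f, h)^-1%g; last by rewrite groupV.
congr (_, _); apply: (mulgI (mexp f)); rewrite mulgV; apply: val_inj.
by rewrite val_magnusM !val_mexp ?texpN //; apply: ordgeN.
Qed.

Lemma lrelMn x y z f h n : lrel x y z f h -> lrel x y z (f *+ n) (h ^+ n)%g.
Proof.
move=> [of1 Gh]; have ofn i : ord_ge 1 (f *+ i).
  by elim: i => [|i IHi]; [apply: ordge0 | rewrite mulrS; apply: ordgeD].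
split=> //; have -> : (mexp (f *+ n)%R, h ^+ n)%g = ((mexp f, h) ^+ n)%g; last exact: groupX.
elim: n => [|n IHn].
  by congr (_, _); apply: val_inj; rewrite val_mexp ?texp0 //; apply: ordge0.
rewrite [RHS]expgS -IHn; congr (_, _); last by rewrite expgS.
by apply: val_inj; rewrite val_magnusM !val_mexp // !texpMn // exprS.
Qed.

Lemma addwC x y : add x y = add y x.
Proof.
by apply: (lrel_fun (lrelD (lrelx x y 1) (lrely x y 1)) (lrelD (lrely x y 1) (lrelx x y 1))); rewrite addrC.
Qed.

Lemma addwA x y z : add x (add y z) = add (add x y) z.
Proof.
apply: (lrel_fun (lrelD (lrelx x y z) (lrelD (lrely x y z) (lrelz x y z)))
  (lrelD (lrelD (lrelx x y z) (lrely x y z)) (lrelz x y z))); exact: addrA.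
Qed.

Lemma addw1 x : add x 1%g = x.
Proof. by apply: (lrel_fun (lrelD (lrelx x 1 1) (lrel0 x 1 1)) (lrelx x 1 1)); rewrite addr0. Qed.

Lemma addwV x : add x x^-1%g = 1%g.
Proof. by apply: (lrel_fun (lrelD (lrelx x 1 1) (lrelN (lrelx x 1 1))) (lrel0 x 1 1)); rewrite subrr. Qed.

Lemma addwX x n : add x (x ^+ n)%g = (x ^+ n.+1)%g.
Proof.
by apply: (lrel_fun (lrelD (lrelx x 1 1) (lrelMn n (lrelx x 1 1))) (lrelMn n.+1 (lrelx x 1 1))); rewrite mulrS.
Qed.

Lemma brwDl x y z : br (add x y) z = add (br x z) (br y z).
Proof.
apply: (lrel_fun (lrelB (lrelD (lrelx x y z) (lrely x y z)) (lrelz x y z))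
  (lrelD (lrelB (lrelx x y z) (lrelz x y z)) (lrelB (lrely x y z) (lrelz x y z)))).
exact: adDr.
Qed.

Lemma brwDr x y z : br z (add x y) = add (br z x) (br z y).
Proof.
apply: (lrel_fun (lrelB (lrelz x y z) (lrelD (lrelx x y z) (lrely x y z)))
  (lrelD (lrelB (lrelz x y z) (lrelx x y z)) (lrelB (lrelz x y z) (lrely x y z)))).
exact: adDl.
Qed.

Lemma brw1r x : br x 1%g = 1%g.
Proof. by apply: (lrel_fun (lrelB (lrelx x 1 1) (lrel0 x 1 1)) (lrel0 x 1 1)); rewrite ad0l. Qed.

Lemma brw1l x : br 1%g x = 1%g.
Proof. by apply: (lrel_fun (lrelB (lrel0 x 1 1) (lrelx x 1 1)) (lrel0 x 1 1)); rewrite ad0r. Qed.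

Lemma brw_commute x y : commute x y -> br x y = 1%g.
Proof. by move/(wop_commute wb)->; rewrite brw1r brw1l mulg1. Qed.

(** Modulo the next term [y] becomes central, and the bracket word is trivial on commuting
    arguments. *)
Lemma brw_lcn (k : nat) x y : (0 < k)%N -> y \in 'L_k([set: gT])%g -> br x y \in 'L_k.+1([set: gT])%g.
Proof.
move=> k_gt0 Ly; set N := ('L_k.+1([set: gT]))%G.
have nN z : z \in 'N(N)%g by apply: (subsetP (lcn_norm _ _)); rewrite inE.
have cosM : {morph coset N : a b / (a * b)%g} by move=> a b; rewrite morphM.
apply: coset_idr => //; rewrite wop_morph // wop_commute.
  have e1 : coset N 1%g = 1%g by exact: morph1.
  have -> : br (coset N x) 1%g = 1%g by rewrite -{1}e1 -wop_morph // brw1r.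
  have -> : br 1%g (coset N y) = 1%g by rewrite -{1}e1 -wop_morph // brw1l.
  exact: mulg1.
apply/commgP; rewrite -morphR //; apply/eqP; apply: coset_id.
rewrite -invgR groupV -addn1; apply: mem_lcn_comm => //.
Qed.

Lemma brw_nil x y : iter c (br x) y = 1%g.
Proof.
have [_ cG] := G_ce.
suff : iter c (br x) y \in 'L_c.+1([set: gT])%g by rewrite cG => /set1P.
elim: c => [|n IHn]; first by rewrite lcn1 inE.
by rewrite iterS; apply: brw_lcn.
Qed.

End OneGroup.

(** Since [exp X_1 exp X_2] is the exponential of a Lie element, the group law
    is a term in the Lazard operations. *)
Lemma lazard_morph (gT hT : finGroupType) (f : gT -> hT) :
  class_exponent gT -> class_exponent hT ->
  (forall x y, f (wop wa x y) = wop wa (f x) (f y)) ->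
  (forall x y, f (wop wb x y) = wop wb (f x) (f y)) ->
  {morph f : x y / (x * y)%g}.
Proof.
move=> Gce Hce fD fB x y.
have f1 : f 1%g = 1%g.
  have := fD 1%g 1%g; rewrite (addw1 Gce) => eqf.
  have := addw1 Hce (f 1%g); rewrite -(addwV Hce (f 1%g)) (addwA Hce) -eqf.
  by rewrite (addwV Hce).
have [F LF eqF] : exists2 F : T, isLie F & (mexp (X (Some true)) * mexp (X (Some false)))%g = mexp F.
  apply: (magnus_gen_exp p_prime c_lt_p c_gt0 (isT : Some true != Some false)).
  by rewrite groupM ?mem_magnus_gen.
have gens o : f (triple x y 1 o) = triple (f x) (f y) 1 o by case: o => [[]|].
(* A Lie polynomial is evaluated by the two operations alone, so [f] carries its value at [x], [y]
   to its value at [f x], [f y]. *)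
have lift_lie i E : lie i E -> exists2 h, lrel x y 1 E h & lrel (f x) (f y) 1 E (f h).
  elim=> {i E} [o|i|i E E' _ [h Gh Hh] _ [h' Gh' Hh']|i E o _ [h Gh Hh]].
  - exists (triple x y 1 o); first exact: lrel_gen.
    by rewrite gens; apply: lrel_gen.
  - by exists 1%g; rewrite ?f1; apply: lrel0.
  - by exists (wop wa h h'); rewrite ?fD; apply: lrelD.
  exists (wop wb h (triple x y 1 o)); rewrite ?fB ?gens; apply: lrelB => //; exact: lrel_gen.
have [h Gh Hh] : exists2 h, lrel x y 1 F h & lrel (f x) (f y) 1 F (f h).
  elim: LF {eqF} => {F} [i E lE|E E' _ [h Gh Hh] _ [h' Gh' Hh']]; first exact: lift_lie lE.
  by exists (wop wa h h'); rewrite ?fD; apply: lrelD.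
have prodrel (kT : finGroupType) (a b : kT) : lrel a b 1 F (a * b)%g.
  split; first exact: proj1 Gh.
  have [_ Ga] := lrelx a b 1; have [_ Gb] := lrely a b 1.
  by rewrite -eqF; have := groupM Ga Gb.
by rewrite -(lrel_fun Gce Gh (prodrel _ x y) erefl) (lrel_fun Hce Hh (prodrel _ _ _) erefl).
Qed.

(** When all brackets vanish, negation preserves both operations. Negation is group inversion, which
    is then multiplicative by [lazard_morph]. *)
Lemma brw_trivial_abelian (gT : finGroupType) : class_exponent gT ->
  (forall x y : gT, wop wb x y = 1%g) -> abelian [set: gT].
Proof.
move=> Gce br1.
have iM : {morph (fun z : gT => z^-1%g) : x y / (x * y)%g}.
  apply: lazard_morph => // x y; last by rewrite !br1 invg1.
  by apply: (lrel_fun Gce (lrelN (lrelD (lrelx x y 1) (lrely x y 1)))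
    (lrelD (lrelN (lrelx x y 1)) (lrelN (lrely x y 1)))); rewrite opprD.
apply/centsP=> x _ y _; apply: invg_inj; by rewrite iM -invMg.
Qed.

End Lazard.

(** * The class two extension of an algebra *)

(** Additivity is all that is recorded; over the prime field it gives bilinearity by
    [additive_scale]. *)
Record bialg (p : nat) := Bialg {
  bcar :> finLmodType 'F_p;
  bbr : bcar -> bcar -> bcar;
  bbrDl : forall x y z, bbr (x + y) z = bbr x z + bbr y z;
  bbrDr : forall x y z, bbr z (x + y) = bbr z x + bbr z y }.

Lemma additive_scale (p : nat) (U V : lmodType 'F_p) (f : U -> V) (k : 'F_p) (x : U) :
  {morph f : x y / x + y} -> f (k *: x) = k *: f x.
Proof.
move=> fD; have f0 : f 0 = 0 by apply: (addrI (f 0)); rewrite -fD !addr0.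
rewrite -[k]natr_Zp !scaler_nat; elim: (k : nat) => [|n IHn]; first by rewrite !mulr0n.
by rewrite !mulrS fD IHn.
Qed.

Lemma pair_mulrn (U V : zmodType) (x : U * V) n : x *+ n = (x.1 *+ n, x.2 *+ n).
Proof. by elim: n => [|n IHn]; rewrite ?mulr0n // !mulrS IHn. Qed.

Section Gadget.
Variables (p : nat) (L : bialg p).
Local Notation br := (@bbr p L).

Definition gadgetV := (L * 'F_p * 'F_p)%type.
Definition gadgetW := (L * L)%type.
Definition gadget := (gadgetV * gadgetW)%type.

HB.instance Definition _ := GRing.Zmodule.on gadgetV.
HB.instance Definition _ := GRing.Zmodule.on gadgetW.
HB.instance Definition _ := Finite.on gadget.
Implicit Types (v : gadgetV) (w : gadgetW) (a : gadget).

(** Any bilinear map is a 2-cocycle. This one is left asymmetric, which avoids halves; commutators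
    see it through [pairing]. *)
Definition cocycle v v' : gadgetW := (br v.1.1 v'.1.1 + v.1.2 *: v'.1.1, v.2 *: v'.1.1).

Lemma cocycleDl v v' u : cocycle (v + v') u = cocycle v u + cocycle v' u.
Proof.
case: v v' u => [[x s] t] [[y s'] t'] [[z r] q]; congr (_, _); rewrite /= scalerDl //.
by rewrite bbrDl addrACA.
Qed.

Lemma cocycleDr v v' u : cocycle u (v + v') = cocycle u v + cocycle u v'.
Proof.
case: v v' u => [[x s] t] [[y s'] t'] [[z r] q]; congr (_, _); rewrite /= scalerDr //.
by rewrite bbrDr addrACA.
Qed.

Lemma cocycle0l u : cocycle 0 u = 0.
Proof. by apply: (addrI (cocycle 0 u)); rewrite -cocycleDl !addr0. Qed.
Lemma cocycle0r u : cocycle u 0 = 0.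
Proof. by apply: (addrI (cocycle u 0)); rewrite -cocycleDr !addr0. Qed.
Lemma cocycleNl v u : cocycle (- v) u = - cocycle v u.
Proof. by apply: (addrI (cocycle v u)); rewrite -cocycleDl !subrr cocycle0l. Qed.

Definition gadget_mul a b : gadget := (a.1 + b.1, a.2 + b.2 + cocycle a.1 b.1).
Definition gadget_one : gadget := (0, 0).
Definition gadget_inv a : gadget := (- a.1, - a.2 + cocycle a.1 a.1).

Fact gadget_mulA : associative gadget_mul.
Proof.
move=> [v w] [v' w'] [v'' w'']; congr (_, _); rewrite /= ?addrA // cocycleDl cocycleDr.
rewrite -!addrA; congr (_ + (_ + _)); rewrite [RHS]addrCA; congr (_ + _).
by rewrite addrC -addrA.
Qed.

Fact gadget_mul1 : left_id gadget_one gadget_mul.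
Proof. by move=> [v w]; congr (_, _); rewrite /= add0r // cocycle0l addr0. Qed.

Fact gadget_mulV : left_inverse gadget_one gadget_inv gadget_mul.
Proof.
move=> [v w]; congr (_, _); first exact: addNr.
by rewrite /= cocycleNl addrAC addrK addNr.
Qed.

HB.instance Definition _ := Finite_isGroup.Build gadget
  gadget_mulA gadget_mul1 gadget_mulV.

Definition pairing v v' := cocycle v v' - cocycle v' v.

Lemma gadgetM a b : (a * b)%g = (a.1 + b.1, a.2 + b.2 + cocycle a.1 b.1) :> gadget.
Proof. by []. Qed.

Lemma gadget_comm a b : [~ a, b]%g = (0, pairing a.1 b.1) :> gadget.
Proof.
apply: (mulgI (b * a)%g); rewrite -commgC !gadgetM /= cocycle0r !addr0; congr (_, _).
  exact: addrC.
by rewrite /pairing [cocycle a.1 b.1 - _]addrC addrA addrK [b.2 + a.2]addrC.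
Qed.

Lemma gadgetX a n : (a ^+ n)%g = (a.1 *+ n, a.2 *+ n + cocycle a.1 a.1 *+ 'C(n, 2)) :> gadget.
Proof.
elim: n => [|n IHn]; first by rewrite expg0 !mulr0n addr0.
rewrite expgSr IHn gadgetM /=; congr (_, _); first by rewrite mulrSr.
have -> : cocycle (a.1 *+ n) a.1 = cocycle a.1 a.1 *+ n.
  by elim: n {IHn} => [|n IHn]; rewrite ?mulr0n ?cocycle0l // !mulrS cocycleDl IHn.
rewrite binS bin1 mulrnDr mulrSr -!addrA; congr (_ + _).
by rewrite addrCA; congr (_ + _); rewrite addrC.
Qed.

Hypotheses (p_prime : prime p) (p_gt2 : (2 < p)%N).

Lemma mulrn_p (U : lmodType 'F_p) (x : U) : x *+ p = 0.
Proof. by rewrite -scaler_nat (pchar_Fp_0 p_prime) scale0r. Qed.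

Lemma gadget_exponent a : (a ^+ p)%g = 1%g.
Proof.
(* The [p]-th power collects the cocycle ['C(p, 2)] times, a multiple of [p] because [p] is odd. *)
rewrite gadgetX; have /dvdnP[k ->] : (p %| 'C(p, 2))%N by apply: prime_dvd_bin.
have p0 (u : gadgetW) : u *+ p = 0.
  by rewrite pair_mulrn !mulrn_p.
rewrite mulrnA !p0 addr0; congr (_, _); rewrite pair_mulrn pair_mulrn /=.
have natp (r : 'F_p) : r *+ p = 0 by rewrite -mulr_natr (pchar_Fp_0 p_prime) mulr0.
by rewrite mulrn_p !natp.
Qed.

Lemma card_gadget : #|{: gadget}| = (#|L| ^ 3 * p ^ 2)%N.
Proof. by rewrite !card_prod card_Fp //; ring. Qed.

Hypothesis L_gt1 : (1 < #|L|)%N.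

(** The scalar [s] acts on [L] as the identity, so commutators survive even when the bracket
    vanishes, as in class one. *)
Lemma gadget_nonabelian : ~~ abelian [set: gadget].
Proof.
have [x x0] : exists x : L, x != 0.
  apply/existsP; apply: contraTT L_gt1; rewrite negb_exists -leqNgt => /forallP L0.
  by rewrite -(cards1 (0 : L)) -cardsT subset_leq_card //; apply/subsetP=> y _; rewrite inE; have := L0 y; rewrite negbK.
apply: contra x0 => /centsP cG.
have /commgP := cG ((0, 1, 0), 0) (in_setT _) ((x, 0, 0), 0) (in_setT _).
rewrite gadget_comm xpair_eqE eqxx /= xpair_eqE => /andP[/eqP/= + _].
have br0 y : br 0 y = 0 by apply: (addrI (br 0 y)); rewrite -bbrDl !addr0.
have br0r y : br y 0 = 0 by apply: (addrI (br y 0)); rewrite -bbrDr !addr0.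
by rewrite br0 br0r scaler0 scale1r add0r addr0 subr0 => ->.
Qed.

Lemma gadget_in_B : p.-nat #|L| -> in_B p 2 (#|L| ^ 3 * p ^ 2) [set: gadget]%G.
Proof.
move=> pL; have cardG : #|[set: gadget]| = (#|L| ^ 3 * p ^ 2)%N by rewrite cardsT card_gadget.
have pG : (p.-group [set: gadget])%g.
  by rewrite /pgroup cardG pnatM !pnatX pL pnat_id.
split=> //.
  apply/eqP; rewrite eqn_leq; apply/andP; split; last first.
    by rewrite ltnNge nil_class1 gadget_nonabelian.
  apply/(lcn_nil_classP 2 (pgroup_nil pG)); apply/trivgP.
  suff sub1 : [~: 'L_2([set: gadget]), [set: gadget]]%g \subset [1]%g by exact: sub1.
  rewrite gen_subG; apply/subsetP=> _ /imset2P[x y Lx _ ->].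
  suff x1 : x.1 = 0.
    rewrite gadget_comm x1 /pairing cocycle0l cocycle0r subrr; exact: set11.
  move: Lx; rewrite lcnSn => /gen_prodgP[n [F inF ->]].
  elim: n F inF => [|n IHn] F inF; first by rewrite big_ord0.
  rewrite big_ord_recl gadgetM /= IHn => [|i]; last exact: inF.
  by have /imset2P[z t _ _ ->] := inF ord0; rewrite gadget_comm addr0.
have : (exponent [set: gadget] %| p)%N by apply/exponentP=> x _; apply: gadget_exponent.
have [_ pdiv] := primeP p_prime => /pdiv/orP[|/eqP//].
rewrite -dvdn1 -trivg_exponent => /eqP G1; have := gadget_nonabelian.
by rewrite (_ : [set: gadget] = 1%g) ?abelian1 //; exact: G1.
Qed.

End Gadget.

(** * The commutator form and its centralizers *)

Section Pairing.
Variables (p : nat) (L : bialg p) (c : nat).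
Local Notation br := (@bbr p L).

(** Alternation, the Engel condition and a nonzero central element; for the algebra of a nontrivial
    [p]-group the last comes from the centre of the group. *)
Definition lie_like := [/\ forall x : L, br x x = 0, forall x y : L, iter c (br x) y = 0
  & exists2 z : L, z != 0 & forall y, br z y = 0].
Hypothesis L_lie : lie_like.

Lemma brC x y : br y x = - br x y.
Proof.
have [alt _ _] := L_lie; apply/eqP; rewrite -addr_eq0 addrC.
by have := alt (x + y); rewrite bbrDl !bbrDr !alt add0r addr0 => ->.
Qed.

Lemma brZr k x y : br x (k *: y) = k *: br x y.
Proof. by apply: (additive_scale (f := br x)) => ? ?; apply: bbrDr. Qed.

Lemma brZl k x y : br (k *: x) y = k *: br x y.
Proof. by apply: (additive_scale (f := br^~ y)) => ? ?; apply: bbrDl. Qed.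

Lemma br0l y : br 0 y = 0.
Proof. by apply: (addrI (br 0 y)); rewrite -bbrDl !addr0. Qed.

Lemma br_eigen x y k : br x y = k *: y -> k *: y = 0.
Proof.
have [_ nil _] := L_lie => eqxy; have := nil x y.
have -> n : iter n (br x) y = k ^+ n *: y.
  by elim: n => [|n IHn]; rewrite ?scale1r //= IHn brZr eqxy scalerA exprSr.
have [-> _|k0 /eqP] := eqVneq k 0; first by rewrite scale0r.
by rewrite scaler_eq0 expf_eq0 (negPf k0) andbF => /eqP->; rewrite scaler0.
Qed.

(** Iterating the equation [c] times brings in the vanishing power of [br x]. *)
Lemma br_fix x y k : y = k *: br x y -> y = 0.
Proof.
have [_ nil _] := L_lie => eqy.
have -> : y = k ^+ c *: iter c (br x) y; last by rewrite nil scaler0.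
elim: c => [|n IHn]; first by rewrite scale1r.
rewrite [LHS]eqy exprS iterS; have -> : br x y = br x (k ^+ n *: iter n (br x) y) by rewrite -IHn.
by rewrite brZr scalerA.
Qed.

Lemma pairingE (x y : L) (s t s' t' : 'F_p) :
  pairing (L := L) (x, s, t) (y, s', t') =
  (br x y *+ 2 + s *: y - s' *: x, t *: y - t' *: x).
Proof.
congr (_, _) => //=; rewrite (brC x y) opprD opprK mulr2n.
by rewrite -!addrA; congr (_ + _); rewrite addrCA.
Qed.

Definition kspace (v : gadgetV L) := v.1.1 == 0.

Lemma pairing_kspace (v u : gadgetV L) : kspace v -> v != 0 -> pairing v u = 0 <-> kspace u.
Proof.
case: v u => [[x s] t] [[y s'] t'] /eqP/= -> nz; rewrite pairingE /kspace /=.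
rewrite br0l mul0rn add0r !scaler0 !subr0.
split=> [[/eqP + /eqP]|/eqP->]; last by rewrite !scaler0.
rewrite !scaler_eq0 => /orP[/eqP s0|//] /orP[/eqP t0|//].
by move: nz; rewrite s0 t0 eqxx.
Qed.

(** If [s] is nonzero, the first coordinate says that [y - (s' / s) x] is fixed by [- (2 / s) br x],
    hence zero; if [s = 0], the second coordinate determines [y] outright. *)
Lemma pairing_generic (x y : L) (s t s' t' : 'F_p) : x != 0 -> (s, t) != 0 ->
  pairing (L := L) (x, s, t) (y, s', t') = 0 ->
  exists k, (y, s', t') = (k *: x, k * s, k * t) :> gadgetV L.
Proof.
have [alt _ _] := L_lie; move=> x0 st0; rewrite pairingE => -[/eqP + /eqP].
have cancelx (k k' : 'F_p) : k *: x = k' *: x -> k = k'.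
  by move/eqP; rewrite -subr_eq0 -scalerBl scaler_eq0 (negPf x0) orbF subr_eq0 => /eqP.
rewrite !subr_eq0 => /eqP eq1 /eqP eq2; have [s0|s0] := eqVneq s 0.
  have t0 : t != 0 by apply: contraNneq st0 => ->; rewrite s0.
  have eqy : y = (t' / t) *: x by rewrite mulrC -scalerA -eq2 scalerA mulVf ?scale1r.
  exists (t' / t); rewrite s0 mulr0 mulfVK // -eqy.
  congr (_, _, _); apply: cancelx; rewrite scale0r -eq1 s0 scale0r addr0.
  by rewrite eqy brZr alt scaler0 mul0rn.
pose k := s' / s; have ks : s' = k * s by rewrite mulfVK.
have y0 : y - k *: x = 0.
  apply: (br_fix (x := x) (k := - (s^-1 * 2%:R))).
  have -> : br x (y - k *: x) = br x y.
    by rewrite bbrDr -scaleNr brZr alt scaler0 addr0.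
  rewrite scaleNr -[(s^-1 * _) *: _]scalerA scaler_nat.
  have -> : br x y *+ 2 = s' *: x - s *: y by rewrite -eq1 addrK.
  by rewrite scalerBr opprB !scalerA mulVf // scale1r mulrC.
have eqy : y = k *: x by apply/eqP; rewrite -subr_eq0 y0.
exists k; rewrite -eqy -ks; congr (_, _, _); apply: cancelx.
by rewrite -eq2 eqy scalerA mulrC.
Qed.

Lemma pairing_base (x y : L) : pairing (L := L) (x, 0, 0) (y, 0, 0) = 0 <-> br x y *+ 2 = 0.
Proof.
rewrite pairingE !scale0r subr0 addr0 subrr; split=> [[]//|->//].
Qed.

End Pairing.

Section KspacePreserved.
Variables (p : nat) (p_prime : prime p) (c : nat).
Variables (L1 L2 : bialg p) (lie1 : lie_like L1 c) (lie2 : lie_like L2 c).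
Hypothesis L2_big : (p ^ 2 < #|L2|)%N.
Variables (F : gadgetV L1 -> gadgetV L2) (Fi : gadgetV L2 -> gadgetV L1).
Hypotheses (FK : cancel F Fi) (FiK : cancel Fi F).
Hypothesis FD : {morph F : u v / u + v}.
Hypothesis F_pair : forall u v, pairing u v = 0 <-> pairing (F u) (F v) = 0.

Lemma F0 : F 0 = 0.
Proof. by apply: (addrI (F 0)); rewrite -FD !addr0. Qed.

Lemma F_scale (k : 'F_p) (x : L1) (s t : 'F_p) (y : L2) (s' t' : 'F_p) :
  F (x, s, t) = (y, s', t') -> F (k *: x, k * s, k * t) = (k *: y, k * s', k * t').
Proof.
move=> eqF.
have natE (r : 'F_p) : r *+ (k : nat) = k * r by rewrite -mulr_natl natr_Zp.
have sE (U : lmodType 'F_p) (u : U) : u *+ (k : nat) = k *: u by rewrite -scaler_nat natr_Zp.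
have -> : (k *: x, k * s, k * t) = ((x, s, t) : gadgetV L1) *+ (k : nat).
  by rewrite pair_mulrn pair_mulrn /= sE !natE.
have -> : (k *: y, k * s', k * t') = ((y, s', t') : gadgetV L2) *+ (k : nat).
  by rewrite pair_mulrn pair_mulrn /= sE !natE.
rewrite -eqF; elim: (nat_of_ord k) => [|n IHn]; first by rewrite !mulr0n F0.
by rewrite !mulrS FD IHn.
Qed.

(* Otherwise [F v] commutes only with its multiples, or lies in [L2]; in the
   latter case a central [z] of [L2] lies in the image of the kernel space, and
   then so does all of [L2], which is too big. *)
Lemma F_kspace v : kspace v -> kspace (F v).
Proof.
move=> Kv; have [->|v0] := eqVneq v 0; first by rewrite F0 /kspace eqxx.
have comm_v u : kspace u -> pairing (F v) (F u) = 0.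
  by move=> Ku; apply/F_pair/(pairing_kspace lie1 u Kv v0).
apply: contraT => nK; case eqFv : (F v) comm_v => [[x s] t] comm_v.
have x0 : x != 0 by move: nK; rewrite eqFv.
have [/eqP st0|st0] := eqVneq (s, t) 0; last first.
  have multv u : kspace u -> exists k, u = (k *: v.1.1, k * v.1.2, k * v.2).
    move=> Ku; have := comm_v u Ku; case eqFu : (F u) => [[y s'] t'].
    case/(pairing_generic lie2 x0 st0) => k eqk; exists k; apply: (can_inj FK).
    by rewrite (F_scale k (x := v.1.1) (s := v.1.2) (t := v.2) (y := x) (s' := s) (t' := t)) ?eqFu ?eqk //; case: (v) eqFv => [[]].
  (* The plane would lie in the line of [v], which its two basis vectors refute. *)
  have [k eqk] := multv (0, 1, 0) (eqxx _).
  have [k' eqk'] := multv (0, 0, 1) (eqxx _).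
  have /= k1 : 1 = k * v.1.2 := congr1 (fun u : gadgetV L1 => u.1.2) eqk.
  have /= k2 : 0 = k * v.2 := congr1 (fun u : gadgetV L1 => u.2) eqk.
  have /= k2' : 1 = k' * v.2 := congr1 (fun u : gadgetV L1 => u.2) eqk'.
  have kn0 : k != 0 by apply: contraTneq (oner_neq0 'F_p) => k0; rewrite k1 k0 mul0r eqxx.
  move/eqP: k2; rewrite eq_sym mulf_eq0 (negPf kn0) /= => /eqP v2.
  by move/eqP: k2'; rewrite v2 mulr0 oner_eq0.
case/eqP: st0 => s0 t0; have [_ _ [z z0 zc]] := lie2.
have Kz : kspace (Fi (z, 0, 0)).
  apply/(pairing_kspace lie1 _ Kv v0)/F_pair; rewrite FiK eqFv s0 t0.
  by apply/(pairing_base lie2); rewrite (brC lie2 z) zc oppr0 mul0rn.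
have Fz0 : Fi (z, 0, 0) != 0.
  by apply: contraNneq z0 => /(congr1 F); rewrite FiK F0 => -[->].
have KL (y : L2) : kspace (Fi (y, 0, 0)).
  apply/(pairing_kspace lie1 _ Kz Fz0)/F_pair; rewrite !FiK.
  by apply/(pairing_base lie2); rewrite zc mul0rn.
suff : (#|L2| <= p ^ 2)%N by rewrite leqNgt L2_big.
pose h (y : L2) := ((Fi (y, 0, 0)).1.2, (Fi (y, 0, 0)).2).
have injh : injective h.
  move=> y y' eqh; suff : Fi (y, 0, 0) = Fi (y', 0, 0) by move/(can_inj FiK) => -[].
  move: eqh; rewrite /h; have := KL y; have := KL y'; rewrite /kspace.
  by case: (Fi (y, 0, 0)) (Fi (y', 0, 0)) => [[u s1] t1] [[u' s2] t2] /= /eqP-> /eqP-> [-> ->].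
by have := leq_card h injh; rewrite card_prod card_Fp.
Qed.

End KspacePreserved.

(** The vanishing of [a] is tested on a nonzero central [z] of [L1]. If [a z = 0], then [A z] is an
    eigenvector of a nilpotent map, with eigenvalue [- a x]. Otherwise [A z] is central and spans
    the image of [A], against the size of [L2]. *)
Lemma gadget_linear_iso (p c : nat) (L1 L2 : bialg p)
    (F : gadgetV L1 -> gadgetV L2) (Fi : gadgetV L2 -> gadgetV L1)
    (psi : gadgetW L1 -> gadgetW L2) :
  prime p -> (2 < p)%N -> lie_like L1 c -> lie_like L2 c ->
  #|L1| = #|L2| -> (p ^ 2 < #|L2|)%N -> (exists x y : L2, bbr x y != 0) ->
  cancel F Fi -> cancel Fi F -> {morph F : u v / u + v} ->
  (forall u v, pairing u v = 0 <-> pairing (F u) (F v) = 0) ->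
  (forall u v, psi (pairing u v) = pairing (F u) (F v)) ->
  exists A : L1 -> L2, [/\ bijective A, {morph A : x y / x + y}
    & forall x y, A (bbr x y) = bbr (A x) (A y)].
Proof.
move=> p_pr p_gt2 lie1 lie2 eqc big [x0 [y0 br0]] FK FiK FD F_pair F_psi.
have FiD : {morph Fi : u v / u + v} by move=> u v; apply: (can_inj FK); rewrite FD !FiK.
have Fi_pair u v : pairing u v = 0 <-> pairing (Fi u) (Fi v) = 0.
  by rewrite -{1}(FiK u) -{1}(FiK v); apply: iff_sym; apply: F_pair.
have FKs := F_kspace p_pr lie1 lie2 big FK FiK FD F_pair.
have big1 : (p ^ 2 < #|L1|)%N by rewrite eqc.
have FiKs := F_kspace p_pr lie2 lie1 big1 FiK FK FiD Fi_pair.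
pose A x := (F (x, 0, 0)).1.1; pose a x := (F (x, 0, 0)).1.2; pose b x := (F (x, 0, 0)).2.
have eqF x : F (x, 0, 0) = (A x, a x, b x) by rewrite /A /a /b; case: (F _) => [[]].
have pairD (x y : L1) : ((x + y, 0, 0) : gadgetV L1) = (x, 0, 0) + (y, 0, 0).
  by congr (_, _, _); rewrite addr0.
have AD : {morph A : x y / x + y} by move=> x y; rewrite /A pairD FD.
have aD : {morph a : x y / x + y} by move=> x y; rewrite /a pairD FD.
have A0 : A 0 = 0 by apply: (addrI (A 0)); rewrite -AD !addr0.
have Ainj0 x : A x = 0 -> x = 0.
  move=> Ax0; have : kspace (F (x, 0, 0)) by rewrite eqF Ax0 /kspace /=.
  by move/FiKs; rewrite FK => /eqP.
have Ainj : injective A.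
  move=> x y eqA; apply/eqP; rewrite -subr_eq0; apply/eqP/Ainj0; rewrite AD eqA -AD subrr; exact: A0.
have Abij : bijective A by apply: inj_card_bij => //; rewrite eqc.
have [alpha [beta eqe]] : exists alpha beta, F (0, 1, 0) = (0, alpha, beta).
  have : kspace (F (0, 1, 0)) by apply: FKs; apply: eqxx.
  by case: (F (0, 1, 0)) => [[u s] t] /= /eqP/= ->; exists s, t.
(* [(x, 0)] is the commutator of [x] with the first scalar, so [psi] determines [A] up to the factor
   [alpha]. *)
have psix x : (psi (x, 0)).1 = alpha *: A x.
  have -> : (x, 0) = pairing (L := L1) (0, 1, 0) (x, 0, 0).
    by rewrite (pairingE lie1) br0l mul0rn add0r scale1r !scale0r !subr0 .
  by rewrite F_psi eqe eqF (pairingE lie2) /= br0l mul0rn add0r scaler0 subr0.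
have key x y : alpha *: A (bbr x y) *+ 2 =
    bbr (A x) (A y) *+ 2 + a x *: A y - a y *: A x.
  have -> : alpha *: A (bbr x y) *+ 2 = alpha *: A (bbr x y *+ 2).
    by rewrite !mulr2n AD scalerDr.
  rewrite -psix; have -> : (bbr x y *+ 2, 0) = pairing (L := L1) (x, 0, 0) (y, 0, 0).
    by rewrite (pairingE lie1) !scale0r subr0 addr0 subrr.
  by rewrite F_psi !eqF (pairingE lie2).
have two0 : (2%:R : 'F_p) != 0.
  by rewrite -(dvdn_pcharf (pchar_Fp p_pr)) gtnNdvd.
have mul2I (U : lmodType 'F_p) (u : U) : u *+ 2 = 0 -> u = 0.
  by move/eqP; rewrite -scaler_nat scaler_eq0 (negPf two0) => /eqP.
have a0 x : a x = 0.
  have [_ _ [z z0 zc]] := lie1.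
  have Az0 : A z != 0 by apply: contraNneq z0 => /Ainj0->.
  have keyz y : bbr (A y) (A z) *+ 2 + a y *: A z - a z *: A y = 0.
    by rewrite -key (brC lie1 z) zc oppr0 A0 scaler0 mul0rn.
  have [az0|az0] := eqVneq (a z) 0.
    have /eqP := keyz x; rewrite az0 scale0r subr0 addr_eq0 -scaleNr -scaler_nat => /eqP eqz.
    have : bbr (2%:R *: A x) (A z) = (- a x) *: A z by rewrite brZl.
    move/(br_eigen lie2)/eqP; rewrite scaler_eq0 (negPf Az0) orbF oppr_eq0 => /eqP//.
  (* Bracketing [keyz] with [A z] shows that [[A z, A y]] is fixed by a multiple of [br (A z)]. *)
  have Dz y : bbr (A z) (A y) = 0.
    have eqy : a z *: A y = bbr (A y) (A z) *+ 2 + a y *: A z.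
      by apply/eqP; rewrite eq_sym -subr_eq0 keyz.
    apply: (br_fix lie2 (x := A z) (k := - ((a z)^-1 * 2%:R))).
    have [alt _ _] := lie2.
    rewrite -[LHS](_ : (a z)^-1 *: (a z *: bbr (A z) (A y)) = _); last by rewrite scalerA mulVf ?scale1r.
    have -> : a z *: bbr (A z) (A y) = - (bbr (A z) (bbr (A z) (A y)) *+ 2).
      rewrite -brZr eqy bbrDr brZr alt scaler0 addr0 !mulr2n bbrDr (brC lie2 (A z) (A y)).
      by rewrite -scaleN1r brZr scaleN1r -opprD.
    by rewrite scaleNr scalerN -[(_ * _) *: _]scalerA scaler_nat.
  (* As [A z] is central, each [A w] is [a w / a z] times [A z], so [a] is injective. *)
  suff : (#|L2| <= p)%N.
    by move=> le; move: big; rewrite ltnNge (leq_trans le) // -{1}[p]expn1 leq_exp2l // prime_gt1.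
  rewrite -[p in X in (_ <= X)%N](card_Fp p_pr) -eqc.
  apply: (leq_card (fun y : L1 => a y)) => y y' eqa; apply: Ainj.
  have eqy w : a z *: A w = a w *: A z.
    by apply/eqP; rewrite eq_sym -subr_eq0 -[X in X - _]add0r; have := keyz w; rewrite (brC lie2 (A z)) Dz oppr0 mul0rn => ->.
  by apply: (scalerI az0); rewrite !eqy eqa.
have keyA x y : alpha *: A (bbr x y) = bbr (A x) (A y).
  apply/eqP; rewrite -subr_eq0; apply/eqP/mul2I.
  by rewrite mulrnBl key !a0 !scale0r subr0 addr0 subrr.
(* Otherwise all brackets of [L2] vanish, [A] being onto. *)
have alpha0 : alpha != 0.
  apply: contraNneq br0 => al0; have [Ai _ AiK] := Abij.
  by rewrite -(AiK x0) -(AiK y0) -keyA al0 scale0r.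
have scaleK (u : L2) : alpha *: (alpha^-1 *: u) = u by rewrite scalerA mulfV ?scale1r.
exists (fun x => alpha^-1 *: A x); split=> [|x y|x y].
- apply: (bij_comp (f := fun u => alpha^-1 *: u) _ Abij).
  exists (fun u => alpha *: u) => u; first exact: scaleK.
  by rewrite scalerA mulVf ?scale1r.
- by rewrite AD scalerDr.
by rewrite brZl brZr -keyA !scalerA mulfVK.
Qed.

(** * The Lie algebra of a group *)

Lemma isog_setTP (gT hT : finGroupType) :
  ([set: gT] \isog [set: hT])%g <->
  exists2 f : gT -> hT, {morph f : x y / (x * y)%g} & bijective f.
Proof.
split=> [/isogP[f injf imf]|[f fM bijf]].
  have fM : {morph f : x y / (x * y)%g} by move=> x y; rewrite morphM ?inE.
  exists f => //; apply: inj_card_bij.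
    by move=> x y; apply: (injmP injf); rewrite inE.
  by rewrite -!cardsT -imf leq_morphim.
pose fm := Morphism (in2W fM : {in [set: gT] &, {morph f : x y / (x * y)%g}}).
apply/isogP; exists fm; first by apply/injmP => x y _ _; apply: bij_inj.
apply/eqP; rewrite -subTset; apply/subsetP=> y _; have [g _ gK] := bijf.
by rewrite -(gK y); apply: mem_morphim; rewrite inE.
Qed.

(** * Isomorphisms of the extensions against isomorphisms of the algebras *)

Section GadgetIsog.
Variables (p c : nat) (L1 L2 : bialg p).
Hypotheses (lie1 : lie_like L1 c) (lie2 : lie_like L2 c).

(** Hence the centre of the extension is exactly [W], and isomorphisms act on [V]. The test vector
    [(0, 1, 0)] kills the part in [L], a nonzero [z] the two scalars. *)
Lemma pairing_nondegenerate (L : bialg p) (v : gadgetV L) : lie_like L c ->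
  (forall u, pairing v u = 0) -> v = 0.
Proof.
move=> lieL; have [_ _ [z z0 _]] := lieL => v0; apply/eqP; apply: contraT => nz.
have Kv : kspace v.
  have := v0 (0, 1, 0); case: v {v0 nz} => [[x s] t]; rewrite (pairingE lieL) => -[+ _].
  have -> : bbr x 0 = 0 by rewrite (brC lieL 0 x) br0l oppr0.
  by rewrite mul0rn add0r scaler0 add0r scale1r /kspace /= => /eqP; rewrite oppr_eq0.
by have /(pairing_kspace lieL (z, 0, 0) Kv nz) := v0 (z, 0, 0); rewrite /kspace /= (negPf z0).
Qed.

Lemma gadget_center (f : gadget L1 -> gadget L2) (w : gadgetW L1) :
  {morph f : x y / (x * y)%g} -> bijective f -> (f (0, w)).1 = 0.
Proof.
move=> fM [g _ gK]; apply: (pairing_nondegenerate lie2) => u.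
have comm0 (b : gadget L1) : (((0%R, w) : gadget L1) * b)%g = (b * ((0%R, w) : gadget L1))%g.
  by rewrite !gadgetM /= cocycle0l cocycle0r !addr0 add0r addrC.
have : commute (f (0, w)) (f (g (u, 0))) by rewrite /commute -!fM comm0.
by rewrite gK => /commgP/eqP; rewrite gadget_comm => /(congr1 snd).
Qed.

Lemma gadget_fst (f : gadget L1 -> gadget L2) v w :
  {morph f : x y / (x * y)%g} -> bijective f -> (f (v, w)).1 = (f (v, 0)).1.
Proof.
move=> fM bijf; have -> : (v, w) = (((v, 0%R) : gadget L1) * ((0%R, w) : gadget L1))%g.
  by rewrite gadgetM /= cocycle0r !addr0 add0r.
by rewrite fM gadgetM /= gadget_center // addr0.
Qed.

End GadgetIsog.

(** [F] is induced on the quotient by the centre, [psi] on the centre; commutators tie them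
    together. *)
Lemma gadget_isog_alg (p c : nat) (L1 L2 : bialg p) :
  prime p -> (2 < p)%N -> lie_like L1 c -> lie_like L2 c ->
  #|L1| = #|L2| -> (p ^ 2 < #|L2|)%N -> (exists x y : L2, bbr x y != 0) ->
  ([set: gadget L1] \isog [set: gadget L2])%g ->
  exists A : L1 -> L2, [/\ bijective A, {morph A : x y / x + y}
    & forall x y, A (bbr x y) = bbr (A x) (A y)].
Proof.
move=> p_pr p_gt2 lie1 lie2 eqc big nab /isog_setTP[f fM bijf].
have [g fK gK] := bijf; have bijg : bijective g by exists f.
have gM : {morph g : x y / (x * y)%g} by move=> x y; apply: (can_inj fK); rewrite fM !gK.
pose F v := (f (v, 0)).1; pose Fi v := (g (v, 0)).1; pose psi w := (f (0, w)).2.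
have commf u v : f (0, pairing u v) = (0, pairing (F u) (F v)).
  have -> : (0, pairing u v) = [~ ((u, 0%R) : gadget L1), ((v, 0%R) : gadget L1)]%g by rewrite gadget_comm.
  rewrite -[RHS](gadget_comm (f (u, 0)) (f (v, 0))).
  have f1 : f 1%g = 1%g by apply: (mulgI (f 1%g)); rewrite -fM !mulg1.
  have fV x : f x^-1%g = (f x)^-1%g by apply: (mulgI (f x)); rewrite -fM !mulgV f1.
  by rewrite /commg /conjg !fM !fV.
have f0 : f (0, 0) = (0, 0) by apply: (mulgI (f 1%g)); rewrite -fM !mulg1.
apply: (@gadget_linear_iso p c L1 L2 F Fi psi) => //.
- move=> v; rewrite /Fi /F -(gadget_fst lie1 (f (v, 0)).1 (f (v, 0)).2 gM bijg).
  by rewrite -surjective_pairing fK.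
- move=> v; rewrite /Fi /F -(gadget_fst lie2 (g (v, 0)).1 (g (v, 0)).2 fM bijf).
  by rewrite -surjective_pairing gK.
- move=> u v; rewrite /F -(gadget_fst lie2 (u + v) (cocycle u v) fM bijf).
  have -> : (u + v, cocycle u v) = (((u, 0%R) : gadget L1) * ((v, 0%R) : gadget L1))%g.
    by rewrite gadgetM /= addr0 add0r.
  by rewrite fM.
- move=> u v; split=> [uv0|FF0].
    by have /(congr1 snd)/= := commf u v; rewrite uv0 f0.
  by have := commf u v; rewrite FF0 -f0 => /(can_inj fK)/(congr1 snd).
by move=> u v; rewrite /psi commf.
Qed.

Lemma alg_gadget_isog (p : nat) (L1 L2 : bialg p) (A : L1 -> L2) :
  bijective A -> {morph A : x y / x + y} ->
  (forall x y, A (bbr x y) = bbr (A x) (A y)) ->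
  ([set: gadget L1] \isog [set: gadget L2])%g.
Proof.
move=> [B AK BK] AD Abr; apply/isog_setTP.
have AZ k x : A (k *: x) = k *: A x by apply: additive_scale.
exists (fun a : gadget L1 => ((A a.1.1.1, a.1.1.2, a.1.2), (A a.2.1, A a.2.2)) : gadget L2).
  move=> [[[x s] t] [u v]] [[[x' s'] t'] [u' v']]; rewrite !gadgetM /=.
  by congr (_, _, _, (_, _)); rewrite ?AD ?AZ ?Abr.
exists (fun a : gadget L2 => ((B a.1.1.1, a.1.1.2, a.1.2), (B a.2.1, B a.2.2)) : gadget L1).
  by move=> [[[x s] t] [u v]] /=; rewrite !AK.
by move=> [[[x s] t] [u v]] /=; rewrite !BK.
Qed.

(* Packaged so that the instances on [lazard_type] depend on a single term. *)
Record lazard_data (p : nat) := LazardData {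
  ld_c : nat;
  ld_wa : seq (option bool);
  ld_wb : seq (option bool);
  ld_gT : finGroupType;
  ld_prime : prime p;
  ld_lt : (ld_c < p)%N;
  ld_gt0 : (0 < ld_c)%N;
  ld_words : lazard_words p ld_c ld_wa ld_wb;
  ld_ce : class_exponent p ld_c ld_gT }.

Section LazardAlgebra.
Variables (p : nat) (D : lazard_data p).
Local Notation pr := (ld_prime D).
Local Notation lt := (ld_lt D).
Local Notation gt0 := (ld_gt0 D).
Local Notation ws := (ld_words D).
Local Notation ce := (ld_ce D).

Definition lazard_type : Type := ld_gT D.
HB.instance Definition _ := Finite.on lazard_type.
Implicit Types x y z : lazard_type.

Definition lazard_add x y : lazard_type := wop (ld_wa D) x y.
Definition lazard_zero : lazard_type := 1%g.
Definition lazard_opp x : lazard_type := (x^-1)%g.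

Fact lazard_addA : associative lazard_add.
Proof. by move=> x y z; apply: (addwA pr lt gt0 ws ce). Qed.
Fact lazard_addC : commutative lazard_add.
Proof. by move=> x y; apply: (addwC pr lt gt0 ws ce). Qed.
Fact lazard_add0 : left_id lazard_zero lazard_add.
Proof. by move=> x; rewrite lazard_addC; apply: (addw1 pr lt gt0 ws ce). Qed.
Fact lazard_addN : left_inverse lazard_zero lazard_opp lazard_add.
Proof. by move=> x; rewrite lazard_addC; apply: (addwV pr lt gt0 ws ce). Qed.

HB.instance Definition _ := GRing.isZmodule.Build lazard_type
  lazard_addA lazard_addC lazard_add0 lazard_addN.

(** As [exp (n x) = (exp x) ^ n], multiples are powers, so scalars too are read off the
    multiplication table. *)
Lemma lazard_mulrn x n : x *+ n = (x ^+ n)%g.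
Proof.
elim: n => [|n IHn]; first by rewrite mulr0n.
by rewrite mulrS IHn; apply: (addwX pr lt gt0 ws ce).
Qed.

Lemma lazard_mulrn_mod x n : x *+ (n %% p) = x *+ n.
Proof.
have xp : x *+ p = 0 by rewrite lazard_mulrn; exact: (proj1 ce).
by rewrite {2}(divn_eq n p) mulrnDr [(_ * p)%N]mulnC mulrnA xp mul0rn add0r.
Qed.

Definition lazard_scale (k : 'F_p) x : lazard_type := x *+ (k : nat).

Fact lazard_scaleA a b x : lazard_scale a (lazard_scale b x) = lazard_scale (a * b) x.
Proof.
rewrite /lazard_scale -mulrnA mulnC -(lazard_mulrn_mod x (a * b)%N) /=; congr (_ *+ (_ %% _)).
exact/esym/Fp_cast/pr.
Qed.
Fact lazard_scale1 : left_id 1 lazard_scale.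
Proof. by move=> x; rewrite /lazard_scale /= modn_small ?mulr1n. Qed.
Fact lazard_scaleDr : right_distributive lazard_scale +%R.
Proof. by move=> a x y; rewrite /lazard_scale mulrnDl. Qed.
Fact lazard_scaleDl x : {morph lazard_scale^~ x : a b / a + b}.
Proof.
move=> a b; rewrite /lazard_scale -mulrnDr -(lazard_mulrn_mod x (a + b)%N) /=.
congr (_ *+ (_ %% _)); exact/Fp_cast/pr.
Qed.

HB.instance Definition _ := GRing.Zmodule_isLmodule.Build 'F_p lazard_type
  lazard_scaleA lazard_scale1 lazard_scaleDr lazard_scaleDl.

Definition lazard_br x y : lazard_type := wop (ld_wb D) x y.
Fact lazard_brDl x y z : lazard_br (x + y) z = lazard_br x z + lazard_br y z.
Proof. exact: (brwDl pr lt gt0 ws ce). Qed.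
Fact lazard_brDr x y z : lazard_br z (x + y) = lazard_br z x + lazard_br z y.
Proof. exact: (brwDr pr lt gt0 ws ce). Qed.

Definition lazard_alg : bialg p := @Bialg p lazard_type lazard_br lazard_brDl lazard_brDr.

Lemma lazard_scaleE (k : 'F_p) (x : lazard_alg) : k *: x = ((x : ld_gT D) ^+ k)%g.
Proof. exact: (@lazard_mulrn x k). Qed.

Lemma lazard_lie_like : (p.-group [set: ld_gT D])%g -> [set: ld_gT D] != 1%g ->
  lie_like lazard_alg (ld_c D).
Proof.
move=> pG ntG; split=> [x|x y|].
- exact: (brw_commute pr lt gt0 ws ce).
- exact: (brw_nil pr lt gt0 ws ce).
have : 'Z([set: ld_gT D])%g != 1%g by rewrite center_nil_eq1 ?(pgroup_nil pG).
case/trivgPn=> z /centerP[_ Zz] nz; exists (z : lazard_alg) => // y.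
by apply: (brw_commute pr lt gt0 ws ce); apply: Zz; rewrite inE.
Qed.

End LazardAlgebra.

Lemma lazard_isogP (p c : nat) (wa wb : seq (option bool)) (gT hT : finGroupType)
    (pr : prime p) (lt : (c < p)%N) (gt0 : (0 < c)%N) (ws : lazard_words p c wa wb)
    (ceG : class_exponent p c gT) (ceH : class_exponent p c hT) :
  let LG := lazard_alg (LazardData pr lt gt0 ws ceG) in
  let LH := lazard_alg (LazardData pr lt gt0 ws ceH) in
  (2 < p)%N -> (p.-group [set: gT])%g -> (p.-group [set: hT])%g ->
  #|gT| = #|hT| -> ~~ abelian [set: gT] -> ~~ abelian [set: hT] ->
  ([set: gadget LG] \isog [set: gadget LH])%g -> ([set: gT] \isog [set: hT])%g.
Proof.
move=> LG LH p_gt2 pG pH eqc nabG nabH isoGH.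
have nt1 (kT : finGroupType) : ~~ abelian [set: kT] -> [set: kT] != 1%g.
  by apply: contraNneq => ->; apply: abelian1.
have lieG : lie_like LG c := @lazard_lie_like p (LazardData pr lt gt0 ws ceG) pG (nt1 _ nabG).
have lieH : lie_like LH c := @lazard_lie_like p (LazardData pr lt gt0 ws ceH) pH (nt1 _ nabH).
(* A [p]-group of order at most [p ^ 2] is abelian. *)
have big : (p ^ 2 < #|LH|)%N.
  rewrite ltnNge; apply/negP=> le2; case/negP: (nabH); move: le2; have [_ _ [m cardH]] := pgroup_pdiv pH (nt1 _ nabH).
  rewrite -[#|LH|]/(#|hT|) -cardsT cardH leq_exp2l ?prime_gt1 // => lem.
  by apply: (@p2group_abelian _ p) => //; rewrite cardH pfactorK.
have nbr : exists x y : LH, bbr x y != 0.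
  have [/forallP br0|] := boolP [forall x : LH, forall y : LH, bbr x y == 0].
    case/negP: nabH; apply: (brw_trivial_abelian pr lt gt0 ws ceH) => x y.
    by have /forallP/(_ (y : LH))/eqP := br0 (x : LH).
  by rewrite negb_forall => /existsP[x]; rewrite negb_forall => /existsP[y nb]; exists x, y.
have [A [bijA AD Abr]] := gadget_isog_alg pr p_gt2 lieG lieH eqc big nbr isoGH.
apply/isog_setTP; exists A => //.
exact: (lazard_morph pr lt gt0 ws ceG ceH AD Abr).
Qed.

(** The operations are words, so group isomorphisms preserve them. *)
Lemma isog_lazard (p c : nat) (wa wb : seq (option bool)) (gT hT : finGroupType)
    (pr : prime p) (lt : (c < p)%N) (gt0 : (0 < c)%N) (ws : lazard_words p c wa wb)
    (ceG : class_exponent p c gT) (ceH : class_exponent p c hT) :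
  let LG := lazard_alg (LazardData pr lt gt0 ws ceG) in
  let LH := lazard_alg (LazardData pr lt gt0 ws ceH) in
  ([set: gT] \isog [set: hT])%g -> ([set: gadget LG] \isog [set: gadget LH])%g.
Proof.
move=> LG LH /isog_setTP[f fM bijf]; apply: (@alg_gadget_isog p LG LH f) => // x y.
  exact: (@wop_morph wa gT hT f x y fM).
exact: (@wop_morph wb gT hT f x y fM).
Qed.

Local Close Scope ring_scope.

(** * Expressions and loops on random access machines *)

Inductive expr :=
  | EReg of nat | EConst of nat | EAdd of expr & expr | ESub of expr & expr
  | EMul of expr & expr | EMem of expr.

Fixpoint eval (e : expr) (s : state) : nat :=
  match e with
  | EReg x => reg s x
  | EConst k => k
  | EAdd e1 e2 => eval e1 s + eval e2 s
  | ESub e1 e2 => eval e1 s - eval e2 s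
  | EMul e1 e2 => eval e1 s * eval e2 s
  | EMem e1 => Defs.mem s (eval e1 s)
  end.

(** A product is computed by repeated addition, three steps per unit of the left factor, so left
    factors must stay small. *)
Fixpoint ecost (e : expr) (s : state) : nat :=
  match e with
  | EReg _ | EConst _ => 1
  | EAdd e1 e2 | ESub e1 e2 => ecost e1 s + ecost e2 s + 1
  | EMul e1 e2 => ecost e1 s + ecost e2 s + (3 * eval e1 s + 4)
  | EMem e1 => ecost e1 s + 1
  end.

Fixpoint ebelow (K : nat) (e : expr) : bool :=
  match e with
  | EReg x => x < K
  | EConst _ => true
  | EAdd e1 e2 | ESub e1 e2 | EMul e1 e2 => ebelow K e1 && ebelow K e2
  | EMem e1 => ebelow K e1
  end.

(** The value is left in register [d]; registers above [d] are scratch. *)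
Fixpoint cexp (d : nat) (e : expr) : prog :=
  match e with
  | EReg x => Copy d x
  | EConst k => Const d k
  | EAdd e1 e2 => Seq (cexp d e1) (Seq (cexp d.+1 e2) (Add d d d.+1))
  | ESub e1 e2 => Seq (cexp d e1) (Seq (cexp d.+1 e2) (Defs.Sub d d d.+1))
  | EMul e1 e2 => Seq (cexp d e1) (Seq (cexp d.+1 e2)
      (Seq (Const d.+2 0) (Seq (Const d.+3 1)
        (Seq (While d (Seq (Add d.+2 d.+2 d.+1) (Defs.Sub d d d.+3))) (Copy d d.+2)))))
  | EMem e1 => Seq (cexp d e1) (Fetch d d)
  end.

(** Registers from [K] on are scratch, so states are compared below [K] only. *)
Definition agree (K : nat) (s s0 : state) :=
  Defs.mem s = Defs.mem s0 /\ forall r, r < K -> reg s r = reg s0 r.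

Lemma agree_refl K s : agree K s s. Proof. by []. Qed.
Lemma agree_trans K s1 s2 s3 : agree K s1 s2 -> agree K s2 s3 -> agree K s1 s3.
Proof. by move=> [m12 r12] [m23 r23]; split=> [|r ltr]; rewrite ?m12 // r12 ?r23. Qed.
Lemma agree_le K K' s s0 : K <= K' -> agree K' s s0 -> agree K s s0.
Proof. by move=> leK [ms rs]; split=> // r ltr; apply: rs; apply: leq_trans leK. Qed.
Lemma agree_set K s x v : K <= x -> agree K (set_reg s x v) s.
Proof. by move=> leK; split=> // r ltr; rewrite /= /upd ltn_eqF // (leq_trans ltr). Qed.

Lemma reg_set s x v r : reg (set_reg s x v) r = if r == x then v else reg s r.
Proof. by []. Qed.

Ltac regs := rewrite ?reg_set; repeat (case: eqP => ?); try lia.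

Lemma eval_agree K e s s0 : ebelow K e -> agree K s s0 -> eval e s = eval e s0.
Proof.
move=> + [ms rs]; elim: e => /= [x|//|e1 IH1 e2 IH2|e1 IH1 e2 IH2|e1 IH1 e2 IH2|e1 IH1].
- exact: rs.
- by case/andP=> /IH1-> /IH2->.
- by case/andP=> /IH1-> /IH2->.
- by case/andP=> /IH1-> /IH2->.
by move/IH1->; rewrite ms.
Qed.

Lemma ecost_agree K e s s0 : ebelow K e -> agree K s s0 -> ecost e s = ecost e s0.
Proof.
move=> + ag; elim: e => //= [e1 IH1 e2 IH2|e1 IH1 e2 IH2|e1 IH1 e2 IH2|e1 IH1].
- by case/andP=> /IH1-> /IH2->.
- by case/andP=> /IH1-> /IH2->.
- by case/andP=> b1 b2; rewrite IH1 // IH2 // (eval_agree b1 ag).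
by move/IH1->.
Qed.

Lemma ebelow_le K K' e : K <= K' -> ebelow K e -> ebelow K' e.
Proof.
move=> leK; elim: e => //= [x|e1 IH1 e2 IH2|e1 IH1 e2 IH2|e1 IH1 e2 IH2].
- by move/leq_trans; apply.
- by case/andP=> /IH1-> /IH2->.
- by case/andP=> /IH1-> /IH2->.
by case/andP=> /IH1-> /IH2->.
Qed.

Definition runs (P : prog) (s : state) (t : nat) (s' : state) :=
  exists2 t', t' <= t & exec P s t' s'.

Lemma runs_seq P Q s1 s2 s3 t1 t2 t : runs P s1 t1 s2 -> runs Q s2 t2 s3 ->
  t1 + t2 <= t -> runs (Seq P Q) s1 t s3.
Proof.
move=> [u1 l1 e1] [u2 l2 e2] le; exists (u1 + u2); last exact: ExecSeq e1 e2.
by apply: leq_trans le; apply: leq_add.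
Qed.

Lemma mul_loop d s a : reg s d = a -> reg s d.+3 = 1 ->
  exists s', [/\ runs (While d (Seq (Add d.+2 d.+2 d.+1) (Defs.Sub d d d.+3))) s (3 * a + 1) s',
    reg s' d.+2 = reg s d.+2 + a * reg s d.+1 & agree d s' s].
Proof.
elim: a s => [|a IHa] s sd s3.
  by exists s; split=> //; [exists 1 => //; apply: ExecWhileF | rewrite mul0n addn0].
pose s1 := set_reg s d.+2 (reg s d.+2 + reg s d.+1).
pose s2 := set_reg s1 d (reg s1 d - reg s1 d.+3).
have [|| s' [[t lett e] r2 ag]] := IHa s2.
- by rewrite /s2 /s1; regs.
- by rewrite /s2 /s1; regs.
exists s'; split.
- exists (1 + 1 + t).+1; first by lia.
  by apply: (ExecWhileT (s2 := s2)) e; [rewrite sd | apply: (ExecSeq (s2 := s1)); constructor].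
- by rewrite r2 /s2 /s1; regs.
apply: agree_trans ag _; apply: agree_trans (agree_set _ _ (leqnn d)) _.
by apply: agree_set; lia.
Qed.

Lemma cexpP d e s : ebelow d e -> exists s',
  [/\ runs (cexp d e) s (ecost e s) s', reg s' d = eval e s & agree d s' s].
Proof.
have bin op P e1 e2 d' s1 : (forall s, exec (P d') s 1 (set_reg s d' (op (reg s d') (reg s d'.+1)))) ->
    (forall s, exists s', [/\ runs (cexp d' e1) s (ecost e1 s) s', reg s' d' = eval e1 s & agree d' s' s]) ->
    (forall s, exists s', [/\ runs (cexp d'.+1 e2) s (ecost e2 s) s', reg s' d'.+1 = eval e2 s & agree d'.+1 s' s]) ->
    ebelow d' e2 ->
    exists s', [/\ runs (Seq (cexp d' e1) (Seq (cexp d'.+1 e2) (P d'))) s1 (ecost e1 s1 + ecost e2 s1 + 1) s',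
      reg s' d' = op (eval e1 s1) (eval e2 s1) & agree d' s' s1].
  move=> Pex IH1 IH2 b2; have [s2 [r2 v2 a2]] := IH1 s1.
  have [s3 [r3 v3 a3]] := IH2 s2; exists (set_reg s3 d' (op (reg s3 d') (reg s3 d'.+1))).
  rewrite (ecost_agree b2 a2) in r3; rewrite (eval_agree b2 a2) in v3; split.
  - apply: (runs_seq r2 (t2 := ecost e2 s1 + 1)); last by rewrite addnA.
    by apply: (runs_seq r3 (t2 := 1)) => //; exists 1.
  - by rewrite reg_set eqxx v3 (proj2 a3) // v2.
  apply: agree_trans (agree_set _ _ (leqnn d')) _; apply: agree_trans a2.
  exact: agree_le (leqnSn _) a3.
elim: e d s => [x|k|e1 IH1 e2 IH2|e1 IH1 e2 IH2|e1 IH1 e2 IH2|e1 IH1] d s /=.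
- move=> _; exists (set_reg s d (reg s x)); rewrite reg_set eqxx; split=> //; last exact: agree_set.
  by exists 1 => //; constructor.
- move=> _; exists (set_reg s d k); rewrite reg_set eqxx; split=> //; last exact: agree_set.
  by exists 1 => //; constructor.
- case/andP=> b1 b2; apply: (bin addn (fun d => Add d d d.+1)) => // [s1|s1|s1]; first by constructor.
    exact: IH1.
  by apply: IH2; apply: ebelow_le b2.
- case/andP=> b1 b2; apply: (bin subn (fun d => Defs.Sub d d d.+1)) => // [s1|s1|s1]; first by constructor.
    exact: IH1.
  by apply: IH2; apply: ebelow_le b2.
- case/andP=> b1 b2; have [s2 [r2 v2 a2]] := IH1 d s b1.
  have [s3 [r3 v3 a3]] := IH2 d.+1 s2 (ebelow_le (leqnSn _) b2).
  rewrite (ecost_agree b2 a2) in r3; rewrite (eval_agree b2 a2) in v3.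
  have v3d : reg s3 d = eval e1 s by rewrite (proj2 a3).
  pose s4 := set_reg s3 d.+2 0; pose s5 := set_reg s4 d.+3 1.
  have [|| s6 [r6 v6 a6]] := @mul_loop d s5 (eval e1 s).
  + by rewrite /s5 /s4; regs.
  + by rewrite /s5 reg_set eqxx.
  exists (set_reg s6 d (reg s6 d.+2)); split.
  + apply: (runs_seq r2 (t2 := ecost e2 s + (3 * eval e1 s + 4))); last by lia.
    apply: (runs_seq r3 (t2 := 3 * eval e1 s + 4)); last by lia.
    apply: (runs_seq (s2 := s4) (t1 := 1) (t2 := 3 * eval e1 s + 3)); [by exists 1 => //; constructor| |lia].
    apply: (runs_seq (s2 := s5) (t1 := 1) (t2 := 3 * eval e1 s + 2)); [by exists 1 => //; constructor| |lia].
    apply: (runs_seq r6 (t2 := 1)); [by exists 1 => //; constructor|lia].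
  + by rewrite reg_set eqxx v6 /s5 /s4 -v3; regs.
  apply: agree_trans (agree_set _ _ (leqnn d)) _; apply: agree_trans a6 _.
  apply: agree_trans (agree_set _ _ _) _; first by lia.
  apply: agree_trans (agree_set _ _ _) _; first by lia.
  by apply: agree_trans (agree_le (leqnSn _) a3) a2.
move=> b1; have [s2 [r2 v2 a2]] := IH1 d s b1.
exists (set_reg s2 d (Defs.mem s2 (reg s2 d))); split.
- by apply: (runs_seq r2 (t2 := 1)) => //; exists 1 => //; constructor.
- by rewrite reg_set eqxx v2 (proj1 a2).
exact: agree_trans (agree_set _ _ (leqnn d)) a2.
Qed.

(** * Counted loops, their compilation and a timed Hoare logic *)

Inductive cmd :=
  | Asg of nat & expr | Put of expr & expr | CSeq of cmd & cmd | For of nat & expr & cmd.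

(** Loops are counted, so execution is a total function returning state and cost. A turn costs 4
    beyond its body: test, copy, increment, decrement. *)
Fixpoint runc (c : cmd) (s : state) : state * nat :=
  match c with
  | Asg x e => (set_reg s x (eval e s), ecost e s + 1)
  | Put a e => (set_mem s (eval a s) (eval e s), ecost a s + ecost e s + 1)
  | CSeq c1 c2 => let r1 := runc c1 s in let r2 := runc c2 r1.1 in (r2.1, r1.2 + r2.2)
  | For x e c1 => iteri (eval e s)
      (fun k st => let r := runc c1 (set_reg st.1 x k) in (r.1, st.2 + (r.2 + 4)))
      (s, ecost e s + 3)
  end.

Fixpoint cbelow (K : nat) (c : cmd) : bool :=
  match c with
  | Asg x e => (x < K) && ebelow K e
  | Put a e => ebelow K a && ebelow K e
  | CSeq c1 c2 => cbelow K c1 && cbelow K c2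
  | For x e c1 => [&& x < K, ebelow K e & cbelow K c1]
  end.

(** The turns are counted in [d] and [d.+1], out of reach of the body, which sees only the copy in
    [x]. *)
Fixpoint ccomp (d : nat) (c : cmd) : prog :=
  match c with
  | Asg x e => Seq (cexp d e) (Copy x d)
  | Put a e => Seq (cexp d a) (Seq (cexp d.+1 e) (Store d d.+1))
  | CSeq c1 c2 => Seq (ccomp d c1) (ccomp d c2)
  | For x e c1 => Seq (cexp d e) (Seq (Const d.+1 0) (Seq (Const d.+2 1)
      (While d (Seq (Copy x d.+1) (Seq (ccomp d.+3 c1)
        (Seq (Add d.+1 d.+1 d.+2) (Defs.Sub d d d.+2)))))))
  end.

(** The last conclusion protects the counters of enclosing loops, which live between [K] and [d]. *)
Lemma ccompP K d c s s0 : K <= d -> cbelow K c -> agree K s s0 -> exists s',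
  [/\ runs (ccomp d c) s (runc c s0).2 s', agree K s' (runc c s0).1
    & forall r, K <= r < d -> reg s' r = reg s r].
Proof.
elim: c d s s0 => [x e|a e|c1 IH1 c2 IH2|x e c1 IH1] d s s0 leK /=.
- case/andP=> ltx be ag; have [s1 [r1 v1 a1]] := cexpP s (ebelow_le leK be).
  rewrite (ecost_agree be ag) in r1; rewrite (eval_agree be ag) in v1.
  exists (set_reg s1 x (reg s1 d)); split=> [||r /andP[leKr ltr]].
  + by apply: (runs_seq r1 (t2 := 1)) => //; exists 1 => //; constructor.
  + have [m1 g1] := agree_trans (agree_le leK a1) ag; split=> // r ltr.
    by rewrite !reg_set v1; case: eqP => // _; apply: g1.
  by rewrite reg_set gtn_eqF ?(leq_trans ltx) // (proj2 a1).
- case/andP=> ba be ag; have [s1 [r1 v1 a1]] := cexpP s (ebelow_le leK ba).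
  have ag1 := agree_trans (agree_le leK a1) ag.
  have [s2 [r2 v2 a2]] := cexpP s1 (ebelow_le (leqW leK) be).
  rewrite (ecost_agree ba ag) in r1; rewrite (eval_agree ba ag) in v1.
  rewrite (ecost_agree be ag1) in r2; rewrite (eval_agree be ag1) in v2.
  exists (set_mem s2 (reg s2 d) (reg s2 d.+1)); split=> [||r /andP[leKr ltr]].
  + apply: (runs_seq r1 (t2 := ecost e s0 + 1)); last by rewrite addnA.
    by apply: (runs_seq r2 (t2 := 1)) => //; exists 1 => //; constructor.
  + have [m2 g2] := agree_trans (agree_le (leqW leK) a2) ag1.
    by split=> //=; rewrite v2 (proj2 a2) // v1 m2.
  by rewrite /= (proj2 a2) ?(proj2 a1) // ltnW.
- case/andP=> b1 b2 ag; have [s1 [r1 a1 p1]] := IH1 d s s0 leK b1 ag.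
  have [s2 [r2 a2 p2]] := IH2 d s1 _ leK b2 a1.
  exists s2; split=> // [|r rr]; last by rewrite p2 ?p1.
  exact: runs_seq r1 r2 (leqnn _).
case/and3P=> ltx be bc ag; have [s1 [r1 v1 a1]] := cexpP s (ebelow_le leK be).
rewrite (ecost_agree be ag) in r1; rewrite (eval_agree be ag) in v1.
set n := eval e s0 in v1 *; pose body := fun k (st : state * nat) =>
  let r := runc c1 (set_reg st.1 x k) in (r.1, st.2 + (r.2 + 4)).
pose s3 := set_reg (set_reg s1 d.+1 0) d.+2 1.
have a3 : agree d s3 s.
  apply: agree_trans a1; apply: agree_trans (agree_set _ _ _) _; first by lia.
  by apply: agree_set; lia.
(* [k] turns are done and [m] remain; the remaining cost is a difference because [iteri]
   accumulates. *)
have loop m k st t0 : m + k = n -> reg st d = m -> reg st d.+1 = k -> reg st d.+2 = 1 ->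
    agree K st (iteri k body (s0, t0)).1 ->
    exists s', [/\ runs (While d (Seq (Copy x d.+1) (Seq (ccomp d.+3 c1)
        (Seq (Add d.+1 d.+1 d.+2) (Defs.Sub d d d.+2))))) st
        ((iteri n body (s0, t0)).2 - (iteri k body (s0, t0)).2 + 1) s',
      agree K s' (iteri n body (s0, t0)).1, (iteri k body (s0, t0)).2 <= (iteri n body (s0, t0)).2
      & forall r, K <= r < d -> reg s' r = reg st r].
  elim: m k st => [|m IHm] k st.
    rewrite add0n => -> vd vk v2 agst; exists st; split=> //.
    by exists 1; [rewrite subnn | apply: ExecWhileF].
  move=> eqn vd vk v2 agst; set st0 := iteri k body (s0, t0) in agst *.
  pose u1 := set_reg st x k.
  have agu1 : agree K u1 (set_reg st0.1 x k).
    by split=> [|r ltr]; rewrite ?(proj1 agst) //= /upd; case: eqP => // _; apply: (proj2 agst).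
  have [|u2 [ru2 au2 pu2]] := IH1 d.+3 u1 _ _ bc agu1; first by lia.
  have pr r : K <= r < d.+3 -> reg u2 r = reg st r.
    move=> rr; rewrite pu2 // /u1 reg_set gtn_eqF //; first by case/andP: rr => /(leq_trans ltx).
  pose u3 := set_reg u2 d.+1 (reg u2 d.+1 + reg u2 d.+2).
  pose u4 := set_reg u3 d (reg u3 d - reg u3 d.+2).
  have iterS' : iteri k.+1 body (s0, t0) = body k st0 by [].
  have [|||||s' [[t lett ex] as' lei ps']] := IHm k.+1 u4; first by rewrite addnS.
  + have := pr d; have := pr d.+2; rewrite vd v2 /u4 /u3 => e1 e2.
    by regs; rewrite e1 ?e2; lia.
  + have := pr d.+1; have := pr d.+2; rewrite vk v2 /u4 /u3 => e1 e2.
    by regs; rewrite e1 ?e2; lia.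
  + by rewrite /u4 /u3; regs; rewrite pr //; lia.
  + rewrite iterS' /=; apply: agree_trans au2; apply: agree_trans (agree_set _ _ leK) _.
    by apply: agree_set; lia.
  rewrite iterS' /= in lett lei.
  exists s'; split=> //; last 2 first.
  + by apply: leq_trans lei; rewrite leq_addr.
  + move=> r rr; have [_ ltr] := andP rr.
    by rewrite ps' // /u4 /u3; regs; rewrite pr //; lia.
  have [t2 le2 ex2] := ru2; exists (1 + (t2 + (1 + 1)) + t).+1; first by lia.
  apply: (ExecWhileT (s2 := u4)) ex; first by rewrite vd.
  apply: (ExecSeq (s2 := u1)); first by rewrite /u1 -vk; constructor.
  apply: (ExecSeq (s2 := u2)) ex2 _.
  by apply: (ExecSeq (s2 := u3)); constructor.
have [||||| s' [rs' as' _ ps']] := loop n 0 s3 (ecost e s0 + 3); first by rewrite addn0.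
- by rewrite /s3 -v1; regs.
- by rewrite /s3; regs.
- by rewrite /s3; regs.
- by apply: agree_trans ag; apply: agree_le a3.
exists s'; split=> // [|r rr]; last by rewrite ps' // (proj2 a3) //; case/andP: rr.
(* The accumulated cost only grows, so the truncated difference is exact. *)
have mono k : ecost e s0 + 3 <= (iteri k body (s0, ecost e s0 + 3)).2.
  by elim: k => // k IHk; rewrite /= (leq_trans IHk) ?leq_addr.
rewrite -/body -/n; have := mono n; set tn := (iteri n _ _).2 in rs' * => letn.
apply: (runs_seq r1 (t2 := 2 + (tn - (ecost e s0 + 3) + 1))); last by lia.
apply: (runs_seq (t1 := 1) (s2 := set_reg s1 d.+1 0) (t2 := 1 + (tn - (ecost e s0 + 3) + 1))); [by exists 1 => //; constructor| |by lia].
by apply: (runs_seq (t1 := 1) (s2 := s3) _ rs') => //; exists 1 => //; constructor.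
Qed.

(** Hoare triple with a time bound; termination is built in, [runc] being total. *)
Definition ht (P : state -> Prop) (c : cmd) (T : nat) (Q : state -> Prop) :=
  forall s, P s -> (runc c s).2 <= T /\ Q (runc c s).1.

Lemma ht_seq P Q R c1 c2 T1 T2 : ht P c1 T1 Q -> ht Q c2 T2 R -> ht P (CSeq c1 c2) (T1 + T2) R.
Proof.
move=> h1 h2 s Ps /=; have [t1 Q1] := h1 s Ps; have [t2 R2] := h2 _ Q1.
by split=> //; apply: leq_add.
Qed.

Lemma ht_for (I : nat -> state -> Prop) (P : state -> Prop) x e c n T0 T1 :
  (forall s, P s -> [/\ eval e s = n, ecost e s <= T0 & I 0 s]) ->
  (forall k, k < n -> forall s, I k s ->
     (runc c (set_reg s x k)).2 <= T1 /\ I k.+1 (runc c (set_reg s x k)).1) ->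
  ht P (For x e c) (T0 + 3 + n * (T1 + 4)) (I n).
Proof.
move=> hP hI s Ps /=; have [-> le0 I0] := hP s Ps.
set F := fun k st => _; set st := (s, _).
suff gen m : m <= n -> (iteri m F st).2 <= T0 + 3 + m * (T1 + 4) /\ I m (iteri m F st).1.
  exact: gen.
elim: m => [_|m IHm ltm] /=; first by rewrite mul0n addn0 leq_add2r.
have [le1 Im] := IHm (ltnW ltm); have [le2 Im1] := hI m ltm _ Im.
by split=> //; rewrite mulSn; lia.
Qed.

(** * The program *)

Lemma nth_allpairs_mul (S T R : Type) (f : S -> T -> R) (s : seq S) (t : seq T) x0 y0 z0 i j :
  i < size s -> j < size t ->
  nth z0 [seq f x y | x <- s, y <- t] (i * size t + j) = f (nth x0 s i) (nth y0 t j).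
Proof.
elim: s i => [|x s IHs] [|i] //= lti ltj; rewrite nth_cat size_map.
  by rewrite mul0n add0n ltj (nth_map y0).
by rewrite mulSn -addnA ltnNge leq_addr /= addKn IHs.
Qed.

(** * Mixed radix numbering of tuples *)

Fixpoint combos (ns : seq nat) : seq (seq nat) :=
  if ns is n :: ns' then [seq k :: v | k <- iota 0 n, v <- combos ns'] else [:: [::]].

(** Position of [v] in the lexicographic list [combos ns], which becomes the name of an element in
    the output table. *)
Fixpoint code (ns v : seq nat) : nat :=
  match ns, v with
  | n :: ns', k :: v' => k * foldr muln 1 ns' + code ns' v'
  | _, _ => 0
  end.

Lemma size_combos ns : size (combos ns) = foldr muln 1 ns.
Proof. by elim: ns => //= n ns IHns; rewrite size_allpairs size_iota IHns. Qed.

Definition in_range (v ns : seq nat) := all2 ltn v ns.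

Lemma mem_combos ns v : (v \in combos ns) = in_range v ns.
Proof.
elim: ns v => [|n ns IHns] [|k v] //=.
  by apply/negbTE/negP=> /allpairsP[[a b] [_ _ ]].
rewrite -IHns; apply/allpairsP/andP=> [[[a b] /= [ia ib [-> ->]]]|[ltk iv]].
  by move: ia; rewrite mem_iota.
by exists (k, v); rewrite mem_iota.
Qed.

Lemma combos_uniq ns : uniq (combos ns).
Proof.
elim: ns => //= n ns IHns; apply: allpairs_uniq => //; first exact: iota_uniq.
by move=> [a b] [a' b'] _ _ [-> ->].
Qed.

Lemma nth_combos ns v : in_range v ns ->
  code ns v < size (combos ns) /\ nth [::] (combos ns) (code ns v) = v.
Proof.
elim: ns v => [|n ns IHns] [|k v] //= /andP[ltk inv].
have [ltc eqc] := IHns v inv; rewrite -size_combos.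
split; last by rewrite (nth_allpairs_mul _ 0 [::]) ?size_iota // nth_iota // add0n eqc.
rewrite size_allpairs size_iota; apply: leq_trans (_ : k.+1 * size (combos ns) <= _).
  by rewrite mulSn addnC ltn_add2r.
by rewrite leq_mul2r ltk orbT.
Qed.

(* Registers: input length [N ^ 2], group order [N], address of a copy of the
   input table, output address, loop index. *)
Definition rQ := 0.
Definition rN := 1.
Definition rB := 2.
Definition rO := 3.
Definition ri := 4.

Section Program.
Variables (p : nat) (wa wb : seq (option bool)).

Definition tblE (e1 e2 : expr) := EMem (EAdd (EReg rB) (EAdd (EMul e1 (EReg rN)) e2)).
Definition powE (e : expr) n := iter n (tblE e) e.
(* The position of the unit is not known, so the empty word is [e1 ^+ p] and, in
   [scaleE], [e ^+ k] is [e ^+ (k + p)]. *)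
Fixpoint wordE (w : seq (option bool)) (e1 e2 : expr) :=
  match w with
  | [::] => powE e1 p.-1
  | Some true :: w' => tblE e1 (wordE w' e1 e2)
  | Some false :: w' => tblE e2 (wordE w' e1 e2)
  | None :: w' => wordE w' e1 e2
  end.
(* Truncated subtraction: the value is 1 if [e = k], else 0. *)
Definition eqE (e : expr) k := ESub (EConst 1) (EAdd (ESub e (EConst k)) (ESub (EConst k) e)).
Definition scaleE (es e : expr) n :=
  iteri n (fun k acc => EAdd (EMul (eqE es k) (powE e (k + p.-1))) acc) (EConst 0).
(** For summands below [p] one subtraction suffices; the factor of [p] is 1 exactly when the sum
    reaches [p]. *)
Definition addmodE (e1 e2 : expr) :=
  ESub (EAdd e1 e2) (EMul (ESub (EConst 1) (ESub (EConst p) (EAdd e1 e2))) (EConst p)).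

(* Registers 5-9 and 10-14 hold the coordinates [x, s, t, u, w] of the factors;
   an element is named by its mixed radix code for the digits [N, p, p, N, N]. *)
Definition outE : expr :=
  let R := EReg in
  let N2 := EMul (R rN) (R rN) in
  EAdd (EMul (wordE wa (R 5) (R 10)) (EMul (EConst (p * p)) N2))
  (EAdd (EMul (addmodE (R 6) (R 11)) (EMul (EConst p) N2))
  (EAdd (EMul (addmodE (R 7) (R 12)) N2)
  (EAdd (EMul (wordE wa (wordE wa (R 8) (R 13))
                       (wordE wa (wordE wb (R 5) (R 10)) (scaleE (R 6) (R 10) p))) (R rN))
        (wordE wa (wordE wa (R 9) (R 14)) (scaleE (R 7) (R 10) p))))).

Definition emit := CSeq (Put (EReg rO) outE) (Asg rO (EAdd (EReg rO) (EConst 1))).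

Definition boundE (b : bool) := if b then EReg rN else EConst p.
Fixpoint nest (xs : seq (nat * bool)) (c : cmd) : cmd :=
  if xs is (x, b) :: xs' then For x (boundE b) (nest xs' c) else c.

Definition loops k := [:: (k, true); (k + 1, false); (k + 2, false); (k + 3, true); (k + 4, true)].

(* The copy is placed beyond the [N ^ 6 * p ^ 4] cells of the output. *)
Definition baseE := EAdd (iter 6 (EMul (EReg rN)) (EConst (p ^ 4))) (EConst 1).

(* Adds 1 while [ri ^ 2 < N ^ 2]. *)
Definition rootE := EAdd (EReg rN)
  (ESub (EConst 1) (ESub (EConst 1) (ESub (EReg rQ) (EMul (EReg ri) (EReg ri))))).

(** The output starts at cell 1, on top of the input, which is why the table is copied beforehand;
    the length goes to cell 0 at the very end. *)
Definition program : cmd :=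
  CSeq (Asg rQ (EMem (EConst 0)))
  (CSeq (For ri (EReg rQ) (Asg rN rootE))
  (CSeq (Asg rB baseE)
  (CSeq (For ri (EReg rQ) (Put (EAdd (EReg rB) (EReg ri)) (EMem (EAdd (EConst 1) (EReg ri)))))
  (CSeq (Asg rO (EConst 1))
  (CSeq (nest (loops 5) (nest (loops 10) emit))
        (Put (EConst 0) (ESub (EReg rO) (EConst 1)))))))).

Lemma ebelow_powE K e n : 2 < K -> ebelow K e -> ebelow K (powE e n).
Proof. by move=> lt2 be; elim: n => //= n IHn; rewrite lt2 be IHn (ltn_trans _ lt2). Qed.

Lemma ebelow_wordE K w e1 e2 : 2 < K -> ebelow K e1 -> ebelow K e2 -> ebelow K (wordE w e1 e2).
Proof.
move=> lt2 b1 b2; have lt1 : 1 < K by apply: ltn_trans lt2.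
by elim: w => [|[[]|] w IHw] //=; rewrite ?ebelow_powE // lt2 lt1 ?b1 ?b2 IHw.
Qed.

Lemma ebelow_scaleE K es e n : 2 < K -> ebelow K es -> ebelow K e -> ebelow K (scaleE es e n).
Proof. by move=> lt2 bs be; elim: n => //= n IHn; rewrite bs ebelow_powE //= IHn. Qed.

Lemma cbelow_program : cbelow 15 program.
Proof. by rewrite /= /outE /addmodE /= !ebelow_wordE ?ebelow_scaleE //= ?ebelow_wordE ?ebelow_scaleE. Qed.

Section Run.
Variables (gT : finGroupType) (sG : seq gT).
Hypotheses (p_gt0 : 0 < p) (expG : forall x : gT, (x ^+ p = 1)%g).
Hypotheses (uniqG : uniq sG) (memG : forall x, x \in sG).
Let N := size sG.
Let v := [seq index (x * y)%g sG | x <- sG, y <- sG].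
Let M2 := N ^ 6 * p ^ 4.
Let B := M2.+1.

Definition table_at s := [/\ reg s rN = N, reg s rB = B
  & forall k, k < N * N -> Defs.mem s (B + k) = nth 0 v k].

(** Group elements are handled by their positions in [sG], with value and cost bound carried
    together. *)
Definition den s e (h : gT) K := eval e s = index h sG /\ ecost e s <= K.

Lemma index_lt h : index h sG < N. Proof. by rewrite index_mem. Qed.

Lemma den_tbl s e1 e2 h1 h2 K1 K2 : table_at s -> den s e1 h1 K1 -> den s e2 h2 K2 ->
  den s (tblE e1 e2) (h1 * h2)%g (K1 + K2 + (3 * N + 9)).
Proof.
move=> [sN sB tb] [v1 c1] [v2 c2]; split=> /=.
  have l1 := index_lt h1; have l2 := index_lt h2.
  rewrite sB sN v1 v2 tb; last first.
    by apply: leq_trans (_ : (index h1 sG).+1 * N <= _); [rewrite mulSn addnC ltn_add2r | rewrite leq_mul2r l1 orbT].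
  by rewrite (nth_allpairs_mul _ 1%g 1%g) // !nth_index.
by have := index_lt h1; rewrite v1; lia.
Qed.

Definition cpow K n := n.+1 * (K + (3 * N + 9)).

Lemma den_pow s e h K n : table_at s -> den s e h K -> den s (powE e n) (h ^+ n.+1)%g (cpow K n).
Proof.
move=> tb de; elim: n => [|n IHn]; first by have [v1 c1] := de; split; rewrite ?expg1 // /cpow /powE /=; lia.
have [v1 c1] := den_tbl tb de IHn; rewrite -expgS in v1; split=> //.
by apply: leq_trans c1 _; rewrite /cpow [n.+2 * _]mulSn; lia.
Qed.

Definition cword (w : seq (option bool)) K1 K2 := cpow K1 p + size w * (K1 + K2 + (3 * N + 9)).

Lemma den_word s w e1 e2 h1 h2 K1 K2 : table_at s -> den s e1 h1 K1 -> den s e2 h2 K2 ->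
  den s (wordE w e1 e2) (wop w h1 h2) (cword w K1 K2).
Proof.
move=> tb d1 d2; elim: w => [|[[]|] w IHw].
- have [v1 c1] := den_pow p.-1 tb d1; rewrite prednK // expG in v1.
  rewrite wop_nil; split=> //; apply: leq_trans c1 _; rewrite /cword /cpow prednK // mul0n addn0.
  by rewrite leq_mul2r leqnSn orbT.
- have [v1 c1] := den_tbl tb d1 IHw; rewrite wop_cons; split=> //.
  by apply: leq_trans c1 _; rewrite /cword /= mulSn; lia.
- have [v1 c1] := den_tbl tb d2 IHw; rewrite wop_cons; split=> //.
  by apply: leq_trans c1 _; rewrite /cword /= mulSn; lia.
have [v1 c1] := IHw; rewrite wop_cons mul1g; split=> //.
by apply: leq_trans c1 _; rewrite /cword /= mulSn; lia.
Qed.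

Definition cscale K n := 1 + n * (cpow K (n + p) + 20).

Lemma den_scale s es e h K k : table_at s -> den s e h K -> eval es s = k -> ecost es s = 1 -> k < p ->
  den s (scaleE es e p) (h ^+ k)%g (cscale K p).
Proof.
move=> tb de vs cs ltk.
(* Only the term of index [k] has a nonzero factor [eqE]; it reads [h ^+ (k + p)], which is
   [h ^+ k]. *)
have step n : n <= p -> eval (scaleE es e n) s = (if k < n then index (h ^+ k)%g sG else 0) /\
    ecost (scaleE es e n) s <= 1 + n * (cpow K (p + p) + 20).
  elim: n => [|n IHn] ltn //; have [v1 c1] := IHn (ltnW ltn).
  have [v2 c2] := den_pow (n + p.-1) tb de; rewrite -addnS prednK // expgD expG mulg1 in v2.
  rewrite /scaleE iteriS -/(scaleE es e n) /=; split.
    rewrite v1 v2 vs; case: (ltngtP k n) => [lt|gt|->].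
    - by rewrite ltnS ltnW // (_ : 1 - _ = 0) ?mul0n //; lia.
    - by rewrite ltnS leqNgt gt /= (_ : 1 - _ = 0) ?mul0n //; lia.
    by rewrite ltnSn subnn mul1n addn0.
  have le2 : cpow K (n + p.-1) <= cpow K (p + p) by rewrite /cpow leq_mul2r; apply/orP; right; lia.
  by rewrite cs mulSn; lia.
have [v1 c1] := step p (leqnn p); rewrite ltk in v1; split=> //; exact: c1.
Qed.

Lemma eval_addmod s e1 e2 a b : eval e1 s = a -> eval e2 s = b -> ecost e1 s = 1 -> ecost e2 s = 1 ->
  a < p -> b < p -> eval (addmodE e1 e2) s = (a + b) %% p /\ ecost (addmodE e1 e2) s <= 30.
Proof.
move=> v1 v2 c1 c2 lta ltb; rewrite /addmodE /= v1 v2 c1 c2; split; last by lia.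
case: (leqP p (a + b)) => le.
  have -> : 1 - (p - (a + b)) = 1 by lia.
  by rewrite mul1n -{2}(subnK le) modnDr modn_small //; lia.
have -> : 1 - (p - (a + b)) = 0 by lia.
by rewrite mul0n subn0 modn_small.
Qed.

Definition elt i := nth 1%g sG i.
Definition result (a b : seq nat) : seq nat :=
  let xa := elt (nth 0 a 0) in let xb := elt (nth 0 b 0) in
  [:: index (wop wa xa xb) sG;
      (nth 0 a 1 + nth 0 b 1) %% p;
      (nth 0 a 2 + nth 0 b 2) %% p;
      index (wop wa (wop wa (elt (nth 0 a 3)) (elt (nth 0 b 3)))
                    (wop wa (wop wb xa xb) (xb ^+ nth 0 a 1)%g)) sG;
      index (wop wa (wop wa (elt (nth 0 a 4)) (elt (nth 0 b 4))) (xb ^+ nth 0 a 2)%g) sG].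

Definition ns := [:: N; p; p; N; N].

Lemma result_in_range a b : in_range (result a b) ns.
Proof. by rewrite /in_range /= !index_lt !ltn_mod p_gt0. Qed.

Definition cout :=
  cword wa 1 1 + 3 * N + 30 + (3 * (p * p) + 20 + 3 * N) + (30 + 3 * p + 30 + 3 * p + 3 * N) + (30 + 3 * p + 30 + 3 * N)
  + cword wa (cword wa 1 1) (cword wa (cword wb 1 1) (cscale 1 p)) + 3 * N + 30
  + cword wa (cword wa 1 1) (cscale 1 p) + 100.

Lemma eval_outE s a b : table_at s -> in_range a ns -> in_range b ns ->
  [seq reg s r | r <- [:: 5; 6; 7; 8; 9; 10; 11; 12; 13; 14]] = a ++ b ->
  eval outE s = code ns (result a b) /\ ecost outE s <= cout.
Proof.
(* [outE] hides behind a variable so that simplification does not unfold it. *)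
have [E eqE] : exists E, E = outE by exists outE.
rewrite -eqE; move=> tb; case: a => [|x [|s1 [|t [|u [|w [|]]]]]]; rewrite /in_range //= ?andbF //.
case: b => [|x' [|s' [|t' [|u' [|w' [|]]]]]] //= ; rewrite ?andbF // !andbT.
move=> /and5P[lx ls lt lu lw] /and5P[lx' ls' lt' lu' lw'].
case=> r5 r6 r7 r8 r9 r10 r11 r12 r13 r14.
have dreg r i : i < N -> reg s r = i -> den s (EReg r) (elt i) 1.
  by move=> lti eqi; split=> //=; rewrite eqi /elt index_uniq.
have d5 := dreg 5 _ lx r5; have d10 := dreg 10 _ lx' r10.
have d8 := dreg 8 _ lu r8; have d13 := dreg 13 _ lu' r13.
have d9 := dreg 9 _ lw r9; have d14 := dreg 14 _ lw' r14.
have [vx cx] := den_word wa tb d5 d10.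
have [vs cs] := @eval_addmod s (EReg 6) (EReg 11) _ _ r6 r11 erefl erefl ls ls'.
have [vt ct] := @eval_addmod s (EReg 7) (EReg 12) _ _ r7 r12 erefl erefl lt lt'.
have [vu cu] := den_word wa tb (den_word wa tb d8 d13) (den_word wa tb (den_word wb tb d5 d10)
   (@den_scale s (EReg 6) (EReg 10) _ 1 _ tb d10 r6 erefl ls)).
have [vw cw] := den_word wa tb (den_word wa tb d9 d14)
   (@den_scale s (EReg 7) (EReg 10) _ 1 _ tb d10 r7 erefl lt).
have [sN _ _] := tb.
(* Values and costs of the five digits are known; abstracting their expressions keeps the evaluation
   small. *)
rewrite eqE /outE; cbv zeta; move: (wordE wa (EReg 5) _) (addmodE (EReg 6) _) (addmodE (EReg 7) _)
  (wordE wa (wordE wa (EReg 8) _) _) (wordE wa (wordE wa (EReg 9) _) _) vx cx vs cs vt ct vu cu vw cw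
  => ex es et eu ew vx cx vs cs vt ct vu cu vw cw /=.
rewrite vx vs vt vu vw sN /=; split; first by ring.
have lx2 := index_lt (wop wa (elt x) (elt x')).
have ls2 : (s1 + s') %% p < p by rewrite ltn_mod.
have lt2 : (t + t') %% p < p by rewrite ltn_mod.
set iu := index (wop wa _ (wop wa _ _)) sG; have lu2 : iu < N := index_lt _.
by rewrite /cout; lia.
Qed.

Definition St (out : seq nat) s :=
  [/\ table_at s, reg s rO = (size out).+1 & forall i, i < size out -> Defs.mem s i.+1 = nth 0 out i].

(** [pre] and [vals] are the registers and values of the enclosing loops, [X] the registers that [c]
    may change besides [rO]. The output stays within [M2] cells, so the copied table is never
    overwritten. *)
Definition emits (X pre vals : seq nat) c T (out' : seq nat) :=
  forall s out, size out + size out' <= M2 -> St out s -> [seq reg s r | r <- pre] = vals ->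
  [/\ (runc c s).2 <= T, St (out ++ out') (runc c s).1
    & forall r, r \notin X -> r != rO -> reg (runc c s).1 r = reg s r].

Lemma emits_emit pre vals val T :
  (forall s, table_at s -> [seq reg s r | r <- pre] = vals -> eval (outE) s = val /\ ecost (outE) s <= T) ->
  emits [::] pre vals emit (T + 6) [:: val].
Proof.
rewrite /emit; move: outE => E hE s out; rewrite /= addn1 => ltM [tb sO outs] eqv.
have [vE cE] := hE s tb eqv; rewrite vE sO.
split=> [||r _ nO]; last by rewrite /= /upd (negPf nO).
  by lia.
have [sN sB tbl] := tb; split.
(* The cell written is at most [M2], below the base [B] of the copy. *)
- by split=> //= k ltk; rewrite /upd -tbl // ifN //; apply/eqP; rewrite /B; lia.
- by rewrite /= size_cat addn1 addn1.
move=> i; have -> : size (out ++ [:: val]) = (size out).+1 by rewrite size_cat addn1.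
rewrite ltnS /= /upd eqSS nth_cat leq_eqVlt => /predU1P[->|lti].
  by rewrite eqxx ltnn subnn.
by rewrite (ltn_eqF lti) lti outs.
Qed.

Lemma emits_for X pre vals x b c T (g : nat -> seq nat) (n := if b then N else p) :
  4 < x -> x \notin pre -> rO \notin pre -> ~~ has (mem X) pre -> 
  (forall k, k < n -> emits X (rcons pre x) (rcons vals k) c T (g k)) ->
  emits (x :: X) pre vals (For x (boundE b) c) (4 + n * (T + 4)) (flatten [seq g k | k <- iota 0 n]).
Proof.
move=> ltx npre nO dis hc s out; set tot := flatten _ => leM sts eqv.
pose I k s' := St (out ++ flatten [seq g i | i <- iota 0 k]) s' /\
  forall r, r \notin x :: X -> r != rO -> reg s' r = reg s r.
have init s' : s' = s -> [/\ eval (boundE b) s' = n, ecost (boundE b) s' <= 1 & I 0 s'].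
  move=> ->; split; [|by rewrite /boundE; case: b {n I hc tot leM}|by rewrite /I /= cats0].
  by have [[sN _ _] _ _] := sts; rewrite /n /boundE; case: (b) => //=.
have step k : k < n -> forall s', I k s' ->
    (runc c (set_reg s' x k)).2 <= T /\ I k.+1 (runc c (set_reg s' x k)).1.
  move=> ltk s' [st' rs'].
  have st1 : St (out ++ flatten [seq g i | i <- iota 0 k]) (set_reg s' x k).
    have [[sN sB tb] sO outs] := st'; split=> //; [split=> //|]; rewrite reg_set ifN //;
      by apply: contraTneq ltx => <-.
  have iotaS : iota 0 n = iota 0 k ++ k :: iota k.+1 (n - k.+1).
    by rewrite -{1}(subnKC ltk) addSnnS iotaD /= -addnS.
  have [||le st2 rs2] := hc k ltk _ _ _ st1.
  - apply: leq_trans leM; rewrite /tot iotaS map_cat flatten_cat /= !size_cat.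
    by rewrite !addnA leq_addr.
  - rewrite map_rcons reg_set eqxx; congr (rcons _ _); rewrite -eqv.
    apply/eq_in_map=> r rpre; rewrite reg_set ifN; last by apply: contraNneq npre => <-.
    apply: rs'; last by apply: contraNneq nO => <-.
    rewrite inE negb_or; apply/andP; split; first by apply: contraNneq npre => <-.
    by apply: contra dis => rX; apply/hasP; exists r.
  split=> //; split.
    by rewrite -addn1 iotaD map_cat flatten_cat /= cats0 catA.
  move=> r; rewrite inE negb_or => /andP[nrx nrX] nrO.
  by rewrite rs2 // reg_set (negPf nrx) rs' // inE negb_or nrx.
by have [le [st' rs']] := ht_for (P := fun s' => s' = s) init step (erefl s).
Qed.

Definition bnd (b : bool) := if b then N else p.
Definition tnest (xs : seq (nat * bool)) T := foldr (fun xb t => 4 + bnd xb.2 * (t + 4)) T xs.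

(** Nested loops visit tuples in the order of [combos], so the letters come out in table order. *)
Lemma emits_nest xs X pre vals c T (g : seq nat -> seq nat) :
  all (fun x => 4 < x) (unzip1 xs) -> rO \notin pre ->
  uniq (pre ++ unzip1 xs) -> ~~ has (mem X) (pre ++ unzip1 xs) ->
  (forall v', in_range v' [seq bnd b | b <- unzip2 xs] ->
     emits X (pre ++ unzip1 xs) (vals ++ v') c T (g v')) ->
  emits (unzip1 xs ++ X) pre vals (nest xs c) (tnest xs T)
    (flatten [seq g v' | v' <- combos [seq bnd b | b <- unzip2 xs]]).
Proof.
elim: xs pre vals g => [|[x b] xs IHxs] pre vals g /=.
  by move=> _ _ _ _ hc; rewrite cats0; have := hc [::] isT; rewrite !cats0.
move=> /andP[ltx ltxs] nO; rewrite -cat_rcons => uni dis hc.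
have -> : flatten [seq g v' | v' <- [seq k :: v' | k <- iota 0 (bnd b), v' <- combos [seq bnd b' | b' <- unzip2 xs]]]
  = flatten [seq flatten [seq g (k :: v') | v' <- combos [seq bnd b' | b' <- unzip2 xs]] | k <- iota 0 (bnd b)].
  by elim: (iota 0 (bnd b)) => //= k l IHl; rewrite map_cat flatten_cat -map_comp IHl.
have := uni; rewrite cat_uniq rcons_uniq => /and3P[/andP[nx _] disx _].
apply: emits_for => //.
- apply: contra dis => /hasP[r rpre]; rewrite inE /= mem_cat => /orP[rxs|rX].
    by case/negP: disx; apply/hasP; exists r => //; rewrite mem_rcons inE rpre orbT.
  by apply/hasP; exists r => //; rewrite mem_cat mem_rcons inE rpre orbT.
move=> k ltk; apply: IHxs => //.
  by rewrite mem_rcons inE negb_or nO andbT; apply: contraTneq ltx => <-.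
move=> v' rv; have := hc (k :: v'); rewrite -cat_rcons; apply.
by rewrite /in_range /= ltk.
Qed.

Definition word_out := [seq code ns (result a b) | a <- combos ns, b <- combos ns].

Definition tloops := tnest (loops 5) (tnest (loops 10) (cout + 6)).

Lemma emits_loops : emits [:: 5; 6; 7; 8; 9; 10; 11; 12; 13; 14] [::] [::]
  (nest (loops 5) (nest (loops 10) emit)) tloops word_out.
Proof.
have -> : word_out = flatten [seq flatten [seq [:: code ns (result a b)] | b <- combos ns] | a <- combos ns].
  rewrite /word_out; congr flatten; apply: eq_map => a.
  by elim: (combos ns) => //= b l ->.
have := @emits_nest (loops 5) [:: 10; 11; 12; 13; 14] [::] [::] (nest (loops 10) emit)
  (tnest (loops 10) (cout + 6)) (fun a => flatten [seq [:: code ns (result a b)] | b <- combos ns]).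
apply=> // a ra.
have := @emits_nest (loops 10) [::] [:: 5; 6; 7; 8; 9] a emit (cout + 6) (fun b => [:: code ns (result a b)]).
apply=> // b rb.
apply: (@emits_emit _ (a ++ b)) => s tb eqv.
exact: eval_outE.
Qed.

Lemma size_word_out : size word_out = M2.
Proof. by rewrite size_allpairs !size_combos /ns /M2 /=; ring. Qed.

Lemma N_gt0 : 0 < N.
Proof. by have := memG 1%g; rewrite /N; case: (sG). Qed.

Lemma size_table : size v = N * N. Proof. by rewrite size_allpairs. Qed.

Lemma M2_ge : N * N <= M2.
Proof.
have N0 := N_gt0; rewrite /M2 -[N * N]muln1; apply: leq_mul; last by rewrite expn_gt0 p_gt0.
by rewrite -[N * N]/(N ^ 2) leq_pexp2l.
Qed.

Definition tprog :=
  3 + ((1 + 3 + N * N * (3 * (N * N) + 20 + 4))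
  + ((6 * (3 * N + 5) + 1 + 1 + 1 + 1)
  + ((1 + 3 + N * N * (9 + 4)) + (2 + (tloops + 6))))).

Lemma run_program : (runc program (input_state v)).2 <= tprog /\
  output_word (runc program (input_state v)).1 = word_out.
Proof.
have N0 := N_gt0; have leM := M2_ge; have szv := size_table.
pose inp s := forall j, j < N * N -> Defs.mem s j.+1 = nth 0 v j.
have h1 : ht (fun s => s = input_state v) (Asg rQ (EMem (EConst 0))) 3
    (fun s => [/\ reg s rQ = N * N, reg s rN = 0 & inp s]).
  by move=> _ ->; split=> //; split=> //=; rewrite /upd /= szv.
have h2 : ht (fun s => [/\ reg s rQ = N * N, reg s rN = 0 & inp s]) (For ri (EReg rQ) (Asg rN rootE))
    (1 + 3 + N * N * (3 * (N * N) + 20 + 4)) (fun s => [/\ reg s rQ = N * N, reg s rN = N & inp s]).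
  (* Turn [k] adds 1 exactly when [k < N], and the [N ^ 2] turns are enough to reach [N]. *)
  pose I k s := [/\ reg s rQ = N * N, reg s rN = minn k N & inp s].
  have := @ht_for I (fun s => [/\ reg s rQ = N * N, reg s rN = 0 & inp s]) ri (EReg rQ) (Asg rN rootE) (N * N) 1 (3 * (N * N) + 20).
  move=> hf s Ps; have [||le [q1 q2 q3]] := hf _ _ s Ps.
  - by move=> s' [q1 q2 q3]; split=> //; split; rewrite ?q2 ?min0n.
  - move=> k ltk s' [q1 q2 q3]; rewrite /= /upd /= q1 q2; split; first by lia.
    split=> //=; rewrite /upd /=; case: (ltnP k N) => [ltkN|leNk].
      have : k * k < N * N by apply: ltn_mul.
      by lia.
    have : N * N <= k * k by apply: leq_mul.
    by lia.
  split=> //; split=> //; rewrite q2; apply/minn_idPr; by rewrite leq_pmulr.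
have h3 : ht (fun s => [/\ reg s rQ = N * N, reg s rN = N & inp s]) (Asg rB baseE)
    (6 * (3 * N + 5) + 1 + 1 + 1 + 1) (fun s => [/\ reg s rQ = N * N, reg s rN = N, reg s rB = B & inp s]).
  move=> s [q1 q2 q3]; rewrite /= q2; split; first by lia.
  by split=> //=; rewrite /upd /= /B /M2; ring.
have h4 : ht (fun s => [/\ reg s rQ = N * N, reg s rN = N, reg s rB = B & inp s])
    (For ri (EReg rQ) (Put (EAdd (EReg rB) (EReg ri)) (EMem (EAdd (EConst 1) (EReg ri)))))
    (1 + 3 + N * N * (9 + 4)) table_at.
  pose I k s := [/\ reg s rQ = N * N, reg s rN = N, reg s rB = B, inp s
    & forall j, j < k -> Defs.mem s (B + j) = nth 0 v j].
  have := @ht_for I (fun s => [/\ reg s rQ = N * N, reg s rN = N, reg s rB = B & inp s]) ri (EReg rQ)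
    (Put (EAdd (EReg rB) (EReg ri)) (EMem (EAdd (EConst 1) (EReg ri)))) (N * N) 1 9.
  move=> hf s Ps; have [||le [q1 q2 q3 q4 q5]] := hf _ _ s Ps; last by split.
  - by move=> s' [q1 q2 q3 q4].
  move=> k ltk s' [q1 q2 q3 q4 q5]; rewrite /= /upd /= q3; split=> //.
  split=> //= j ltj; rewrite /= /upd /=.
    by rewrite ifN ?q4 //; apply/eqP; rewrite /B; lia.
  rewrite eqn_add2l; move: ltj; rewrite ltnS leq_eqVlt => /predU1P[->|ltjk].
    by rewrite eqxx q4.
  by rewrite (ltn_eqF ltjk) q5.
have h5 : ht table_at (Asg rO (EConst 1)) 2 (St [::]).
  by move=> s tb; split=> //; split.
have h6 : ht (St [::]) (nest (loops 5) (nest (loops 10) emit)) tloops (St word_out).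
  by move=> s st; have [|//|le st' _] := emits_loops _ st; rewrite ?size_word_out.
have h7 : ht (St word_out) (Put (EConst 0) (ESub (EReg rO) (EConst 1))) 6
    (fun s => output_word s = word_out).
  move=> s [_ sO outs]; split=> //; rewrite /output_word /= /upd /= sO subn1 /=.
  apply: (@eq_from_nth _ 0); rewrite size_mkseq // => i lti.
  by rewrite nth_mkseq // outs.
exact: (ht_seq h1 (ht_seq h2 (ht_seq h3 (ht_seq h4 (ht_seq h5 (ht_seq h6 h7)))))) (erefl _).
Qed.

(** The program owns registers 0 to 14, so scratch space starts at 15. *)
Lemma outputs_program : outputs_within (ccomp 15 program) v tprog word_out.
Proof.
have [le outw] := run_program.
have [s' [[t let' ex] ag _]] := ccompP (leqnn 15) cbelow_program (agree_refl 15 (input_state v)).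
exists t, s'; split=> //; first exact: leq_trans let' le.
by rewrite -outw /output_word (proj1 ag).
Qed.

End Run.
End Program.

(** * The table of the extension *)

Section GadgetTable.
Variables (p : nat) (D : lazard_data p) (sG : seq (ld_gT D)).
Hypotheses (uniqG : uniq sG) (memG : forall x, x \in sG).
Local Notation L := (lazard_alg D).
Local Notation pr := (ld_prime D).
Local Notation shape := (ns p sG).

Definition dec (a : seq nat) : gadget L :=
  (((elt sG (nth 0 a 0) : L), (nth 0 a 1)%:R%R, (nth 0 a 2)%:R%R),
   ((elt sG (nth 0 a 3) : L), (elt sG (nth 0 a 4) : L))).

Lemma eltK x : elt sG (index x sG) = x. Proof. exact: nth_index. Qed.

Lemma dec_result a b : in_range a shape ->
  dec (result p (ld_wa D) (ld_wb D) sG a b) = (dec a * dec b)%g.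
Proof.
case: a => [|x [|s [|t [|u [|w [|]]]]]]; rewrite /in_range //= ?andbF //.
rewrite !andbT => /and5P[_ ls lt _ _].
rewrite gadgetM /dec /result /= !eltK !(Fp_nat_mod pr) !natrD.
have scaleE k (y : L) : k < p -> ((k%:R : 'F_p) *: y)%R = ((y : ld_gT D) ^+ k)%g.
  by move=> ltk; rewrite lazard_scaleE (val_Fp_nat pr) modn_small.
by rewrite /cocycle /= !scaleE.
Qed.

Lemma dec_inj : {in combos shape &, injective dec}.
Proof.
have FpI j k : j < p -> k < p -> (j%:R = k%:R :> 'F_p)%R -> j = k.
  by move=> ltj ltk /(congr1 val); rewrite /= !(val_Fp_nat pr) !modn_small.
have eltI i j : i < size sG -> j < size sG -> elt sG i = elt sG j -> i = j.
  by move=> lti ltj /eqP; rewrite nth_uniq // => /eqP.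
move=> a b; rewrite !mem_combos.
case: a => [|x [|s [|t [|u [|w [|]]]]]]; rewrite /in_range //= ?andbF //.
case: b => [|x' [|s' [|t' [|u' [|w' [|]]]]]]; rewrite /in_range //= ?andbF // !andbT.
move=> /and5P[lx ls lt lu lw] /and5P[lx' ls' lt' lu' lw'] eqd.
have /(eltI _ _ lx lx')-> := congr1 (fun a : gadget L => a.1.1.1 : ld_gT D) eqd.
have /(FpI _ _ ls ls')-> := congr1 (fun a : gadget L => a.1.1.2) eqd.
have /(FpI _ _ lt lt')-> := congr1 (fun a : gadget L => a.1.2) eqd.
have /(eltI _ _ lu lu')-> := congr1 (fun a : gadget L => a.2.1 : ld_gT D) eqd.
by have /(eltI _ _ lw lw')-> := congr1 (fun a : gadget L => a.2.2 : ld_gT D) eqd.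
Qed.

Lemma dec_surj (z : gadget L) : exists2 a, a \in combos shape & z = dec a.
Proof.
case: z => [[[x s] t] [u w]].
exists [:: index (x : ld_gT D) sG; s : nat; t : nat; index (u : ld_gT D) sG; index (w : ld_gT D) sG].
  have ltF (r : 'F_p) : r < p by have := ltn_ord r; rewrite [X in _ < X](Fp_cast pr).
  by rewrite mem_combos /in_range /= !index_mem !memG !ltF.
by rewrite /dec /= !eltK !natr_Zp.
Qed.

(** The elements are listed by decoding [combos shape]; [dec] is injective there and turns [result]
    into the product, so the position of a product is the code of its digits. *)
Lemma cayley_gadget : cayley_table [set: gadget L]%G (word_out p (ld_wa D) (ld_wb D) sG).
Proof.
exists [seq dec a | a <- combos shape]; split.
- by rewrite map_inj_in_uniq ?combos_uniq //; apply: dec_inj.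
- move=> z; rewrite inE; have [a ia ->] := dec_surj z; exact: map_f.
rewrite /word_out allpairs_mapl allpairs_mapr; apply/eq_in_allpairs => a b ia ib.
have rr := result_in_range (ld_wa D) (ld_wb D) (prime_gt0 pr) memG a b.
have [ltc eqc] := nth_combos rr.
rewrite -dec_result -?mem_combos // -{2}eqc -(nth_map _ 1%g) // index_uniq ?size_map //.
by rewrite map_inj_in_uniq ?combos_uniq //; apply: dec_inj.
Qed.

End GadgetTable.

(** * Polynomial bounds and the conclusion *)

Definition poly_bounded (f : forall gT : finGroupType, seq gT -> nat) :=
  exists P : {poly nat}, forall (gT : finGroupType) (s : seq gT), f gT s <= (P.[size s])%R.

Lemma pb_const k : poly_bounded (fun _ _ => k).
Proof. by exists (k%:P)%R => gT s; rewrite hornerC. Qed.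

Lemma pb_size : poly_bounded (fun _ s => size s).
Proof. by exists 'X%R => gT s; rewrite hornerX. Qed.

Lemma pb_add f g : poly_bounded f -> poly_bounded g -> poly_bounded (fun gT s => f gT s + g gT s).
Proof.
by move=> [P Pf] [Q Qg]; exists (P + Q)%R => gT s; rewrite hornerD; apply: leq_add.
Qed.

Lemma pb_mul f g : poly_bounded f -> poly_bounded g -> poly_bounded (fun gT s => f gT s * g gT s).
Proof.
by move=> [P Pf] [Q Qg]; exists (P * Q)%R => gT s; rewrite hornerM; apply: leq_mul.
Qed.

(** [p] and the words are constants, so the time is built from the size by sums and products; the
    polynomial need not be written out. *)
Lemma pb_tprog p wa wb : poly_bounded (fun gT s => @tprog p wa wb gT s).
Proof.
rewrite /tprog /tloops /tnest /loops /= /bnd /cout /cword /cscale /cpow.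
repeat first [exact: pb_const | exact: pb_size | apply: pb_add | apply: pb_mul].
Qed.

(** Passing to the type [subg_of G] makes the group a whole type while its table stays literally the
    same. *)
Lemma group_data (p c N : nat) (gT : finGroupType) (G : {group gT}) (w : seq nat) :
  prime p -> 0 < c -> in_B p c N G -> cayley_table G w ->
  exists sG : seq (subg_of G),
    [/\ uniq sG, forall x, x \in sG, size sG = N
      & w = [seq index (x * y)%g sG | x <- sG, y <- sG]] /\
    [/\ class_exponent p c (subg_of G), (p.-group [set: subg_of G])%g,
        abelian [set: subg_of G] = (c == 1), #|{: subg_of G}| = N & 1 < N].
Proof.
move=> p_pr c_gt0 [pG clG exG cardG] [s [us memS ->]].
have isoG := isog_subg G.
have subgI : {in s &, injective (subg G)}.
  by move=> x y; rewrite !memS => Gx Gy /(congr1 sgval); rewrite !subgK.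
have sGi x : x \in G -> index (subg G x) [seq subg G y | y <- s] = index x s.
  move=> Gx; have xs : x \in s by rewrite memS.
  rewrite -{1}(nth_index 1%g xs) -(nth_map _ 1%g) ?index_mem // index_uniq ?size_map ?index_mem //.
  by rewrite map_inj_in_uniq.
have cardS : #|{: subg_of G}| = N by rewrite -cardsT -(card_isog isoG).
exists [seq subg G x | x <- s]; split; split=> //.
- by rewrite map_inj_in_uniq.
- by move=> x; rewrite -(sgvalK x) map_f // memS subgP.
- by rewrite size_map -cardG -(eq_card memS); apply/esym/card_uniqP.
- rewrite allpairs_mapl allpairs_mapr; apply/eq_in_allpairs => x y; rewrite !memS => Gx Gy.
  by rewrite -sGi ?groupM // -subgM.
- split=> [x|].
    apply: val_inj; rewrite /= [sgval _](morphX (sgval_morphism G)) ?inE //.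
    by rewrite -exG expg_exponent ?subgP.
  apply/(lcn_nil_classP c); last by rewrite -(isog_nil_class isoG) clG.
  by rewrite -(isog_nil isoG) (pgroup_nil pG).
- by rewrite /pgroup cardsT cardS -cardG.
(* Class 0 is excluded by [c_gt0], so abelian means class exactly 1. *)
- by rewrite -(isog_abelian isoG) -nil_class1 clG; case: (c) c_gt0 => [|[|]].
rewrite -cardG cardG_gt1; apply: contraTneq c_gt0 => G1.
by rewrite -clG lt0n negbK nil_class0 G1.
Qed.

Theorem theorem1p2 (p c : nat) (p_prime : prime p) (c_gt0 : 0 < c)
    (c_lt_p : c < p) (not_2_1 : ~ (p = 2 /\ c = 1)) :
  exists (A : prog) (time order : {poly nat}),
    forall (N : nat) (gT hT : finGroupType) (G : {group gT}) (H : {group hT})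
           (v w : seq nat),
      in_B p c N G -> in_B p c N H ->
      cayley_table G v -> cayley_table H w ->
      exists (v' w' : seq nat) (aT bT : finGroupType)
             (AG : {group aT}) (AH : {group bT}) (M M' : nat),
        [/\ outputs_within A v time.[N]%R v' /\
              outputs_within A w time.[N]%R w',
            cayley_table AG v' /\ cayley_table AH w',
            in_B p 2 M AG /\ in_B p 2 M' AH,
            M <= order.[N]%R /\ M' <= order.[N]%R
          & (G \isog H)%g <-> (AG \isog AH)%g].
Proof.
have p_gt2 : 2 < p.
  rewrite ltn_neqAle prime_gt1 // andbT; apply: contra_not_neq not_2_1 => p2; split=> //.
  by move: c_gt0 c_lt_p; rewrite -p2; case: (c) => [|[|]].
have p_gt0 := prime_gt0 p_prime.
have [wa [wb ws]] := exists_lazard_words p_prime c_lt_p c_gt0.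
have [time timeP] := pb_tprog p wa wb.
(* The extension has order [N ^ 3 * p ^ 2], with [p] a constant. *)
have [order orderP] : poly_bounded (fun _ s => size s * size s * size s * (p * p)).
  by repeat first [exact: pb_const | exact: pb_size | apply: pb_mul].
exists (ccomp 15 (program p wa wb)), time, order => N gT hT G H v w BG BH tG tH.
have [sG [[uG mG szG ->] [ceG pG abG cardG N1]]] := group_data p_prime c_gt0 BG tG.
have [sH [[uH mH szH ->] [ceH pH abH cardH _]]] := group_data p_prime c_gt0 BH tH.
pose DG := LazardData p_prime c_lt_p c_gt0 ws ceG.
pose DH := LazardData p_prime c_lt_p c_gt0 ws ceH.
have outG := outputs_program wa wb p_gt0 (proj1 ceG) uG mG.
have outH := outputs_program wa wb p_gt0 (proj1 ceH) uH mH.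
have le_out t t' x y : t <= t' -> outputs_within (ccomp 15 (program p wa wb)) x t y ->
    outputs_within (ccomp 15 (program p wa wb)) x t' y.
  by move=> le [u [s [leu ex eqy]]]; exists u, s; split=> //; apply: leq_trans le.
have inB (kT : finGroupType) (ce : class_exponent p c kT) : (p.-group [set: kT])%g -> #|kT| = N ->
    in_B p 2 (N ^ 3 * p ^ 2) [set: gadget (lazard_alg (LazardData p_prime c_lt_p c_gt0 ws ce))]%G.
  move=> pK cardK; rewrite -cardK; apply: gadget_in_B => //; first by rewrite -[#|_|]/(#|kT|) cardK.
  by move: pK; rewrite /pgroup cardsT.
have leo : N ^ 3 * p ^ 2 <= order.[N]%R.
  by rewrite -{2}szG; apply: leq_trans (orderP _ sG); rewrite szG; apply: eq_leq; ring.
exists (word_out p wa wb sG), (word_out p wa wb sH), (gadget (lazard_alg DG)), (gadget (lazard_alg DH)).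
exists [set: gadget (lazard_alg DG)]%G, [set: gadget (lazard_alg DH)]%G, (N ^ 3 * p ^ 2), (N ^ 3 * p ^ 2).
split.
- split; [apply: le_out outG | apply: le_out outH].
    by rewrite -szG; apply: timeP.
  by rewrite -szH; apply: timeP.
- split; [exact: (@cayley_gadget p DG sG) | exact: (@cayley_gadget p DH sH)].
- by split; apply: inB.
- by [].
have isoG := isog_subg G; have isoH := isog_subg H.
have eqiso : (G \isog H)%g <-> ([set: subg_of G] \isog [set: subg_of H])%g.
  split=> iso; first by apply: isog_trans (isog_trans iso isoH); rewrite isog_sym.
  by apply: isog_trans isoG (isog_trans iso _); rewrite isog_sym.
rewrite eqiso; split; first exact: isog_lazard.
have eqc : #|{: subg_of G}| = #|{: subg_of H}| by rewrite cardG cardH.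
(* In class one the bracket is zero and the order may be as small as [p], out of reach of
   [lazard_isogP]; both groups are then elementary abelian of the same order. *)
have [c1|c1] := eqVneq c 1; last first.
  by apply: (lazard_isogP p_gt2 pG pH eqc); rewrite ?abG ?abH.
move=> _; have abel (kT : finGroupType) : class_exponent p c kT -> abelian [set: kT] = (c == 1) ->
    (p.-abelem [set: kT])%g.
  by move=> [eK _] abK; rewrite abelemE // abK c1; apply/exponentP=> x _; apply: eK.
by rewrite (isog_abelem_card _ (abel _ ceG abG)) (abel _ ceH abH) !cardsT eqc /=.
Qed.
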